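(* Consider the triggered urn model described in the context and suppose there is $p<1$ with $p_n\le p$ for all $n\ge1$. Let $C_\infty=\sup_n C_n$ be the total number of colors ever observed. (1) If $\sum_{n=1}^\infty 1/F(n)<\infty$, then almost surely exactly one color is observed infinitely many times, all other colors being observed a finite number of times. (2) If $\sum_{n=1}^\infty 1/F(n)=\infty$, then almost surely every observed color is observed infinitely often, i.e. $K_{n,c}\uparrow\infty$ as $n\to\infty$ for every color $c$ with $1\le c\le C_\infty$.
   Context: Triggered (FAQ) urn model. The urn is empty at time $0$. Let $B_0=1$ and let $(B_n)_{n\ge1}$ be independent Bernoulli random variables with $\Pr(B_n=1)=p_n\in(0,1)$, independent of everything else in the construction. Let $F:[1,\infty)\to[0,\infty)$ be strictly increasing with $F(1)>0$ (the update function). Colors are labelled $1,2,\dots$ in order of first appearance, and a history sequence $\mathcal S=(S_n)_{n\ge1}$ records one color per time step. For a color $c$, $K_{n,c}$ denotes the number of times $c$ has been registered in $\mathcal S$ up to and including time $n$; at time $n$ the urn contains, for each color $c$ already present, a weight $F(K_{n,c})$. At each time $n\ge1$: if $B_{n-1}=1$, a new color is added with weight $F(1)$ and registered in $\mathcal S$; if $B_{n-1}=0$, a color $c$ among those present is drawn with probability $F(K_{n-1,c})/\sum_{c'}F(K_{n-1,c'})$ (sum over colors present at time $n-1$), registered in $\mathcal S$, and its weight becomes $F(K_{n,c})$. $C_n=\sum_{i=0}^{n-1}B_i$ is the number of distinct colors present at time $n$. *)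

(* Defs.v *)
From HB Require Import structures.
From mathcomp Require Import all_boot all_order all_algebra.
From mathcomp Require Import all_classical all_reals all_analysis.
Set Implicit Arguments. Unset Strict Implicit. Unset Printing Implicit Defensive.
Import Order.TTheory GRing.Theory Num.Theory.
Local Open Scope ring_scope.
Local Open Scope classical_set_scope.

(* Triggered (FAQ) urn model.
   A realisation is described by b : nat -> bool (b i = B_i) and
   s : nat -> nat (s k = S_k, the color registered at time k >= 1;
   s 0 is irrelevant).  Colors are 1, 2, 3, ... *)

Definition ncol (b : nat -> bool) (n : nat) : nat := \sum_(i < n) (b i : nat).

Definition kcount (s : nat -> nat) (n c : nat) : nat :=
  \sum_(1 <= k < n.+1) (s k == c : nat).

Section Law.
Variables (R : realType) (F : R -> R) (p : nat -> R).

(* factor of the joint law coming from B_i (B_0 = 1 deterministically,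
   B_i ~ Bernoulli(p_i) for i >= 1) *)
Definition bfac (b : nat -> bool) (i : nat) : R :=
  if i == 0%N then (b 0%N)%:R else if b i then p i else 1 - p i.

(* conditional probability that S_k = s k given the past (k >= 1):
   if B_{k-1} = 1 a new color (label C_{k-1}+1) is registered,
   otherwise a present color c in 1..C_{k-1} is drawn with probability
   F(K_{k-1,c}) / sum_{c'} F(K_{k-1,c'}). *)
Definition trans (b : nat -> bool) (s : nat -> nat) (k : nat) : R :=
  if b k.-1 then (s k == (ncol b k.-1).+1)%:R
  else if (1 <= s k <= ncol b k.-1)%N then
    F (kcount s k.-1 (s k))%:R /
      \sum_(1 <= c < (ncol b k.-1).+1) F (kcount s k.-1 c)%:R
  else 0.

Definition urn_law (n : nat) (b : nat -> bool) (s : nat -> nat) : R :=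
  (\prod_(i < n) bfac b i) * \prod_(1 <= k < n.+1) trans b s k.

End Law.

Definition is_triggered_urn (R : realType) (d : measure_display)
  (T : measurableType d) (P : probability T R) (F : R -> R) (p : nat -> R)
  (B : nat -> T -> bool) (S : nat -> T -> nat) : Prop :=
  (forall n (x : bool), measurable [set w : T | B n w = x]) /\
  (forall n (x : nat), measurable [set w : T | S n w = x]) /\
  (forall n (b : nat -> bool) (s : nat -> nat),
     P [set w : T | (forall i, (i < n)%N -> B i w = b i) /\
                (forall k, (1 <= k <= n)%N -> S k w = s k)]
     = (urn_law F p n b s)%:E).

(* Main.v *)
Require Import Defs.
From HB Require Import structures.
From mathcomp Require Import all_boot all_order all_algebra.
From mathcomp Require Import all_classical all_reals all_analysis.
From mathcomp Require Import ring lra zify.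
Import Order.TTheory GRing.Theory Num.Theory.
Import numFieldNormedType.Exports.
Local Open Scope ring_scope.
Local Open Scope classical_set_scope.

(** Give a color drawn [j] times an exponential clock of rate [f j = F j]; the
    draws of the urn follow these clocks (Rubin's embedding). The proof only
    uses the traces of this picture on the discrete chain: explicit
    supermartingales, with [\prod (1 + t * speed)] in place of [exp (t * time)].
    The product [growth f t k = \prod_(1 <= i < k) (1 + t / f i)] is the inverse
    of the Laplace transform at [t] of the time a newborn needs to reach level [k].

    Some color is drawn infinitely often. As long as no color has reached
    level [k], the population grows at a rate below [k ^ (1/32)], since a draw
    brings only boundedly many newborns on average; on the other hand each
    color reaches level [k] within a comparable delay with probability about
    [1 / growth]. Hence some color is at level [k] by a time [n] of order
    [k ^ 4 * growth f (2 * k ^ (1/32)) k ^ 3], with probability tending to 1.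
    If [f j >= j ^ (3/4)] eventually, then [\sum_(j >= k) 1 / (f j) ^ 2] is a
    negative power of [k], so the fluctuations of a leader at level [k] live on
    a time scale much shorter than [k ^ (-1/32)], and with probability tending
    to 1 no color born after time [n] ever overtakes the finitely many colors
    present at time [n]; one of these is then drawn infinitely often. If
    [f k < k ^ (3/4)] for infinitely many [k], then reaching level [k] takes a
    time of order [log k], so the clock of any fixed color rings again.

    If [\sum 1 / f] diverges, a color drawn infinitely often leaves no other
    color undrawn forever. If [\sum 1 / f] converges, let
    [u j = \prod_(1 <= i < j) (1 - 'i * t / f i)]; for two colors with
    multiplicities [a] and [b], [u a * (u b)^*] is a bounded martingale. When
    both colors are drawn infinitely often its limit has maximal modulus,
    while as [t] grows its initial value becomes negligible, as does its limit
    when one of the colors stops; so two infinite colors have probability 0. *)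

(** * The 32nd root as a slowly growing scale *)

Section Root32.
Variable R : realType.

(* The 32nd root: any small enough power of [k] would do. *)
Definition rt (k : nat) : R :=
  Num.sqrt (Num.sqrt (Num.sqrt (Num.sqrt (Num.sqrt k%:R)))).

Lemma rt_ge0 k : 0 <= rt k. Proof. exact: sqrtr_ge0. Qed.

Lemma rtX k : rt k ^+ 32 = k%:R.
Proof.
rewrite /rt -[32%N]/(2 * (2 * (2 * (2 * 2))))%N !exprM.
by rewrite !sqr_sqrtr ?sqrtr_ge0 ?ler0n.
Qed.

Lemma rt_le k l : (k <= l)%N -> rt k <= rt l.
Proof. by move=> kl; rewrite /rt !ler_wsqrtr// ler_nat. Qed.

Lemma rt_ge1 k : (0 < k)%N -> 1 <= rt k.
Proof.
move=> k0; rewrite -(@ler_pXn2r _ 32) ?nnegrE ?rt_ge0//.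
by rewrite rtX expr1n ler1n.
Qed.

Lemma rt_gt0 k : (0 < k)%N -> 0 < rt k.
Proof. by move=> /rt_ge1; exact: lt_le_trans. Qed.

Lemma nat_large (Y : R) : exists k0, forall k, (k0 <= k)%N -> Y <= k%:R.
Proof.
exists (Num.bound `|Y|) => k hk; apply: (le_trans (ler_norm _)).
by apply: (le_trans (ltW (archi_boundP (normr_ge0 _)))); rewrite ler_nat.
Qed.

Lemma rt_large (Y : R) : exists k0, forall k, (k0 <= k)%N -> Y <= rt k.
Proof.
have [k0 h] := nat_large (`|Y| ^+ 32).
exists k0 => k hk; apply: (le_trans (ler_norm _)).
by rewrite -(@ler_pXn2r _ 32) ?nnegrE ?rt_ge0// rtX h.
Qed.

End Root32.
Arguments rt {R}.

(** * Growth products and weights *)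

Section Growth.
Variables (R : realType) (f : nat -> R).
Hypothesis f_gt0 : forall j, (0 < j)%N -> 0 < f j.
Hypothesis f_le : forall i j, (0 < i)%N -> (i <= j)%N -> f i <= f j.

Definition growth (t : R) (j : nat) : R := \prod_(1 <= i < j) (1 + t / f i).

Lemma growth1 t : growth t 1 = 1.
Proof. by rewrite /growth big_geq. Qed.

Lemma growthS t j : (0 < j)%N -> growth t j.+1 = growth t j * (1 + t / f j).
Proof. by move=> j0; rewrite /growth big_nat_recr. Qed.

Lemma growth_fac_ge1 t j : 0 <= t -> (0 < j)%N -> 1 <= 1 + t / f j.
Proof. by move=> t0 j0; rewrite lerDl divr_ge0// ltW// f_gt0. Qed.

Lemma growth_ge1 t j : 0 <= t -> 1 <= growth t j.
Proof.
move=> t0; rewrite /growth big_nat_cond.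
elim/big_rec: _ => // i x /andP[/andP[i1 _] _] x1.
by rewrite mulr_ege1// growth_fac_ge1.
Qed.

Lemma growth_gt0 t j : 0 <= t -> 0 < growth t j.
Proof. by move=> /growth_ge1 h; apply: lt_le_trans (h j). Qed.

Lemma growth_le t i j : 0 <= t -> (i <= j)%N -> growth t i <= growth t j.
Proof.
move=> t0; elim: j => [|j IH]; first by rewrite leqn0 => /eqP->.
rewrite leq_eqVlt => /orP[/eqP->//|]; rewrite ltnS => /IH.
case: (posnP j) => [->|j0] le_ij; first by rewrite growth1 (le_trans le_ij)// /growth big_geq.
rewrite growthS// (le_trans le_ij)// ler_peMr ?growth_fac_ge1//.
by rewrite ltW// growth_gt0.
Qed.

Lemma growth_fac_le (s t : R) j : s <= t -> (0 < j)%N -> 1 + s / f j <= 1 + t / f j.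
Proof. by move=> st j0; rewrite lerD2l ler_pM2r// invr_gt0 f_gt0. Qed.

Lemma growth_le_param (s t : R) j : 0 <= s -> s <= t -> growth s j <= growth t j.
Proof.
move=> s0 st; rewrite /growth [leLHS]big_nat_cond [leRHS]big_nat_cond.
apply: ler_prod => i /andP[/andP[i1 _] _].
by rewrite growth_fac_le// andbT (le_trans ler01)// growth_fac_ge1.
Qed.

(** The quotient is the product of [1 / (1 + t / f i)] over [j <= i < m], and each factor decreases
    in [t]. This allows a rate that increases with the level of the leader. *)
Lemma growth_ratio (s t : R) j m : 0 <= s -> s <= t -> (0 < j)%N -> (j <= m)%N ->
  growth t j / growth t m <= growth s j / growth s m.
Proof.
move=> s0 st j0; have t0 := le_trans s0 st.
have D0 := growth_gt0.
elim: m => [|m IH]; first by case: j j0.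
rewrite leq_eqVlt => /orP[/eqP->|]; first by rewrite !divff// gt_eqF// D0.
rewrite ltnS => jm; have m0 : (0 < m)%N by apply: leq_trans jm.
rewrite !growthS// !invfM !mulrA ler_pM ?IH//.
- by rewrite divr_ge0// ltW// D0.
- by rewrite invr_ge0 (le_trans ler01)// growth_fac_ge1.
rewrite lef_pV2 ?posrE ?(lt_le_trans ltr01) ?growth_fac_ge1//.
exact: growth_fac_le.
Qed.

(** The first [J] factors suffice, each being at least [t / f J]. With [t = rt m] and [J] a multiple
    of 32 this beats a power of [m], up to a constant that depends only on [f] and [J]. *)
Lemma growth_lower t J l : 0 <= t -> (0 < J)%N -> (J < l)%N ->
  (t / f J) ^+ J <= growth t l.
Proof.
move=> t0 J0 Jl; apply: le_trans (growth_le _ _ _ t0 Jl).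
rewrite /growth -{2}[J](subn1 J.+1) -prodr_const_nat [leLHS]big_nat_cond [leRHS]big_nat_cond.
apply: ler_prod => i /andP[/andP[i1 iJ] _].
rewrite divr_ge0 ?(ltW (f_gt0 _ J0))//=.
rewrite (le_trans (y := t / f i))//; last by rewrite lerDr.
by rewrite ler_wpM2l// lef_pV2 ?posrE ?f_gt0// f_le// -ltnS.
Qed.

Variable C : R.
Hypothesis C_ge0 : 0 <= C.

(** Chosen so that [growth t l * leak k l >= 1] as soon as [t >= rt (maxn l k)]. With [maxn l k] in
    the rate, the losses have a finite total that vanishes as [k] grows. *)
Definition leak (k l : nat) : R := (growth (rt (maxn l k)) l)^-1.
Definition damp (k j : nat) : R := 1 - C * \sum_(2 <= l < j.+1) leak k l.

Lemma damp1 k : damp k 1 = 1.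
Proof. by rewrite /damp big_geq// mulr0 subr0. Qed.

Lemma leak_ge0 k l : 0 <= leak k l.
Proof. by rewrite invr_ge0 ltW// growth_gt0// rt_ge0. Qed.

Lemma damp_le1 k j : damp k j <= 1.
Proof. by rewrite gerBl mulr_ge0// sumr_ge0// => i _; rewrite leak_ge0. Qed.

Lemma dampS k j : (0 < j)%N -> damp k j.+1 = damp k j - C * leak k j.+1.
Proof. by move=> j0; rewrite /damp big_nat_recr//= mulrDr opprD addrA. Qed.

Lemma sum_inv_sqr_max k j : (0 < k)%N ->
  \sum_(1 <= l < j.+1) ((maxn l k)%:R ^+ 2)^-1 <= 2 / k%:R :> R.
Proof.
move=> k0; have k0' : 0 < k%:R :> R by rewrite ltr0n.
(* The induction needs a sharper form: up to [k] the terms are constant, and beyond [k] the term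
   [1 / l ^ 2] is at most [1 / (l - 1) - 1 / l]. *)
suff: \sum_(1 <= l < j.+1) ((maxn l k)%:R ^+ 2)^-1 <=
  (if (j <= k)%N then j%:R / k%:R ^+ 2 else 2 / k%:R - 1 / j%:R) :> R.
  move=> /le_trans; apply; case: leqP => [jk|kj].
    rewrite expr2 invfM mulrA ler_pM2r ?invr_gt0//.
    by rewrite ler_pdivrMr// (le_trans (y := k%:R)) ?ler_nat// ler_peMl// ?ltW// ltr1n.
  by rewrite gerBl divr_ge0.
elim: j => [|j IH]; first by rewrite big_geq// mul0r.
rewrite big_nat_recr//=; case: (ltngtP j k) IH => [jk IH|kj IH|-> IH].
- have m0 : 0 < (maxn j.+1 k)%:R :> R by rewrite ltr0n (leq_trans k0)// leq_maxr.
  have m1 : k%:R <= (maxn j.+1 k)%:R :> R by rewrite ler_nat leq_maxr.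
  rewrite -natr1 mulrDl mul1r; apply: lerD => //.
  rewrite lef_pV2 ?posrE ?exprn_gt0//.
  by rewrite lerXn2r ?nnegrE ?(ltW m0) ?(ltW k0').
- rewrite (maxn_idPl _); last by lia.
  apply: (le_trans (lerD IH (lexx _))).
  rewrite -addrA lerD2l -lerBrDl opprK.
  have j0 : 0 < j%:R :> R by rewrite ltr0n; lia.
  have j1 : 0 < j.+1%:R :> R by rewrite ltr0n.
  have -> : - (1 / j.+1%:R) + 1 / j%:R = (j%:R * j.+1%:R)^-1 :> R.
    by rewrite -natr1; field; rewrite ?(natr1,nat1r) !gt_eqF.
  rewrite lef_pV2 ?posrE ?mulr_gt0 ?exprn_gt0// expr2 ler_pM2r//.
  by rewrite ler_nat.
rewrite (maxn_idPl _)//.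
apply: (le_trans (lerD IH (lexx _))).
have k1 : 0 < k.+1%:R :> R by rewrite ltr0n.
rewrite -subr_ge0.
have -> : 2 / k%:R - 1 / k.+1%:R - (k%:R / k%:R ^+ 2 + (k.+1%:R ^+ 2)^-1) =
  (k%:R * (k.+1%:R) ^+ 2)^-1 :> R.
  by rewrite -natr1; field; rewrite ?(natr1,nat1r) !gt_eqF.
by rewrite invr_ge0 mulr_ge0 ?exprn_ge0 ?ltW.
Qed.

(** Write [m = maxn l k]. For [l > 64] the first 64 factors contribute [rt m ^ 64 = m ^ 2], up to
    the constant [f 64 ^ 64]; for smaller [l] the first factor alone gives a bound that vanishes as
    [k] grows. *)
Lemma leak_bound k l : (0 < k)%N -> (1 < l)%N ->
  leak k l <= (if (l <= 64)%N then f 1 / rt k else 0) +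
              f 64 ^+ 64 * ((maxn l k)%:R ^+ 2)^-1.
Proof.
move=> k0 l1; have rk := rt_gt0 R k k0.
have lk : (k <= maxn l k)%N by rewrite leq_maxr.
have f1 := f_gt0 1 isT; have f64 := f_gt0 64 isT.
have m0 : (0 < maxn l k)%N by rewrite leq_max k0 orbT.
have rm := rt_gt0 R _ m0.
case: leqP => l64.
  apply: (le_trans (y := f 1 / rt k)).
    rewrite -invf_div lef_pV2 ?posrE ?growth_gt0 ?rt_ge0 ?divr_gt0//.
    apply: le_trans (growth_le _ _ _ (rt_ge0 _ _) l1).
    rewrite growthS// growth1 mul1r.
    rewrite (le_trans (y := rt (maxn l k) / f 1)) ?lerDr//.
    by rewrite ler_pM2r ?invr_gt0// rt_le.
  by rewrite lerDl mulr_ge0// ?invr_ge0 ?exprn_ge0// ltW.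
rewrite add0r -invf_div lef_pV2 ?posrE ?growth_gt0 ?rt_ge0//; last first.
  by rewrite divr_gt0 ?exprn_gt0// ltr0n.
apply: le_trans (growth_lower _ _ _ (rt_ge0 _ _) _ l64) => //.
by rewrite expr_div_n -[X in rt _ ^+ X]/(32 * 2)%N exprM rtX.
Qed.

Lemma damp_large : exists k0, (0 < k0)%N /\
  forall k, (k0 <= k)%N -> forall j, 1 / 2 <= damp k j.
Proof.
have f1 := f_gt0 1 isT; have f64 := f_gt0 64 isT.
have [k1 h1] := rt_large R (C * 64 * f 1 * 4).
have [k2 h2] := nat_large R (C * f 64 ^+ 64 * 2 * 4).
exists (maxn k1 k2).+1; split=> // k hk j.
have k0 : (0 < k)%N by lia.
have rk := rt_gt0 R k k0; have k0' : 0 < k%:R :> R by rewrite ltr0n.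
have {}h1 := h1 k ltac:(lia); have {}h2 := h2 k ltac:(lia).
suff H : \sum_(2 <= l < j.+1) leak k l <=
   64 * (f 1 / rt k) + f 64 ^+ 64 * (2 / k%:R).
  rewrite /damp lerBrDl -lerBrDr (le_trans (ler_wpM2l C_ge0 H))//.
  (* The loss of 1 / 2 is shared equally between the small levels and the summable tail. *)
  rewrite mulrDr [leRHS](_ : _ = 1/4 + 1/4); last by field.
  rewrite lerD//.
    by rewrite !mulrA ler_pdivrMr// -(ler_pM2r (x := 4)) ?ltr0n//; lra.
  by rewrite !mulrA ler_pdivrMr// -(ler_pM2r (x := 4)) ?ltr0n//; lra.
apply: (le_trans (y := \sum_(2 <= l < j.+1)
  ((if (l <= 64)%N then f 1 / rt k else 0) +
              f 64 ^+ 64 * ((maxn l k)%:R ^+ 2)^-1))).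
  by rewrite [leLHS]big_nat_cond [leRHS]big_nat_cond; apply: ler_sum => l /andP[/andP[l2 _] _]; rewrite leak_bound.
rewrite big_split/= lerD//.
  rewrite -big_mkcond/= big_const_seq iter_addr addr0 -[leLHS]mulr_natl ler_wpM2r ?divr_ge0 ?(ltW f1) ?(ltW rk)//.
  rewrite ler_nat.
  rewrite -size_filter -[leqRHS](size_iota 1) uniq_leq_size ?filter_uniq ?iota_uniq//.
  by move=> l; rewrite mem_filter mem_index_iota mem_iota; lia.
rewrite -mulr_sumr ler_wpM2l ?exprn_ge0 ?(ltW f64)//.
apply: le_trans (sum_inv_sqr_max k j k0).
case: j => [|j]; first by rewrite !big_geq.
by rewrite [leRHS]big_ltn// lerDr invr_ge0 exprn_ge0.
Qed.

(* [growth t * damp k] solves a one-step equation that charges each draw at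
   level [j] for the [C] newborn colors it brings on average. *)
Lemma weight_step k t j : (0 < j)%N -> rt (maxn j.+1 k) <= t ->
  f j * (growth t j.+1 * damp k j.+1 - growth t j * damp k j + C) <=
  t * (growth t j * damp k j).
Proof.
move=> j0 ht; have fj := f_gt0 _ j0.
have t0 : 0 <= t := le_trans (rt_ge0 _ _) ht.
have D0 := growth_gt0 t j.+1 t0.
(* Hence the decrement [C * leak] of [damp] is worth at least [C] after multiplication by
   [growth t j.+1], which pays for the term [C] on the left. *)
have H : 1 <= growth t j.+1 * leak k j.+1.
  rewrite ler_pdivlMr ?growth_gt0 ?rt_ge0// mul1r.
  by rewrite growth_le_param ?rt_ge0.
have -> : t * (growth t j * damp k j) =
  f j * (growth t j * damp k j * (t / f j)) by field; rewrite gt_eqF.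
rewrite ler_pM2l// dampS//.
have -> : growth t j.+1 * (damp k j - C * leak k j.+1) =
  growth t j.+1 * damp k j - C * (growth t j.+1 * leak k j.+1) by ring.
have := ler_wpM2l C_ge0 H; rewrite mulr1.
move: (_ * leak _ _) => z.
rewrite growthS//; move: (growth _ _) (damp _ _) (t / _) => x y u.
lra.
Qed.

End Growth.
Arguments growth {R}.

(** * Histories and their law *)

(* A history lists the pairs (B_{k-1}, S_k), most recent first. *)
Definition history := seq (bool * nat).
Definition colors (h : history) : nat := count (fun y => y.1) h.
Definition mult (c : nat) (h : history) : nat := count (fun y => y.2 == c) h.
Definition succs (h : history) : seq (bool * nat) :=
  (true, (colors h).+1) :: [seq (false, c) | c <- index_iota 1 (colors h).+1].
Fixpoint valid (h : history) : bool :=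
  if h is y :: h' then (y \in succs h') && valid h' else true.

Arguments colors : simpl never.
Arguments mult : simpl never.
Arguments succs : simpl never.

Lemma colors_cons y h : colors (y :: h) = (y.1 + colors h)%N.
Proof. by []. Qed.

Lemma mult_cons c y h : mult c (y :: h) = ((y.2 == c) + mult c h)%N.
Proof. by []. Qed.

Lemma mult_le c y h : (mult c h <= mult c (y :: h))%N.
Proof. by rewrite mult_cons leq_addl. Qed.

Lemma mem_succs y h : (y \in succs h) =
  if y.1 then y.2 == (colors h).+1 else (0 < y.2 <= colors h)%N.
Proof.
case: y => [[] x]; rewrite /succs in_cons /=.
  rewrite xpair_eqE eqxx /=; case: eqP => //= _; apply/negbTE/negP.
  by move=> /mapP[c _].
apply/mapP/idP.
  by move=> [c]; rewrite mem_index_iota ltnS => hc [->].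
by move=> hx; exists x => //; rewrite mem_index_iota ltnS.
Qed.

(** A new color takes the next free label, so no label is skipped. *)
Lemma valid_mult_gt0 h c : valid h -> (0 < mult c h)%N = (0 < c <= colors h)%N.
Proof.
elim: h => [|[[] x] h IH] /=; first by case: c.
  rewrite mem_succs/= => /andP[/eqP-> /IH {}IH].
  by rewrite mult_cons colors_cons /= addn_gt0 IH lt0b; lia.
rewrite mem_succs/= => /andP[hx /IH {}IH].
by rewrite mult_cons colors_cons /= addn_gt0 IH lt0b; lia.
Qed.

Lemma valid_mult0 h c : valid h -> ~~ (0 < c <= colors h)%N -> mult c h = 0%N.
Proof. by move=> /valid_mult_gt0 <-; rewrite lt0n negbK => /eqP. Qed.

Lemma valid_sum_mult h : valid h ->
  (\sum_(1 <= c < (colors h).+1) mult c h = size h)%N.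
Proof.
elim: h => [|[b x] h IH]; first by move=> _; rewrite big_geq.
move=> /= /andP[hx vh].
have e : ((colors ((b, x) :: h)).+1 = (b + colors h).+1)%N by [].
under eq_bigr do rewrite mult_cons.
rewrite big_split/= -[RHS]add1n -(IH vh); congr addn.
  rewrite (bigD1_seq x) ?iota_uniq//=; last first.
    by move: hx; rewrite mem_succs mem_index_iota e; case: b {e} => /=; lia.
  rewrite eqxx big1// => i /negbTE; rewrite eq_sym => ->.
  by [].
rewrite e; case: b hx {e} => // _.
rewrite add1n big_nat_recr//= (valid_mult0 h (colors h).+1)//.
  by rewrite addn0.
by rewrite ltnn andbF.
Qed.

Lemma colors_gt0 h : valid h -> (0 < size h)%N -> (0 < colors h)%N.
Proof.
move=> vh; rewrite -(valid_sum_mult _ vh).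
by case: (colors h) => //; rewrite big_geq.
Qed.

(** * One-step transition law and drift estimates *)

Section Kernel.
Variables (R : realType) (f p : nat -> R).

Definition weight (h : history) : R := \sum_(1 <= c < (colors h).+1) f (mult c h).

Definition pnew (n : nat) : R := if n == 0%N then 1 else p n.

Definition kernel (h : history) (y : bool * nat) : R :=
  if y.1 then pnew (size h) * (y.2 == (colors h).+1)%:R
  else (1 - pnew (size h)) *
    (if (0 < y.2 <= colors h)%N then f (mult y.2 h) / weight h else 0).

Fixpoint law (h : history) : R :=
  if h is y :: h' then law h' * kernel h' y else 1.

Definition expect (phi : history -> R) (h : history) : R :=
  \sum_(y <- succs h) kernel h y * phi (y :: h).

(** The Rubin time assigned to one step: a color at level [j] is drawn with probability
    [speed h * f j]. *)
Definition speed (h : history) : R := (1 - pnew (size h)) / weight h.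

Lemma expectE phi h : expect phi h =
  pnew (size h) * phi ((true, (colors h).+1) :: h) +
  speed h * \sum_(1 <= c < (colors h).+1) f (mult c h) * phi ((false, c) :: h).
Proof.
rewrite /expect /succs big_cons big_map /kernel/= eqxx mulr1; congr (_ + _).
rewrite mulr_sumr big_nat_cond [RHS]big_nat_cond; apply: eq_bigr => c.
rewrite andbT => /andP[c1 c2]; rewrite c1 -ltnS c2 /=.
by rewrite /speed; ring.
Qed.

Hypothesis f_gt0 : forall j, (0 < j)%N -> 0 < f j.
Hypothesis f_le : forall i j, (0 < i)%N -> (i <= j)%N -> f i <= f j.
Hypothesis p01 : forall n, (0 < n)%N -> 0 < p n < 1.

Lemma pnew01 n : 0 < pnew n <= 1.
Proof.
by rewrite /pnew; case: posnP => [_|/p01/andP[-> /ltW->]]//; rewrite ltr01 lexx.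
Qed.

Lemma weight_ge h c : valid h -> (0 < c <= colors h)%N -> f (mult c h) <= weight h.
Proof.
move=> vh hc; rewrite /weight (bigD1_seq c) ?iota_uniq ?mem_index_iota//=.
rewrite lerDl big_seq_cond sumr_ge0// => i /andP[]; rewrite mem_index_iota ltnS => hi _.
by rewrite ltW// f_gt0// valid_mult_gt0.
Qed.

Lemma weight_gt0 h : valid h -> (0 < size h)%N -> 0 < weight h.
Proof.
move=> vh h0; have := colors_gt0 _ vh h0 => n0.
apply: (lt_le_trans _ (weight_ge h 1 vh _)) => //.
by rewrite f_gt0// valid_mult_gt0.
Qed.

Lemma speed0 : speed [::] = 0.
Proof. by rewrite /speed/= subrr mul0r. Qed.

Lemma speed_ge0 h : valid h -> 0 <= speed h.
Proof.
case: h => [|y h] vh; first by rewrite speed0.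
by rewrite divr_ge0 ?subr_ge0 ?(ltW (weight_gt0 _ _ _))//; case/andP: (pnew01 (size (y :: h))).
Qed.

Lemma speed_weight h : valid h -> speed h * weight h = 1 - pnew (size h).
Proof.
case: h => [|y h] vh; first by rewrite speed0 mul0r /= subrr.
by rewrite divfK// gt_eqF// weight_gt0.
Qed.

Lemma kernel_ge0 h y : valid h -> 0 <= kernel h y.
Proof.
move=> vh; have /andP[p0 p1] := pnew01 (size h).
rewrite /kernel; case: y.1; first by rewrite mulr_ge0// ltW.
case: ifP => hy; last by rewrite mulr0.
rewrite mulr_ge0 ?subr_ge0 ?divr_ge0//.
  by rewrite ltW// f_gt0// valid_mult_gt0.
by apply: le_trans (weight_ge h y.2 vh hy); rewrite ltW// f_gt0// valid_mult_gt0.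
Qed.

Lemma law_ge0 h : valid h -> 0 <= law h.
Proof. by elim: h => //= y h IH /andP[_ vh]; rewrite mulr_ge0 ?IH// kernel_ge0. Qed.

Lemma expect_cst v h : valid h -> expect (fun=> v) h = v.
Proof.
move=> vh; rewrite expectE -mulr_suml mulrA speed_weight//.
by rewrite -mulrDl [_ + (1 - _)]addrC subrK mul1r.
Qed.

Lemma expectZ v phi h : expect (fun h => v * phi h) h = v * expect phi h.
Proof. by rewrite /expect mulr_sumr; apply: eq_bigr => y _; rewrite mulrCA. Qed.

Lemma le_expect phi psi h : valid h ->
  (forall y, y \in succs h -> phi (y :: h) <= psi (y :: h)) ->
  expect phi h <= expect psi h.
Proof.
move=> vh le_phi; rewrite /expect big_seq [leRHS]big_seq.
by apply: ler_sum => y hy; rewrite ler_wpM2l ?le_phi ?kernel_ge0.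
Qed.

(** The drift estimate for the supermartingales below. A birth is at most [C] times as likely as a
    draw, so its cost [b] is charged to the draws as an extra [C * b] each. The empty history is
    excluded because its step is a birth with certainty. *)
Lemma expect_le phi h (C v b : R) (d : nat -> R) :
  (forall n, (0 < n)%N -> p n <= C * (1 - p n)) ->
  valid h -> (0 < size h)%N -> 0 <= b ->
  phi ((true, (colors h).+1) :: h) <= v + b ->
  (forall c, (0 < c <= colors h)%N -> phi ((false, c) :: h) <= v + d c) ->
  expect phi h <=
    v + speed h * \sum_(1 <= c < (colors h).+1) f (mult c h) * (d c + C * b).
Proof.
move=> pC vh h0 b0 hb hd; have e0 := speed_ge0 _ vh.
have [/andP[p0 p1] ew] := (pnew01 (size h), speed_weight _ vh).
have pCh : pnew (size h) <= C * (1 - pnew (size h)).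
  by rewrite /pnew -[_ == _]negbK -lt0n h0 /= pC.
rewrite expectE; apply: (le_trans (y := pnew (size h) * (v + b) +
  speed h * \sum_(1 <= c < (colors h).+1) f (mult c h) * (v + d c))).
  rewrite lerD ?ler_wpM2l ?(ltW p0)//.
  rewrite [leLHS]big_nat_cond [leRHS]big_nat_cond.
  apply: ler_sum => c /andP[hc _]; rewrite ler_wpM2l ?hd//.
  by rewrite ltW// f_gt0// valid_mult_gt0.
under eq_bigr do rewrite mulrDr.
under [in leRHS]eq_bigr do rewrite mulrDr.
rewrite !big_split/= -!mulr_suml -/(weight h) !mulrDr !mulrA ew.
have -> : pnew (size h) * v + pnew (size h) * b + ((1 - pnew (size h)) * v
   + speed h * \sum_(1 <= i < (colors h).+1) f (mult i h) * d i) =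
   v + (pnew (size h) * b + speed h * \sum_(1 <= i < (colors h).+1) f (mult i h) * d i) by ring.
rewrite lerD2l addrC lerD2l.
by have := ler_wpM2r b0 pCh; lra.
Qed.

Lemma expect_super phi h (C b : R) (d : nat -> R) :
  (forall n, (0 < n)%N -> p n <= C * (1 - p n)) ->
  valid h -> (0 < size h)%N -> 0 <= b ->
  phi ((true, (colors h).+1) :: h) <= phi h + b ->
  (forall c, (0 < c <= colors h)%N -> phi ((false, c) :: h) <= phi h + d c) ->
  \sum_(1 <= c < (colors h).+1) f (mult c h) * (d c + C * b) <= 0 ->
  expect phi h <= phi h.
Proof.
move=> pC vh h0 b0 hb hd hs; apply: (le_trans (expect_le _ _ _ _ _ _ pC vh h0 b0 hb hd)).
by rewrite gerDl mulr_ge0_le0// speed_ge0.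
Qed.

(* The discrete counterpart of [exp (t * time)], where time is the intrinsic
   (Rubin) time in which a color at level [j] rings at rate [f j]. *)
Fixpoint clock (t : R) (h : history) : R :=
  if h is _ :: h' then clock t h' * (1 + t * speed h') else 1.

Lemma clock_ge1 t h : 0 <= t -> valid h -> 1 <= clock t h.
Proof.
move=> t0; elim: h => //= y h IH /andP[_ vh].
by rewrite mulr_ege1 ?IH// lerDl mulr_ge0// speed_ge0.
Qed.

Lemma clock_gt0 t h : 0 <= t -> valid h -> 0 < clock t h.
Proof. by move=> t0 vh; rewrite (lt_le_trans ltr01)// clock_ge1. Qed.

Lemma clock_cons_le t y h : 0 <= t -> valid h -> clock t h <= clock t (y :: h).
Proof.
move=> t0 vh /=; rewrite ler_peMr ?(ltW (clock_gt0 _ _ t0 vh))//.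
by rewrite lerDl mulr_ge0 ?speed_ge0.
Qed.

(** Bernoulli's inequality, factor by factor. A large clock at rate [q * t] thus forces a large
    clock at rate [t]. *)
Lemma clock_pow t q h : 0 <= t -> valid h -> clock (q%:R * t) h <= clock t h ^+ q.
Proof.
move=> t0; elim: h => [|y h IH] /=; first by rewrite expr1n.
move=> /andP[_ vh]; rewrite exprMn ler_pM ?IH//.
- by rewrite ltW// clock_gt0// mulr_ge0.
- by rewrite addr_ge0// mulr_ge0 ?speed_ge0// mulr_ge0.
have e0 : 0 <= t * speed h by rewrite mulr_ge0// speed_ge0.
rewrite -mulrA; move: (t * _) e0 => x x0.
elim: q {IH} => [|q IHq]; first by rewrite mul0r addr0.
rewrite exprS; apply: (le_trans (y := (1 + x) * (1 + q%:R * x))).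
  rewrite -natr1 -subr_ge0 (_ : _ - _ = q%:R * x ^+ 2); last by ring.
  by rewrite mulr_ge0// exprn_ge0.
by rewrite ler_wpM2l// addr_ge0.
Qed.

(** Each step contributes a factor at most 2: the weight of a nonempty history is at least [f 1], so
    [f 1 * speed <= 1], and the first step has speed 0. *)
Lemma clock_f1 h : valid h -> clock (f 1) h <= 2 ^+ size h.
Proof.
elim: h => //= y h IH /andP[_ vh]; rewrite exprSr.
have e0 := speed_ge0 _ vh.
have f1 := f_gt0 1 isT.
apply: ler_pM; [by rewrite ltW// clock_gt0// ltW| |by rewrite IH|].
  by rewrite addr_ge0// mulr_ge0// ltW.
rewrite (_ : 2 = 1 + 1)// lerD2l.
have [h0|h0] := posnP (size h).
  by rewrite (size0nil h0) speed0 mulr0.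
apply: (le_trans (y := weight h * speed h)).
  rewrite ler_wpM2r//; apply: le_trans (weight_ge h 1 vh _).
    by apply: f_le; rewrite ?valid_mult_gt0//= colors_gt0.
  by rewrite /= colors_gt0.
by rewrite mulrC speed_weight// gerBl; case/andP: (pnew01 (size h)) => /ltW.
Qed.

(* [G] is meant to be [h |-> P (cylinder of h, event)]. *)
Lemma backward_domination (I : history -> Prop) (G X : history -> R) (m : nat) :
  (forall h, I h -> valid h) ->
  (forall h y, I h -> (size h < m)%N -> y \in succs h -> I (y :: h)) ->
  (forall h, I h -> (size h < m)%N -> G h = \sum_(y <- succs h) G (y :: h)) ->
  (forall h, I h -> size h = m -> G h <= X h * law h) ->
  (forall h, I h -> (size h < m)%N -> G h <= X h * law h \/ expect X h <= X h) ->
  forall h, I h -> (size h <= m)%N -> G h <= X h * law h.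
Proof.
move=> Iv IS GS Gm GX h Ih hm.
have [n en] : exists n, (m - size h = n)%N by eexists.
elim: n h Ih hm en => [|n IH] h Ih hm en; first by apply: Gm => //; lia.
have hm' : (size h < m)%N by lia.
(* Where the bound is known already there is nothing to prove; this alternative plays the role of a
   stopping time. *)
have [//|EX] := GX _ Ih hm'.
have vh := Iv _ Ih.
rewrite GS//; apply: (le_trans (y := expect X h * law h)); last first.
  by rewrite ler_wpM2r// law_ge0.
rewrite /expect mulr_suml big_seq [leRHS]big_seq; apply: ler_sum => y hy.
apply: (le_trans (IH _ (IS _ _ Ih hm' hy) _ _)) => /=; [lia|lia|].
by rewrite le_eqVlt; apply/orP; left; apply/eqP; ring.
Qed.

End Kernel.

(** * Histories read off from paths *)

Fixpoint past (b : nat -> bool) (s : nat -> nat) (n : nat) : history :=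
  if n is m.+1 then (b m, s m.+1) :: past b s m else [::].

Lemma size_past b s n : size (past b s n) = n.
Proof. by elim: n => //= n ->. Qed.

Lemma mult_past b s n c : mult c (past b s n) = kcount s n c.
Proof.
elim: n => [|n IH]; first by rewrite /kcount big_geq.
by rewrite /= mult_cons IH /kcount [RHS]big_nat_recr//= [RHS]addnC.
Qed.

Lemma colors_past b s n : colors (past b s n) = ncol b n.
Proof.
elim: n => [|n IH]; first by rewrite /ncol big_ord0.
by rewrite /= colors_cons IH /ncol [RHS]big_ord_recr/= [RHS]addnC.
Qed.

(** The two products agree factor by factor; the deterministic [B_0 = 1] in [bfac] corresponds to
    [pnew 0 = 1] in [kernel]. *)
Lemma urn_law_past (R : realType) (F : R -> R) (p : nat -> R) b s n :
  urn_law F p n b s = law R (fun j => F j%:R) p (past b s n).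
Proof.
rewrite /urn_law; elim: n => [|n IH]; first by rewrite big_ord0 big_geq// mulr1.
rewrite big_ord_recr big_nat_recr//= -IH mulrACA; congr (_ * _).
rewrite /bfac /trans /kernel /pnew /= size_past colors_past mult_past.
have -> : weight R (fun j => F j%:R) (past b s n) =
  \sum_(1 <= c < (ncol b n).+1) F (kcount s n c)%:R.
  by rewrite /weight colors_past; apply: eq_bigr => c _; rewrite mult_past.
by case: n {IH} => [|n] /=; case: (b _) => //; rewrite subrr !mul0r.
Qed.

Lemma past_eq b s b' s' n : past b s n = past b' s' n <->
  (forall i, (i < n)%N -> b i = b' i) /\
  (forall k, (1 <= k <= n)%N -> s k = s' k).
Proof.
elim: n => [|n IH] /=; first by split=> // _; split=> // k; lia.
split=> [[eb es /IH[hb hs]]|[hb hs]].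
  split=> [i|k]; first by rewrite ltnS leq_eqVlt => /orP[/eqP->//|]; exact: hb.
  case/andP => k1; rewrite leq_eqVlt => /orP[/eqP->//|kn]; apply: hs.
  by rewrite k1.
rewrite hb// hs ?ltnSn//; congr cons; apply/IH; split=> [i ni|k kn].
  by apply: hb; lia.
by apply: hs; lia.
Qed.

(** Beyond the length of the history, [b] and [s] are arbitrary. This gives access to the law of
    every history, since the urn law is stated for paths. *)
Lemma past_surj (h : history) : exists b s, past b s (size h) = h.
Proof.
elim: h => [|[x y] h [b [s e]]]; first by exists xpredT, id.
exists (fun i => if i == size h then x else b i),
       (fun k => if k == (size h).+1 then y else s k).
rewrite /= !eqxx -{4}e; congr cons; apply/past_eq; split=> [i|k] hi.
  by rewrite ifN//; lia.
by rewrite ifN//; lia.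
Qed.

(** * Supermartingales for the population *)

Section ColorSums.
Variables (R : realType) (g : nat -> R).

Lemma sum_mult_notin y h a b : ~~ (a <= y.2 < b)%N ->
  \sum_(a <= c < b) g (mult c (y :: h)) = \sum_(a <= c < b) g (mult c h).
Proof.
move=> hy; rewrite big_nat_cond [RHS]big_nat_cond; apply: eq_bigr => c.
rewrite andbT => hc; rewrite mult_cons; case: eqP => // e.
by rewrite e hc in hy.
Qed.

Lemma sum_mult_in y h a b : (a <= y.2 < b)%N ->
  \sum_(a <= c < b) g (mult c (y :: h)) =
  \sum_(a <= c < b) g (mult c h) + (g (mult y.2 h).+1 - g (mult y.2 h)).
Proof.
move=> hy.
rewrite (bigD1_seq y.2) ?iota_uniq ?mem_index_iota//=.
rewrite [in RHS](bigD1_seq y.2) ?iota_uniq ?mem_index_iota//=.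
rewrite mult_cons eqxx add1n.
under eq_bigr => c /negbTE yc.
  rewrite mult_cons eq_sym yc add0n; over.
by move: (\sum_(_ <- _ | _) _) => z; ring.
Qed.

Lemma sum_mult_birth h a : valid h -> (a <= (colors h).+1)%N ->
  \sum_(a <= c < (colors ((true, (colors h).+1) :: h)).+1)
    g (mult c ((true, (colors h).+1) :: h)) =
  \sum_(a <= c < (colors h).+1) g (mult c h) + g 1.
Proof.
move=> vh ha; rewrite colors_cons add1n big_nat_recr//.
rewrite sum_mult_notin ?ltnn ?andbF//.
by rewrite mult_cons eqxx (valid_mult0 _ _ vh)//= ltnn.
Qed.

End ColorSums.

Definition low (k : nat) (h : history) : Prop := forall c, (mult c h < k)%N.

Lemma low_cons k y h : low k (y :: h) -> low k h.
Proof. by move=> lh c; apply: leq_ltn_trans (lh c); exact: mult_le. Qed.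

Lemma low_past k b s n m : (n <= m)%N -> low k (past b s m) -> low k (past b s n).
Proof.
elim: m => [|m IH]; first by rewrite leqn0 => /eqP->.
by rewrite leq_eqVlt => /orP[/eqP->//|]; rewrite ltnS => /IH h /low_cons.
Qed.

Lemma low_size k h : valid h -> low k h -> (size h <= colors h * k)%N.
Proof.
move=> vh lh; rewrite -(valid_sum_mult _ vh).
apply: (leq_trans (n := \sum_(1 <= c < (colors h).+1) k)).
  by apply: leq_sum => c _; exact/ltnW/lh.
by rewrite sum_nat_const_nat subn1.
Qed.

Lemma colors_le_size h : (colors h <= size h)%N.
Proof. exact: count_size. Qed.

Section Potentials.
Variables (R : realType) (f p : nat -> R).
Hypothesis f_gt0 : forall j, (0 < j)%N -> 0 < f j.
Hypothesis f_le : forall i j, (0 < i)%N -> (i <= j)%N -> f i <= f j.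
Hypothesis p01 : forall n, (0 < n)%N -> 0 < p n < 1.
Variable C : R.
Hypothesis C_ge0 : 0 <= C.
Hypothesis pC : forall n, (0 < n)%N -> p n <= C * (1 - p n).
Local Notation valid_gt0 vh hc := (etrans (valid_mult_gt0 _ _ vh) hc).

Local Notation E := (expect R f p).
Local Notation speed := (speed R f p).
Local Notation clock := (clock R f p).

Section Slow.
Variables (k : nat) (t : R).
Hypothesis k_gt0 : (0 < k)%N.
Hypothesis damp_ge : forall j, 1 / 2 <= damp R f C k j.
Hypothesis t_ge : rt k <= t.

Let t_ge0 : 0 <= t. Proof. exact: le_trans (rt_ge0 _ _) t_ge. Qed.

(** The cap at [k] bounds the weight by [growth f t k]; below it, the condition of [weight_step] on
    the rate reads [rt k <= t]. *)
Definition wgt (j : nat) : R := growth f t (minn j k) * damp R f C k (minn j k).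

Lemma wgt_ge j : growth f t (minn j k) / 2 <= wgt j.
Proof.
rewrite /wgt ler_wpM2l ?(ltW (growth_gt0 _ _ f_gt0 _ _ t_ge0))//.
by have := damp_ge (minn j k); rewrite div1r.
Qed.

Lemma wgt_ge_half j : 1 / 2 <= wgt j.
Proof.
apply: le_trans (wgt_ge j); rewrite ler_pM2r ?invr_gt0//.
exact: growth_ge1.
Qed.

Lemma wgt_le j : wgt j <= growth f t k.
Proof.
apply: (le_trans (y := growth f t (minn j k))).
  rewrite /wgt ler_piMr ?(damp_le1 R f f_gt0 C C_ge0)//.
  by rewrite ltW// growth_gt0.
by apply: growth_le => //; exact: geq_minr.
Qed.

Lemma wgt1 : wgt 1 = 1.
Proof. by rewrite /wgt (minn_idPl k_gt0) growth1 damp1 mulr1. Qed.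

Lemma wgt_step j : (0 < j < k)%N -> f j * (wgt j.+1 - wgt j + C) <= t * wgt j.
Proof.
move=> /andP[j0 jk]; rewrite /wgt (minn_idPl (ltnW jk)) (minn_idPl jk).
apply: weight_step => //.
by rewrite (maxn_idPr jk).
Qed.

Definition pop (h : history) : R := \sum_(1 <= c < (colors h).+1) wgt (mult c h).

(** Each color is balanced separately by [wgt_step]: its promotion and the [C] newborns of weight 1
    charged to its draw cost at most [t] times its weight. *)
Lemma pop_super h : valid h -> (0 < size h)%N -> low k h ->
  E pop h <= pop h * (1 + t * speed h).
Proof.
move=> vh h0 lh.
have := expect_le R f p f_gt0 p01 pop h C (pop h) 1
  (fun c => wgt (mult c h).+1 - wgt (mult c h)) pC vh h0 ler01.
move=> /(_ _ _)/le_trans; apply.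
- by rewrite /pop sum_mult_birth// wgt1.
- by move=> c hc; rewrite /pop sum_mult_in.
rewrite [leRHS]mulrDr (mulr1 (pop h)) lerD2l.
have -> : pop h * (t * speed h) = speed h * (t * pop h) by ring.
apply: ler_wpM2l; first exact: speed_ge0.
rewrite /pop mulr_sumr [leLHS]big_nat_cond [leRHS]big_nat_cond.
apply: ler_sum => c /andP[hc _]; rewrite mulr1 wgt_step//.
by rewrite lh andbT valid_mult_gt0.
Qed.

Lemma pop_clock_super v h : 0 <= v -> valid h -> (0 < size h)%N -> low k h ->
  E (fun h => v * (pop h / clock t h)) h <= v * (pop h / clock t h).
Proof.
move=> v0 vh h0 lh; rewrite expectZ ler_wpM2l//.
have c0 := clock_gt0 R f p f_gt0 p01 t h t_ge0 vh.
have e0 := speed_ge0 R f p f_gt0 p01 h vh.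
have e1 : 0 < 1 + t * speed h by rewrite ltr_pwDl// mulr_ge0.
rewrite /expect /=.
under eq_bigr do rewrite mulrA.
rewrite -mulr_suml ler_pdivrMr ?mulr_gt0// -/(speed h).
rewrite [leRHS](_ : _ = pop h * (1 + t * speed h)); first exact: pop_super.
by field; rewrite gt_eqF.
Qed.

Lemma pop_ge0 h : 0 <= pop h.
Proof.
by apply: sumr_ge0 => c _; apply: le_trans (wgt_ge_half _); rewrite divr_ge0.
Qed.

Lemma pop_low_ge h : valid h -> low k h -> (size h)%:R / (2 * k%:R) <= pop h.
Proof.
move=> vh lh; apply: (le_trans (y := (colors h)%:R / 2)).
  rewrite ler_pdivrMr ?mulr_gt0 ?ltr0n// mulrA divfK ?gt_eqF//.
  by rewrite -natrM ler_nat low_size.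
apply: (le_trans (y := \sum_(1 <= c < (colors h).+1) (1 / 2))); last first.
  by apply: ler_sum => c _; exact: wgt_ge_half.
by rewrite sumr_const_nat subn1 -[leRHS]mulr_natl div1r.
Qed.

Lemma pop_le h : pop h <= (size h)%:R * growth f t k.
Proof.
apply: (le_trans (y := \sum_(1 <= c < (colors h).+1) growth f t k)).
  by apply: ler_sum => c _; exact: wgt_le.
rewrite sumr_const_nat subn1 -[leLHS]mulr_natl ler_wpM2r//.
  by rewrite ltW// growth_gt0.
by rewrite ler_nat colors_le_size.
Qed.

(* [expR (- survivors)] estimates the probability that none of the first
   [N] colors reaches level [k]; the growth rate [2 * t] leaves room for
   [1 - exp (- y) >= y / 2]. *)
Variables (N : nat) (a : R).
Hypothesis a_gt0 : 0 < a.

Definition survivors (h : history) : R :=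
  \sum_(1 <= c < N.+1) growth f (2 * t) (mult c h) / growth f (2 * t) k
   * (a / clock t h).

Lemma expRN_half (y : R) : 0 <= y <= 1 -> expR (- y) <= 1 - y / 2.
Proof.
move=> /andP[y0 y1]; rewrite expRN.
have h1 := expR_ge1Dx y.
rewrite -(ler_pM2r (expR_gt0 y)) mulVf ?gt_eqF ?expR_gt0//.
apply: (le_trans (y := (1 - y / 2) * (1 + y))).
  by nra.
by rewrite ler_wpM2l//; lra.
Qed.

(** A draw of one of the first [N] colors raises [survivors] by some [x] in [0, 1] and so removes at
    least the fraction [x / 2] of the exponential. On average this makes up for the loss in
    [survivors] caused by the growth of [clock]. *)
Lemma survivors_super v h : valid h -> (0 < size h)%N -> low k h ->
  (N <= colors h)%N -> a <= clock t h ->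
  E (fun h => expR (v - survivors h)) h <= expR (v - survivors h).
Proof.
move=> vh h0 lh Nh ah.
have c0 := clock_gt0 R f p f_gt0 p01 t h t_ge0 vh.
have e0 := speed_ge0 R f p f_gt0 p01 h vh.
have t2 : 0 <= 2 * t by rewrite mulr_ge0.
have D0 := growth_gt0 R f f_gt0 _ _ t2.
set e := speed h in e0.
have e1 : 1 <= 1 + t * e by rewrite lerDl mulr_ge0.
have e1' : 0 < 1 + t * e by rewrite (lt_le_trans ltr01).
pose q c := growth f (2 * t) (mult c h) / growth f (2 * t) k
   * (a / (clock t h * (1 + t * e))).
pose Q := \sum_(1 <= c < N.+1) q c.
have sE : survivors h = Q * (1 + t * e).
  rewrite /survivors /Q mulr_suml; apply: eq_bigr => c _.
  by rewrite /q; field; rewrite !gt_eqF.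
pose x c := 2 * t * q c / f (mult c h).
have q_ge0 c : 0 <= q c.
  by rewrite mulr_ge0 ?divr_ge0 ?mulr_ge0 ?(ltW (D0 _)) ?ltW.
(* The increment is at most the new term of the sum, which is at most 1 because the new level is at
   most [k] and [a] is at most the clock. *)
have x01 c : (0 < c <= colors h)%N -> 0 <= x c <= 1.
  move=> hc; have m0 := valid_gt0 vh hc.
  have f0 := f_gt0 _ m0.
  apply/andP; split.
    by apply: divr_ge0; [apply: mulr_ge0 => //; exact: mulr_ge0|exact: ltW].
  rewrite /x.
  have -> : 2 * t * q c / f (mult c h) =
     (growth f (2 * t) (mult c h) * (2 * t / f (mult c h))) / growth f (2 * t) k *
     (a / (clock t h * (1 + t * e))) by rewrite /q; ring.
  rewrite -[leRHS]mulr1; apply: ler_pM.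
  - by rewrite divr_ge0 ?(ltW (D0 _))// mulr_ge0 ?(ltW (D0 _))// divr_ge0// ltW.
  - by rewrite divr_ge0 ?mulr_ge0 ?(ltW a_gt0) ?(ltW c0) ?(ltW e1').
  - rewrite ler_pdivrMr// mul1r.
    apply: (le_trans (y := growth f (2 * t) (mult c h).+1)).
      by rewrite growthS// mulrDr mulr1 lerDr ltW.
    exact: growth_le.
  by rewrite ler_pdivrMr ?mulr_gt0// mul1r (le_trans ah)// ler_peMr// ltW.
pose G j := growth f (2 * t) j / growth f (2 * t) k
   * (a / (clock t h * (1 + t * e))).
have sy y : survivors (y :: h) = \sum_(1 <= c < N.+1) G (mult c (y :: h)) by [].
pose dd c := if (c <= N)%N then - expR (v - Q) * (x c / 2) else 0.
apply: (le_trans (expect_le R f p f_gt0 p01 _ _ C (expR (v - Q)) 0 dd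
  pC vh h0 (lexx _) _ _)).
- rewrite addr0 sy sum_mult_notin//=.
  by rewrite -leqNgt ltnS.
- move=> c hc; rewrite /dd sy; case: leqP => cN; last first.
    by rewrite sum_mult_notin ?addr0//= negb_and -!leqNgt cN orbT.
  rewrite sum_mult_in/=; last by case/andP: hc => -> _; rewrite ltnS cN.
  have m0 := valid_gt0 vh hc.
  have -> : G (mult c h).+1 - G (mult c h) = x c by rewrite /G growthS// /x /q; ring.
  rewrite -[\sum_(_ <= _ < _) _]/Q opprD addrA expRD mulNr.
  have := expRN_half _ (x01 c hc); rewrite -(ler_pM2l (expR_gt0 (v - Q))).
  by rewrite mulrBr mulr1.
have -> : \sum_(1 <= c < (colors h).+1) f (mult c h) * (dd c + C * 0) =
   - expR (v - Q) * (t * Q).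
  rewrite /dd mulr0 (big_cat_nat _ (n := N.+1))//= [X in _ + X]big_nat_cond.
  rewrite [X in _ + X]big1 ?addr0; last first.
    by move=> c /andP[/andP[Nc _] _]; rewrite leqNgt Nc addr0 mulr0.
  rewrite /Q !mulr_sumr big_nat_cond [RHS]big_nat_cond; apply: eq_bigr => c.
  rewrite andbT => /andP[c1 cN]; rewrite -ltnS cN addr0.
  have m0 : (0 < mult c h)%N by rewrite valid_mult_gt0// c1 (leq_trans _ Nh).
  by rewrite /x; field; rewrite gt_eqF// f_gt0.
rewrite sE mulrDr mulr1 opprD addrA [leRHS]expRD.
have -> : expR (v - Q) + e * (- expR (v - Q) * (t * Q)) =
  expR (v - Q) * (1 + - (Q * (t * e))) by ring.
by rewrite ler_wpM2l ?expR_ge0// expR_ge1Dx.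
Qed.

End Slow.
End Potentials.

(** * Overtaking the leader *)

Definition leader (N : nat) (h : history) : nat := (\max_(1 <= c < N.+1) mult c h)%N.

Lemma mult_le_leader N h c : (0 < c <= N)%N -> (mult c h <= leader N h)%N.
Proof. by move=> hc; apply: leq_bigmax_seq; rewrite ?mem_index_iota. Qed.

Lemma leader_attained N h : (0 < leader N h)%N ->
  exists2 c, (0 < c <= N)%N & mult c h = leader N h.
Proof.
rewrite /leader; elim: N => [|N IH]; first by rewrite big_geq.
rewrite big_nat_recr//=.
case: (leqP (\max_(1 <= i < N.+1) mult i h) (mult N.+1 h)) => [_ _|_ max0].
  by exists N.+1; rewrite ?leqnn.
have [c /andP[c0 cN] e] := IH max0.
by exists c => //; rewrite c0 (leq_trans cN).
Qed.

Lemma leader_le N h b : (forall c, (0 < c <= N)%N -> mult c h <= b)%N ->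
  (leader N h <= b)%N.
Proof. by move=> H; apply/bigmax_leqP_seq => c; rewrite mem_index_iota => hc _; apply: H. Qed.

Lemma leader_mono N y h : (leader N h <= leader N (y :: h))%N.
Proof.
apply: leader_le => c hc; apply: leq_trans (mult_le _ _ _) _.
exact: mult_le_leader.
Qed.

Lemma leader_same N y h : ((0 < y.2 <= N)%N -> (mult y.2 h < leader N h)%N) ->
  leader N (y :: h) = leader N h.
Proof.
move=> H; apply/eqP; rewrite eqn_leq leader_mono andbT; apply: leader_le => c hc.
rewrite mult_cons; case: eqP => [e|_]; last exact: mult_le_leader.
by rewrite -e in hc *; rewrite add1n H.
Qed.

Lemma leader_up N y h : (0 < y.2 <= N)%N -> mult y.2 h = leader N h ->
  leader N (y :: h) = (leader N h).+1.
Proof.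
move=> hy e; apply/eqP; rewrite eqn_leq; apply/andP; split; last first.
  by rewrite -e; apply: leq_trans (mult_le_leader _ _ _ hy); rewrite mult_cons eqxx.
apply: leader_le => c hc; rewrite mult_cons.
by have := mult_le_leader _ h _ hc; case: eqP => _ /=; lia.
Qed.

Section Overtaken.
Variables (k N : nat).
Hypothesis k_gt0 : (0 < k)%N.

Definition overtaken (h : history) : Prop :=
  (k <= leader N h)%N /\ exists2 c, (N < c)%N & (leader N h <= mult c h)%N.

Fixpoint was_overtaken (h : history) : Prop :=
  overtaken h \/ (if h is _ :: h' then was_overtaken h' else False).

Lemma was_overtaken_present h : was_overtaken h ->
  exists2 c, (N < c)%N & (0 < mult c h)%N.
Proof.
elim: h => [|y h IH] /= [[kM [c Nc Mc]]|//]; try by exists c => //; lia.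
by move=> /IH[c Nc c0]; exists c => //; apply: leq_trans (mult_le _ _ _).
Qed.

End Overtaken.

Section Overtake.
Variables (R : realType) (f p : nat -> R).
Hypothesis f_gt0 : forall j, (0 < j)%N -> 0 < f j.
Hypothesis f_le : forall i j, (0 < i)%N -> (i <= j)%N -> f i <= f j.
Hypothesis p01 : forall n, (0 < n)%N -> 0 < p n < 1.
Variable C : R.
Hypothesis C_ge0 : 0 <= C.
Hypothesis pC : forall n, (0 < n)%N -> p n <= C * (1 - p n).
Variables (k : nat) (th zeta : nat -> R).
Hypothesis k_gt0 : (0 < k)%N.
Hypothesis damp_ge : forall j, 1 / 2 <= damp R f C k j.
Hypothesis th_ge : forall m, (k <= m)%N -> rt m <= th m.
Hypothesis th_le : forall m, (k <= m)%N -> th m <= th m.+1.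
Hypothesis th_sum : forall m, \sum_(k <= i < m) (th i / f i) ^+ 2 <= 1 / 2.

Let th_ge0 m : (k <= m)%N -> 0 <= th m.
Proof. by move=> /th_ge; apply: le_trans; exact: rt_ge0. Qed.

(** A factor in [1 / 2, 1]. Its decrease supplies [1 - x ^ 2] with [x = th m / f m], which turns
    [1 / (1 + x)] into the linear [1 - x]. *)
Definition margin (m : nat) : R := 1 - \sum_(k <= i < m) (th i / f i) ^+ 2.

(* A bound on the chance that a color at level [j] catches a leader at level
   [m]; the rate [th m] of the exponential moment increases with [m]. *)
Definition catch (j m : nat) : R :=
  margin m * (growth f (th m) (minn j m) * damp R f C k (minn j m))
   / growth f (th m) m.

Hypothesis zeta_ge0 : forall m, 0 <= zeta m.
Hypothesis zeta_step : forall m, (k <= m)%N -> catch 1 m <= zeta m - zeta m.+1.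

Lemma margin_ge m : 1 / 2 <= margin m.
Proof. by rewrite /margin; have := th_sum m; lra. Qed.

Lemma margin_le1 m : margin m <= 1.
Proof. by rewrite gerBl sumr_ge0// => i _; exact: sqr_ge0. Qed.

Lemma marginS m : (k <= m)%N -> margin m.+1 <= margin m * (1 - (th m / f m) ^+ 2).
Proof.
move=> km; rewrite /margin big_nat_recr//= opprD addrA -/(margin m).
have := margin_le1 m; have := sqr_ge0 (th m / f m).
move: (margin m) (_ ^+ 2) => x y y0 x1; nra.
Qed.

Lemma catch_ge0 j m : (k <= m)%N -> 0 <= catch j m.
Proof.
move=> km; have := margin_ge m; have := damp_ge (minn j m) => h1 h2.
have g0 i := growth_gt0 _ _ f_gt0 (th m) i (th_ge0 m km).
by rewrite /catch divr_ge0 ?(ltW (g0 _))// mulr_ge0 ?mulr_ge0 ?(ltW (g0 _))//; lra.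
Qed.

Lemma catch_top j m : (k <= m <= j)%N -> 1 / 4 <= catch j m.
Proof.
move=> /andP[km mj]; have h1 := margin_ge m; have h2 := damp_ge m.
have g0 := growth_gt0 _ _ f_gt0 (th m) m (th_ge0 m km).
rewrite /catch (minn_idPr mj).
have -> : margin m * (growth f (th m) m * damp R f C k m) / growth f (th m) m =
  margin m * damp R f C k m by field; rewrite gt_eqF.
nra.
Qed.

Lemma catch1 m : (k <= m)%N -> catch 1 m = margin m / growth f (th m) m.
Proof.
move=> km; rewrite /catch (minn_idPl _); last by lia.
by rewrite growth1 damp1 !mulr1.
Qed.

(** This is [weight_step] scaled by [margin m / growth f (th m) m], the value [catch 1 m] of a
    newborn. *)
Lemma catch_up j m : (0 < j < m)%N -> (k <= m)%N ->
  f j * (catch j.+1 m - catch j m + C * catch 1 m) <= th m * catch j m.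
Proof.
move=> /andP[j0 jm] km; rewrite catch1// /catch (minn_idPl jm) (minn_idPl (ltnW jm)).
have g0 := growth_gt0 _ _ f_gt0 (th m) m (th_ge0 m km).
have h1 := margin_ge m.
have hw := weight_step R f f_gt0 C C_ge0 k (th m) j j0.
have {hw} := hw (le_trans (rt_le R _ m _) (th_ge m km)).
rewrite geq_max jm km => /(_ isT) hw.
have := ler_wpM2l (_ : 0 <= margin m / growth f (th m) m) hw.
rewrite divr_ge0 ?(ltW g0)//; last by lra.
move=> /(_ isT); rewrite [X in X <= _ -> _ <= _](_ : _ = f j * (
  margin m * (growth f (th m) j.+1 * damp R f C k j.+1) / growth f (th m) m -
  margin m * (growth f (th m) j * damp R f C k j) / growth f (th m) m +
  C * (margin m / growth f (th m) m))); last by ring.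
by move=> /le_trans; apply; rewrite le_eqVlt; apply/orP; left; apply/eqP; ring.
Qed.

(** With [x = th m / f m], the leader's draw puts a factor [1 + x] in the denominator and, by
    [marginS], at most [1 - x ^ 2] in the numerator, together [1 - x]. Raising the rate to [th m.+1]
    only lowers the value, by [growth_ratio]. *)
Lemma catch_leader j m : (0 < j <= m)%N -> (k <= m)%N ->
  f m * (catch j m.+1 - catch j m) <= - th m * catch j m.
Proof.
move=> /andP[j0 jm] km.
have m0 : (0 < m)%N by lia.
have fm := f_gt0 _ m0.
have t0 := th_ge0 _ km.
have g0 i := growth_gt0 _ _ f_gt0 (th m) i t0.
have g1 i := growth_gt0 _ _ f_gt0 (th m.+1) i (th_ge0 m.+1 (leqW km)).
pose x := th m / f m.
have x0 : 0 <= x by rewrite divr_ge0// ltW.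
suff : catch j m.+1 <= (1 - x) * catch j m.
  move=> /(ler_wpM2l (ltW fm)).
  have -> : f m * ((1 - x) * catch j m) = f m * catch j m - th m * catch j m.
    by rewrite /x; field; rewrite gt_eqF.
  by rewrite mulrBr; lra.
rewrite /catch (minn_idPl (leqW jm)) (minn_idPl jm).
have dj := damp_ge j.
apply: (le_trans (y := margin m.+1 * damp R f C k j *
   (growth f (th m) j / growth f (th m) m.+1))).
  rewrite [leLHS](_ : _ = margin m.+1 * damp R f C k j *
    (growth f (th m.+1) j / growth f (th m.+1) m.+1)); last by ring.
  apply: ler_wpM2l; first by apply: mulr_ge0; [have := margin_ge m.+1; lra|lra].
  by apply: growth_ratio => //; [exact: th_le|exact: leqW].
rewrite growthS// -/x.
apply: (le_trans (y := margin m * (1 - x ^+ 2) * damp R f C k j *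
   (growth f (th m) j / (growth f (th m) m * (1 + x))))).
  apply: ler_wpM2r.
    by rewrite divr_ge0 ?mulr_ge0 ?(ltW (g0 _))// addr_ge0.
  by apply: ler_wpM2r; [lra|exact: marginS].
rewrite le_eqVlt; apply/orP; left; apply/eqP; field.
by rewrite !gt_eqF// ltr_pwDl.
Qed.

Variable N : nat.

(* The term in [zeta] pays for the future newborns brought by draws of the
   first [N] colors. *)
Definition challenge (h : history) : R :=
  \sum_(N.+1 <= c < (colors h).+1) catch (mult c h) (leader N h)
  + N%:R * C * zeta (leader N h).

Lemma challenge_ge0 h : (k <= leader N h)%N -> 0 <= challenge h.
Proof.
move=> kM; rewrite addr_ge0 ?mulr_ge0// sumr_ge0// => c _.
exact: catch_ge0.
Qed.

Lemma challenge_overtaken h : valid h -> overtaken k N h -> 1 / 4 <= challenge h.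
Proof.
move=> vh [kM [c Nc hc]].
have c0 : (0 < c <= colors h)%N by rewrite -valid_mult_gt0//; lia.
rewrite /challenge (bigD1_seq c) ?iota_uniq ?mem_index_iota//=; last by lia.
rewrite -addrA; apply: (le_trans (catch_top (mult c h) (leader N h) _)).
  by rewrite kM.
rewrite lerDl addr_ge0 ?mulr_ge0// sumr_ge0// => i _.
exact: catch_ge0.
Qed.

(** For each challenger, the gain from its own draws and their newborns is at most [th M * catch],
    which the leader's draws take back. There remain the newborns due to the first [N] colors, each
    drawn at rate at most [f M]; the drop of [zeta] at the leader's draws covers them. *)
Lemma challenge_super h : valid h -> (0 < size h)%N -> (N <= colors h)%N ->
  (k <= leader N h)%N -> ~ overtaken k N h -> expect R f p challenge h <= challenge h.
Proof.
move=> vh h0 Nh kM nov.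
set M := leader N h in kM.
have M0 : (0 < M)%N by lia.
have below c : (N < c)%N -> (mult c h < M)%N.
  by move=> Nc; rewrite ltnNge; apply/negP => Mc; apply: nov; split=> //; exists c.
(* The change of [challenge] when the leader moves from level [M] to [M.+1]. *)
pose D := \sum_(N.+1 <= c < (colors h).+1) (catch (mult c h) M.+1 - catch (mult c h) M)
   + N%:R * C * (zeta M.+1 - zeta M).
pose dd c := if (c <= N)%N then (if mult c h == M then D else 0)
  else catch (mult c h).+1 M - catch (mult c h) M.
have c1_ge0 : 0 <= catch 1 M by exact: catch_ge0.
have bound c : (N.+1 <= c < (colors h).+1)%N ->
  f (mult c h) * (catch (mult c h).+1 M - catch (mult c h) M + C * catch 1 M) +
  f M * (catch (mult c h) M.+1 - catch (mult c h) M) <= 0.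
  move=> hc; have c0 : (0 < mult c h)%N by rewrite valid_mult_gt0//; lia.
  have cM := below c ltac:(lia).
  have := catch_up (mult c h) M; rewrite c0 cM => /(_ isT kM).
  have := catch_leader (mult c h) M; rewrite c0 (ltnW cM) => /(_ isT kM).
  by rewrite mulNr; lra.
have zs : catch 1 M <= zeta M - zeta M.+1 by exact: zeta_step.
have D_le0 : D <= 0.
  rewrite /D -[leRHS](addr0 0); apply: lerD; last first.
    by rewrite mulr_ge0_le0 ?mulr_ge0//; lra.
  rewrite big_nat_cond; apply: sumr_le0 => c; rewrite andbT => hc.
  have c0 : (0 < mult c h)%N by rewrite valid_mult_gt0//; lia.
  have := catch_leader (mult c h) M; rewrite c0 (ltnW (below c _)); last by lia.
  move=> /(_ isT kM) hh; rewrite -(pmulr_rle0 _ (f_gt0 _ M0)) (le_trans hh)//.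
  by rewrite mulNr oppr_le0 mulr_ge0 ?th_ge0// catch_ge0.
apply: (expect_super R f p f_gt0 p01 challenge h C (catch 1 M) dd pC) => //.
- rewrite /challenge leader_same/=; last by lia.
  rewrite (sum_mult_birth _ (fun j => catch j M)) ?ltnS//.
  by rewrite addrAC.
- move=> c hc; rewrite /challenge /dd colors_cons /= add0n; case: ifP => cN; last first.
    rewrite leader_same/=; last by rewrite cN andbF.
    rewrite (sum_mult_in _ (fun j => catch j M))/=; last by lia.
    by rewrite addrAC.
  case: ifP => [/eqP cM|cM].
    rewrite leader_up//=; last by lia.
    rewrite (sum_mult_notin _ (fun j => catch j M.+1))/=; last by lia.
    rewrite /D sumrB -/M.
    by rewrite le_eqVlt; apply/orP; left; apply/eqP; ring.
  rewrite leader_same/=; last first.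
    move=> hcN; have := mult_le_leader _ h _ hcN; rewrite -/M.
    by rewrite leq_eqVlt cM.
  by rewrite (sum_mult_notin _ (fun j => catch j M))/= ?addr0//; lia.
rewrite (big_cat_nat _ (n := N.+1))//=.
(* One color at level [M] yields the term [f M * D]; colors tied with it can only help, as
   [D <= 0]. *)
have [x0 hx0 ex0] := leader_attained N h M0.
have part1 : \sum_(1 <= c < N.+1) f (mult c h) * (dd c + C * catch 1 M) <=
   f M * D + N%:R * (f M * (C * catch 1 M)).
  under eq_bigr do rewrite mulrDr.
  rewrite big_split/= lerD//.
    rewrite (bigD1_seq x0) ?iota_uniq ?mem_index_iota//=.
    have -> : dd x0 = D by rewrite /dd (_ : (x0 <= N)%N) ?ex0 ?eqxx//; lia.
    rewrite ex0 gerDl big_seq_cond sumr_le0// => c /andP[]; rewrite mem_index_iota => hc _.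
    rewrite mulr_ge0_le0//.
      by rewrite ltW// f_gt0// valid_mult_gt0//; lia.
    rewrite /dd (_ : (c <= N)%N); last by lia.
    by case: ifP.
  rewrite (_ : N%:R * _ = \sum_(1 <= c < N.+1) f M * (C * catch 1 M)); last first.
    by rewrite sumr_const_nat subn1 -[RHS]mulr_natl.
  rewrite big_nat_cond [leRHS]big_nat_cond; apply: ler_sum => c; rewrite andbT => hc.
  apply: ler_wpM2r; first exact: mulr_ge0.
  apply: f_le; first by rewrite valid_mult_gt0//; lia.
  by apply: mult_le_leader; lia.
have part2 : \sum_(N.+1 <= c < (colors h).+1) f (mult c h) * (dd c + C * catch 1 M) <=
  - (f M * \sum_(N.+1 <= c < (colors h).+1) (catch (mult c h) M.+1 - catch (mult c h) M)).
  rewrite mulr_sumr -sumrN big_nat_cond [leRHS]big_nat_cond; apply: ler_sum => c.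
  rewrite andbT => hc; have := bound c hc; rewrite /dd ifF; last by lia.
  by lra.
apply: (le_trans (lerD part1 part2)).
have fM := f_gt0 _ M0.
have -> : f M * D + N%:R * (f M * (C * catch 1 M)) - f M *
   \sum_(N.+1 <= c < (colors h).+1) (catch (mult c h) M.+1 - catch (mult c h) M)
  = f M * (N%:R * C * (zeta M.+1 - zeta M + catch 1 M)) by rewrite /D; ring.
by rewrite mulr_ge0_le0 ?(ltW fM)// mulr_ge0_le0 ?mulr_ge0//; lra.
Qed.

End Overtake.

(** * Rates and newborn budget for fast growing [f] *)

Section Scales.
Variables (R : realType) (f : nat -> R).
Hypothesis f_gt0 : forall j, (0 < j)%N -> 0 < f j.
Hypothesis f_le : forall i j, (0 < i)%N -> (i <= j)%N -> f i <= f j.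
(** The coefficients are those of [(1 + 2 * y) ^ 4] without the constant term. *)
Definition fast_const : R :=
  8 + 24 * (f 1)^-1 + 32 * (f 1)^-1 ^+ 2 + 16 * (f 1)^-1 ^+ 3.
Definition fast (m : nat) : R := fast_const * rt m ^+ 4.

Let f1_gt0 : 0 < f 1. Proof. exact: f_gt0. Qed.

Lemma fast_const_ge : 8 <= fast_const.
Proof.
have x0 : 0 <= (f 1)^-1 by rewrite invr_ge0 ltW.
have := exprn_ge0 2 x0; have := exprn_ge0 3 x0; rewrite /fast_const; lra.
Qed.

Lemma fast_le m : fast m <= fast m.+1.
Proof.
apply: ler_wpM2l; first by apply: le_trans fast_const_ge.
by rewrite lerXn2r ?nnegrE ?rt_ge0// rt_le.
Qed.

Lemma fast_ge m : (0 < m)%N -> rt m <= fast m.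
Proof.
move=> m0; have r1 := rt_ge1 R m m0; have c8 := fast_const_ge.
have r0 : 0 <= rt m :> R := rt_ge0 R m.
apply: (le_trans (y := 1 * rt m ^+ 4)); last first.
  by apply: ler_wpM2r; [exact: exprn_ge0|lra].
by rewrite mul1r ler_eXnr.
Qed.

(** Each factor on the left is at most [(1 + 2 * r * x) ^ 4] with [r = rt m >= 1] and
    [x = 1 / f i <= 1 / f 1]; in its expansion all powers of [r] are at most [r ^ 4], and all but
    one factor [x] are replaced by [1 / f 1]. The cube is meant to cancel the one in the number of
    steps of [low_rare]. *)
Lemma growth_fast m : (0 < m)%N ->
  growth f (2 * rt m) m ^+ 3 * growth f (rt m) m <= growth f (fast m) m.
Proof.
move=> m0; rewrite /growth -prodrXl -big_split/=.
rewrite [leLHS]big_nat_cond [leRHS]big_nat_cond.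
apply: ler_prod => i /andP[/andP[i0 _] _].
have fi := f_gt0 i i0; have le_fi := f_le 1 i isT i0.
rewrite /fast /fast_const.
have r1 := rt_ge1 R m m0; move: (rt m) r1 (rt_ge0 R m) => r r1 r0.
have xX : (f i)^-1 <= (f 1)^-1 by rewrite lef_pV2.
have x0 : 0 <= (f i)^-1 by rewrite invr_ge0 ltW.
move: (f i)^-1 (f 1)^-1 xX x0 => x X xX x0.
have X0 : 0 <= X by lra.
apply/andP; split; first by rewrite mulr_ge0 ?exprn_ge0 ?addr_ge0 ?mulr_ge0.
have rx : 0 <= r * x by rewrite mulr_ge0.
apply: (le_trans (y := (1 + 2 * r * x) ^+ 4)).
  rewrite [leRHS]exprSr; apply: ler_wpM2l; last by lra.
  by rewrite exprn_ge0 ?addr_ge0 ?mulr_ge0.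
rewrite (_ : (1 + 2 * r * x) ^+ 4 =
  1 + x * (8 * r + 24 * (r ^+ 2 * x) + 32 * (r ^+ 3 * x ^+ 2) + 16 * (r ^+ 4 * x ^+ 3))); last by ring.
rewrite lerD2l mulrC; apply: ler_wpM2r => //.
have h1 : r <= r ^+ 4 by rewrite ler_eXnr.
have h2 : r ^+ 2 * x <= r ^+ 4 * X.
  by apply: ler_pM; rewrite ?exprn_ge0// ler_weXn2l.
have h3 : r ^+ 3 * x ^+ 2 <= r ^+ 4 * X ^+ 2.
  by apply: ler_pM; rewrite ?exprn_ge0// ?ler_weXn2l// lerXn2r.
have h4 : r ^+ 4 * x ^+ 3 <= r ^+ 4 * X ^+ 3.
  by apply: ler_wpM2l; rewrite ?exprn_ge0// lerXn2r.
rewrite [leRHS](_ : _ = 8 * r ^+ 4 + 24 * (r ^+ 4 * X) + 32 * (r ^+ 4 * X ^+ 2) +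
  16 * (r ^+ 4 * X ^+ 3)); last by ring.
by rewrite !lerD// ler_wpM2l.
Qed.

(** In terms of the fourth roots [u] and [v] of [m] and [m + 1]: the identity [v ^ 4 - u ^ 4 = 1]
    bounds [v - u] from below, and [v <= 2 * u] controls the denominators. *)
Lemma inv_rt40_telescope m : (0 < m)%N ->
  (rt m ^+ 40)^-1 <= 128 * ((rt m ^+ 8)^-1 - (rt m.+1 ^+ 8)^-1) :> R.
Proof.
move=> m0.
set u := rt m ^+ 8; set v := rt m.+1 ^+ 8.
have -> : rt m ^+ 40 = u ^+ 5 by rewrite /u -exprM.
have u0 : 0 < u by rewrite exprn_gt0// rt_gt0.
have uv : u <= v by rewrite lerXn2r ?nnegrE ?rt_ge0// rt_le.
have v0 : 0 < v by rewrite (lt_le_trans u0).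
have e4 : v ^+ 4 = u ^+ 4 + 1 by rewrite /u /v -!exprM !rtX natr1.
have u1 : 1 <= u by rewrite exprn_ege1// rt_ge1.
clearbody u v.
have v2u : v <= 2 * u.
  suff : v ^+ 4 <= (2 * u) ^+ 4.
    by rewrite ler_pXn2r ?nnegrE ?(ltW v0)// mulr_ge0 ?(ltW u0).
  rewrite e4 exprMn (_ : 2 ^+ 4 = 16 :> R); last by ring.
  have : 1 <= u ^+ 4 by rewrite exprn_ege1.
  by move: (u ^+ 4) => z; lra.
have -> : u^-1 - v^-1 = (v - u) / (u * v) by field; rewrite !gt_eqF.
rewrite mulrA ler_pdivlMr ?mulr_gt0// ler_pdivrMl ?exprn_gt0//.
have vu1 : 1 <= (v - u) * (4 * v ^+ 3).
  rewrite [leLHS](_ : 1 = (v - u) * ((v + u) * (v ^+ 2 + u ^+ 2))); last first.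
    by rewrite [LHS](_ : 1 = v ^+ 4 - u ^+ 4); [ring|rewrite e4; ring].
  apply: ler_wpM2l; first by rewrite subr_ge0.
  rewrite (_ : 4 * v ^+ 3 = (2 * v) * (2 * v ^+ 2)); last by ring.
  have uv2 : u ^+ 2 <= v ^+ 2 by rewrite lerXn2r ?nnegrE ?(ltW u0) ?(ltW v0).
  by apply: ler_pM; rewrite ?addr_ge0 ?sqr_ge0 ?(ltW u0) ?(ltW v0)//; lra.
apply: (le_trans (y := u * v * ((v - u) * (4 * v ^+ 3)))).
  by rewrite ler_peMr// mulr_ge0// ltW.
rewrite (_ : u * v * _ = (u * (v - u)) * (4 * v ^+ 4)); last by ring.
rewrite (_ : u ^+ 5 * _ = (u * (v - u)) * (128 * u ^+ 4)); last by ring.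
apply: ler_wpM2l; first by rewrite mulr_ge0 ?subr_ge0// ltW.
have : v ^+ 4 <= (2 * u) ^+ 4 by rewrite lerXn2r ?nnegrE ?(ltW v0)// mulr_ge0 ?(ltW u0).
have : 0 <= u ^+ 4 by rewrite exprn_ge0 ?ltW.
rewrite exprMn (_ : 2 ^+ 4 = 16 :> R); last by ring.
by move: (u ^+ 4) (v ^+ 4) => a b; lra.
Qed.

(** Each term is at most [fast_const ^ 2] times [rt i ^ 8 / rt i ^ 48], that is [1 / rt i ^ 40],
    which telescopes. *)
Lemma fast_sum (k : nat) : (0 < k)%N ->
  (forall m, (k <= m)%N -> rt m ^+ 24 <= f m) ->
  forall m, \sum_(k <= i < m) (fast i / f i) ^+ 2 <= fast_const ^+ 2 * 128 / rt k ^+ 8.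
Proof.
move=> k0 hf m.
have rr i : 0 <= (rt i ^+ 8)^-1 :> R by rewrite invr_ge0 exprn_ge0// rt_ge0.
have c2 : 0 <= fast_const ^+ 2 * 128 by rewrite mulr_ge0// sqr_ge0.
have [mk|km] := leqP m k.
  by rewrite big_geq// mulr_ge0.
apply: (le_trans (y := fast_const ^+ 2 * 128 *
   \sum_(k <= i < m) ((rt i ^+ 8)^-1 - (rt i.+1 ^+ 8)^-1))).
  rewrite mulr_sumr big_nat_cond [leRHS]big_nat_cond; apply: ler_sum => i.
  rewrite andbT => /andP[ki _]; have i0 : (0 < i)%N by lia.
  rewrite -mulrA; apply: (le_trans (y := fast_const ^+ 2 * (rt i ^+ 40)^-1)); last first.
    by apply: ler_wpM2l; [exact: sqr_ge0|exact: inv_rt40_telescope].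
  have r0 := rt_gt0 R i i0.
  rewrite /fast expr_div_n exprMn -mulrA; apply: ler_wpM2l; first exact: sqr_ge0.
  have -> : (rt i ^+ 40)^-1 = rt i ^+ 4 ^+ 2 / (rt i ^+ 24) ^+ 2 :> R.
    by field; rewrite gt_eqF.
  apply: ler_wpM2l; first exact: sqr_ge0.
  rewrite lef_pV2 ?posrE ?exprn_gt0 ?f_gt0//.
  by rewrite lerXn2r ?nnegrE ?exprn_ge0 ?(ltW r0) ?(ltW (f_gt0 _ i0))// hf.
apply: ler_wpM2l => //.
have -> : \sum_(k <= i < m) ((rt i ^+ 8)^-1 - (rt i.+1 ^+ 8)^-1) =
  (rt k ^+ 8)^-1 - (rt m ^+ 8)^-1 :> R.
  rewrite -[LHS]opprK -sumrN; under eq_bigr do rewrite opprB.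
  by rewrite telescope_sumr ?(ltnW km)// opprB.
by rewrite gerBl.
Qed.

Variable k : nat.
Hypothesis k_large : (256 < k)%N.

Let D := growth f (2 * rt k) k.
(** Makes [births_scale / m] a bound for the sum of [catch 1 i] over [i >= m], for [m >= k]. *)
Definition births_scale : R := 2 * f 256 ^+ 256 / (D ^+ 3 * k%:R ^+ 6).
Definition births_left (m : nat) : R := births_scale / m%:R.

Let D_gt0 : 0 < D.
Proof. by apply: growth_gt0 => //; rewrite mulr_ge0// rt_ge0. Qed.
Let k_gt0' : 0 < k%:R :> R. Proof. by rewrite ltr0n; lia. Qed.

Lemma births_scale_ge0 : 0 <= births_scale.
Proof.
have A0 : 0 <= f 256 ^+ 256 by apply: exprn_ge0; exact/ltW/f_gt0.
rewrite /births_scale; move: (f 256 ^+ 256) A0 => A A0.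
apply: divr_ge0; first exact: mulr_ge0.
by apply: mulr_ge0; apply: exprn_ge0 => //; exact: ltW.
Qed.

Lemma births_left_ge0 m : 0 <= births_left m.
Proof. by rewrite divr_ge0 ?births_scale_ge0. Qed.

Lemma births_left_le m : (k <= m)%N -> births_left m <= births_left k.
Proof.
move=> km; apply: ler_wpM2l; first exact: births_scale_ge0.
by rewrite lef_pV2 ?posrE ?ltr0n ?ler_nat//; lia.
Qed.

Variable C : R.
Hypothesis C_ge0 : 0 <= C.

Lemma births_left_step m : (k <= m)%N ->
  catch R f C k fast 1 m <= births_left m - births_left m.+1.
Proof.
move=> km; have m0 : (0 < m)%N by lia.
have m0' : 0 < m%:R :> R by rewrite ltr0n.
have m1' : 0 < m.+1%:R :> R by rewrite ltr0n.
have r0 := rt_ge0 R m.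
have f256 := f_gt0 256 isT.
have g0 j := growth_gt0 R f f_gt0 _ j (le_trans r0 (fast_ge m m0)).
rewrite catch1//; last by lia.
have -> : births_left m - births_left m.+1 = births_scale / (m%:R * m.+1%:R).
  by rewrite /births_left -natr1; field; rewrite ?(natr1,nat1r) !gt_eqF.
apply: (le_trans (y := (growth f (fast m) m)^-1)).
  rewrite ler_piMl ?invr_ge0 ?(ltW (g0 _))//.
  exact: margin_le1.
(* The cube comes from [growth_fast], and the first 256 factors at rate [rt m] give
   [rt m ^ 256 = m ^ 8]. Six of these eight powers become [k ^ 6], and the other two telescope. *)
have lower : D ^+ 3 * (m%:R ^+ 8 / f 256 ^+ 256) <= growth f (fast m) m.
  apply: le_trans (growth_fast m m0); apply: ler_pM.
  - by rewrite exprn_ge0 ?ltW.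
  - by rewrite divr_ge0 ?exprn_ge0 ?ltW.
  - have g2 := growth_gt0 R f f_gt0 (2 * rt m) m (mulr_ge0 (ler0n _ 2) r0).
    apply: lerXn2r; rewrite ?nnegrE; [exact: ltW|exact: ltW|].
    apply: (le_trans (y := growth f (2 * rt k) m)).
      by apply: growth_le => //; rewrite mulr_ge0 ?rt_ge0.
    apply: growth_le_param => //; first by rewrite mulr_ge0 ?rt_ge0.
    by rewrite ler_pM2l ?ltr0n// rt_le.
  apply: le_trans (growth_lower _ _ f_gt0 f_le (rt m) 256 m r0 isT _); last by lia.
  by rewrite expr_div_n -[X in rt _ ^+ X]/(32 * 8)%N exprM rtX.
apply: (le_trans (y := (D ^+ 3 * (m%:R ^+ 8 / f 256 ^+ 256))^-1)).
  have low0 : 0 < D ^+ 3 * (m%:R ^+ 8 / f 256 ^+ 256).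
    by rewrite mulr_gt0 ?exprn_gt0// divr_gt0 ?exprn_gt0.
  by rewrite lef_pV2 ?posrE ?g0.
rewrite /births_scale.
set A := f 256 ^+ 256; have A0 : 0 < A by rewrite exprn_gt0.
rewrite (_ : (D ^+ 3 * (m%:R ^+ 8 / A))^-1 =
   A / D ^+ 3 * (m%:R ^+ 8)^-1); last by field; rewrite !gt_eqF.
rewrite (_ : 2 * A / (D ^+ 3 * k%:R ^+ 6) / (m%:R * m.+1%:R) =
   A / D ^+ 3 * (2 / (k%:R ^+ 6 * (m%:R * m.+1%:R)))); last first.
  by rewrite -natr1; field; rewrite ?(natr1,nat1r) !gt_eqF.
apply: ler_wpM2l; first by rewrite divr_ge0 ?exprn_ge0 ?ltW.
rewrite -invf_div lef_pV2 ?posrE ?exprn_gt0 ?divr_gt0 ?mulr_gt0 ?exprn_gt0//.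
rewrite ler_pdivrMr// (_ : m%:R ^+ 8 * 2 = m%:R ^+ 6 * (m%:R * (2 * m%:R))); last by ring.
apply: ler_pM; rewrite ?exprn_ge0 ?mulr_ge0//.
  by rewrite lerXn2r ?nnegrE// ler_nat.
have : 1 <= m%:R :> R by rewrite ler1n.
by rewrite ler_pM2l// -natr1; lra.
Qed.

End Scales.

(** * The rotation martingale *)

Section Rotation.
Variables (R : realType) (f : nat -> R).
Hypothesis f_gt0 : forall j, (0 < j)%N -> 0 < f j.
Variable t : R.

(* Real and imaginary parts of [\prod_(1 <= i < j) (1 - 'i * t / f i)]. *)
Fixpoint rot (j : nat) : R * R :=
  if j is i.+1 then
    if i is 0%N then (1, 0)
    else ((rot i).1 + t / f i * (rot i).2, (rot i).2 - t / f i * (rot i).1)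
  else (1, 0).

(** The real part of [u i] times the conjugate of [u j], where [u] is the complex product coded by
    [rot]. *)
Definition rot_dot (i j : nat) : R := (rot i).1 * (rot j).1 + (rot i).2 * (rot j).2.

Lemma rotS j : (0 < j)%N ->
  rot j.+1 = ((rot j).1 + t / f j * (rot j).2, (rot j).2 - t / f j * (rot j).1).
Proof. by case: j. Qed.

(** A draw of the first color brings the factor [1 - 'i * t / f i], one of the second the conjugated
    factor [1 + 'i * t / f j]; weighted by the rates [f i] and [f j], the two increments are
    opposite. *)
Lemma inner_drift i j : (0 < i)%N -> (0 < j)%N ->
  f i * (rot_dot i.+1 j - rot_dot i j) + f j * (rot_dot i j.+1 - rot_dot i j) = 0.
Proof.
move=> i0 j0; have fi := f_gt0 i i0; have fj := f_gt0 j j0.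
by rewrite /rot_dot !rotS//=; field; rewrite !gt_eqF.
Qed.

Lemma inner_normS j : (0 < j)%N ->
  rot_dot j.+1 j.+1 = rot_dot j j * (1 + (t / f j) ^+ 2).
Proof. by move=> j0; rewrite /rot_dot rotS//=; ring. Qed.

Lemma inner_norm_ge1 j : 1 <= rot_dot j j.
Proof.
elim: j => [|j IH]; first by rewrite /rot_dot/=; lra.
have [->|j0] := posnP j; first by rewrite /rot_dot/=; lra.
by rewrite inner_normS// mulr_ege1// lerDl sqr_ge0.
Qed.

Lemma inner_norm_le i j : (0 < i)%N -> (i <= j)%N -> rot_dot i i <= rot_dot j j.
Proof.
move=> i0; elim: j => [|j IH]; first by lia.
rewrite leq_eqVlt => /orP[/eqP->//|]; rewrite ltnS => ij.
apply: (le_trans (IH ij)); rewrite inner_normS; last by lia.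
rewrite ler_peMr//; last by rewrite lerDl sqr_ge0.
by apply: le_trans (inner_norm_ge1 j).
Qed.

(* AM-GM form of Cauchy-Schwarz. *)
Lemma inner_ge i j a : 0 < a -> - (a * rot_dot j j + rot_dot i i / a) / 2 <= rot_dot i j.
Proof.
move=> a0; rewrite -subr_ge0.
have -> : rot_dot i j - - (a * rot_dot j j + rot_dot i i / a) / 2 =
  (((rot i).1 + a * (rot j).1) ^+ 2 + ((rot i).2 + a * (rot j).2) ^+ 2) / (2 * a).
  by rewrite /rot_dot; field; rewrite gt_eqF.
by rewrite divr_ge0 ?addr_ge0 ?sqr_ge0// mulr_ge0// ltW.
Qed.

Lemma inner_le i j a : 0 < a -> rot_dot i j <= (a * rot_dot j j + rot_dot i i / a) / 2.
Proof.
move=> a0; rewrite -subr_ge0.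
have -> : (a * rot_dot j j + rot_dot i i / a) / 2 - rot_dot i j =
  (((rot i).1 - a * (rot j).1) ^+ 2 + ((rot i).2 - a * (rot j).2) ^+ 2) / (2 * a).
  by rewrite /rot_dot; field; rewrite gt_eqF.
by rewrite divr_ge0 ?addr_ge0 ?sqr_ge0// mulr_ge0// ltW.
Qed.

Hypothesis t_ge0 : 0 <= t.

Let size1 j := `|(rot j).1| + `|(rot j).2|.

(** In the norm [|x| + |y|], each factor moves the product by at most [t / f i] times its size, and
    the size grows at most like [growth]; both bounds are proved together. *)
Lemma rot_drift L j : (0 < L)%N -> (L <= j)%N ->
  `|(rot j).1 - (rot L).1| + `|(rot j).2 - (rot L).2| <=
  size1 L * (growth f t j / growth f t L - 1).
Proof.
move=> L0; have g0 i := growth_gt0 R f f_gt0 t i t_ge0.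
suff H : (L <= j)%N -> `|(rot j).1 - (rot L).1| + `|(rot j).2 - (rot L).2| <=
  size1 L * (growth f t j / growth f t L - 1) /\
   size1 j <= size1 L * (growth f t j / growth f t L).
  by move=> /H[].
elim: j => [|j IH]; first by lia.
rewrite leq_eqVlt => /orP[/eqP<-|].
  by rewrite !subrr divff ?gt_eqF// subrr normr0 addr0 mulr0 mulr1.
rewrite ltnS => Lj; have [IH1 IH2] := IH Lj.
have j0 : (0 < j)%N by lia.
have fj := f_gt0 j j0.
have x0 : 0 <= t / f j by rewrite divr_ge0// ltW.
rewrite growthS// rotS//= /size1 rotS//=.
rewrite -/(size1 L).
set x := t / f j in x0 *; set a := (rot j).1; set b := (rot j).2.
set a' := (rot L).1; set b' := (rot L).2.
have n1 : `|x * b| = x * `|b| by rewrite normrM ger0_norm.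
have n2 : `|x * a| = x * `|a| by rewrite normrM ger0_norm.
have e1 := ler_normD a (x * b); have e2 := ler_normB b (x * a).
have e3 := ler_normD (a - a') (x * b); have e4 := ler_normB (b - b') (x * a).
rewrite addrAC in e3; rewrite addrAC in e4.
rewrite n1 in e1 e3; rewrite n2 in e2 e4.
set q := growth f t j / growth f t L in IH1 IH2.
have -> : growth f t j * (1 + x) / growth f t L = q * (1 + x) by rewrite /q; ring.
rewrite -/a -/b -/a' -/b' in IH1.
have IH2x := ler_wpM2r x0 IH2.
rewrite /size1 -/a -/b -/a' -/b' in IH1 IH2 IH2x *.
split.
  apply: (le_trans (lerD e3 e4)); nra.
apply: (le_trans (lerD e1 e2)); nra.
Qed.

(** The displacement is at most 1 / 8 of the 1-norm, whose square is at most twice the squared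
    Euclidean norm: this gives [2 / 64 = 1 / 32]. *)
Lemma rot_close L j : (0 < L)%N -> (L <= j)%N ->
  growth f t j <= (1 + 1 / 8) * growth f t L ->
  ((rot j).1 - (rot L).1) ^+ 2 + ((rot j).2 - (rot L).2) ^+ 2 <= rot_dot L L / 32.
Proof.
move=> L0 Lj hg; have g0 := growth_gt0 R f f_gt0 t L t_ge0.
have := rot_drift L j L0 Lj.
have s0 : 0 <= size1 L by rewrite addr_ge0.
have q8 : growth f t j / growth f t L - 1 <= 1 / 8.
  by rewrite lerBlDl ler_pdivrMr.
move=> /le_trans /(_ (ler_wpM2l s0 q8)).
have : size1 L ^+ 2 <= 2 * rot_dot L L.
  rewrite /size1 /rot_dot -!expr2 -[(rot L).1 ^+ 2]real_normK ?num_real//.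
  rewrite -[(rot L).2 ^+ 2]real_normK ?num_real//.
  by have := sqr_ge0 (`|(rot L).1| - `|(rot L).2|); nra.
rewrite -[((rot j).1 - _) ^+ 2]real_normK ?num_real//.
rewrite -[((rot j).2 - _) ^+ 2]real_normK ?num_real//.
move: (size1 L) (rot_dot L L) s0 (normr_ge0 ((rot j).1 - (rot L).1))
  (normr_ge0 ((rot j).2 - (rot L).2)).
move: (`|(rot j).1 - (rot L).1|) (`|(rot j).2 - (rot L).2|) => u v s N s0 u0 v0 h1 h2.
have h3 : (u + v) ^+ 2 <= (s * (1 / 8)) ^+ 2.
  by rewrite lerXn2r// nnegrE ?addr_ge0// mulr_ge0.
have := mulr_ge0 u0 v0; move: h3.
rewrite (_ : (u + v) ^+ 2 = u ^+ 2 + 2 * (u * v) + v ^+ 2); last by ring.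
rewrite (_ : (s * (1 / 8)) ^+ 2 = s ^+ 2 / 64); last by field.
lra.
Qed.

Variable L : nat.
Hypothesis L_gt0 : (0 < L)%N.
Hypothesis close : forall j, (L <= j)%N -> growth f t j <= (1 + 1 / 8) * growth f t L.

Lemma inner_late i j : (L <= i)%N -> (L <= j)%N -> rot_dot L L / 2 <= rot_dot i j.
Proof.
move=> Li Lj; have := rot_close L i L_gt0 Li (close i Li).
have := rot_close L j L_gt0 Lj (close j Lj).
rewrite /rot_dot; move: (rot i) (rot j) (rot L) => [a b] [a' b'] [x y] /=.
set da := a - x; set db := b - y; set da' := a' - x; set db' := b' - y.
have -> : a = x + da by rewrite /da; ring.
have -> : b = y + db by rewrite /db; ring.
have -> : a' = x + da' by rewrite /da'; ring.
have -> : b' = y + db' by rewrite /db'; ring.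
move: da db da' db' => u v u' v' h1 h2.
(* These squares control the cross terms of the scalar product expanded around [rot L]. *)
have := sqr_ge0 (x + 4 * u); have := sqr_ge0 (y + 4 * v).
have := sqr_ge0 (x + 4 * u'); have := sqr_ge0 (y + 4 * v').
have := sqr_ge0 (u + u'); have := sqr_ge0 (v + v').
have := sqr_ge0 x; have := sqr_ge0 y.
move: h1 h2; rewrite !expr2; lra.
Qed.

Lemma inner_norm_max j : rot_dot j j <= 2 * rot_dot L L.
Proof.
have [Lj|jL] := leqP L j.
  have := rot_close L j L_gt0 Lj (close j Lj).
  rewrite /rot_dot; move: (rot j) (rot L) => [a b] [x y] /=.
  have := sqr_ge0 (2 * x - a); have := sqr_ge0 (2 * y - b).
  have := sqr_ge0 (4 * (a - x) - x); have := sqr_ge0 (4 * (b - y) - y).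
  have := sqr_ge0 x; have := sqr_ge0 y.
  rewrite !expr2; lra.
have [->|j0] := posnP j.
  have := inner_norm_ge1 L; rewrite [X in _ -> X <= _](_ : _ = 1); first by lra.
  by rewrite /rot_dot/=; ring.
have := inner_norm_le j L j0 (ltnW jL); have := inner_norm_ge1 L; lra.
Qed.

End Rotation.

(** * Growth products against partial sums of [1 / f] *)

Section Growths.
Variables (R : realType) (f : nat -> R).
Hypothesis f_gt0 : forall j, (0 < j)%N -> 0 < f j.

Lemma growth_ge_sum t j : 0 <= t ->
  1 + t * \sum_(1 <= i < j) (f i)^-1 <= growth f t j.
Proof.
move=> t0; elim: j => [|[|j] IH].
- by rewrite /growth !big_geq// mulr0 addr0.
- by rewrite growth1 big_geq// mulr0 addr0.
rewrite growthS// big_nat_recr//= mulrDr mulrDr mulr1 addrA lerD//.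
rewrite ler_peMl ?divr_ge0 ?(ltW (f_gt0 _ _))//.
exact: growth_ge1.
Qed.

Lemma growth_le_exp t j : 0 <= t ->
  growth f t j <= expR (t * \sum_(1 <= i < j) (f i)^-1).
Proof.
move=> t0; elim: j => [|[|j] IH].
- by rewrite /growth !big_geq// mulr0 expR0.
- by rewrite growth1 big_geq// mulr0 expR0.
rewrite growthS// big_nat_recr//= [in leRHS]mulrDr expRD; apply: ler_pM => //.
- by rewrite ltW// growth_gt0.
- by rewrite addr_ge0// divr_ge0// ltW// f_gt0.
exact: expR_ge1Dx.
Qed.

(** The sequence is nondecreasing and bounded by [growth_le_exp], so it comes within a factor
    [1 + e] of its supremum. *)
Lemma growth_stabilizes t (A e : R) : 0 <= t -> 0 < e ->
  (forall j, \sum_(1 <= i < j) (f i)^-1 <= A) ->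
  exists L0, forall L j, (L0 <= L)%N -> growth f t j <= (1 + e) * growth f t L.
Proof.
move=> t0 e0 hA.
pose U := [set growth f t j | j in setT].
have supU : has_sup U.
  split; first by exists (growth f t 0); exists 0%N.
  exists (expR (t * A)) => _ [j _ <-]; apply: (le_trans (growth_le_exp _ _ t0)).
  by rewrite ler_expR ler_wpM2l.
have ub j : growth f t j <= sup U by apply: (ub_le_sup supU.2); exists j.
have s1 : 1 <= sup U.
  by apply: le_trans (ub 1%N); rewrite growth1.
have e1 : 0 < 1 + e by lra.
have d0 : 0 < sup U - sup U / (1 + e).
  by rewrite subr_gt0 ltr_pdivrMr// ltr_pMr; lra.
have [_ [L0 _ <-] hL0] := sup_adherent d0 supU.
exists L0 => L j LL; apply: (le_trans (ub j)).
have := growth_le R f f_gt0 t L0 L t0 LL.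
rewrite opprB addrCA subrr addr0 in hL0.
move=> h; rewrite mulrC -ler_pdivrMr//; apply: le_trans h; exact: ltW.
Qed.

End Growths.

Lemma eps_nat (R : realType) (c e : R) : 0 < e -> exists k0, forall k, (k0 <= k)%N -> c / k%:R <= e.
Proof.
move=> e0; have [k0 h] := nat_large R (`|c| / e).
exists k0.+1 => k hk; have kp : 0 < k%:R :> R by rewrite ltr0n; lia.
rewrite ler_pdivrMr// mulrC -ler_pdivrMr//.
apply: le_trans (h k (ltnW hk)); apply: ler_wpM2r; first by rewrite invr_ge0 ltW.
exact: ler_norm.
Qed.

(** * Measurability of countable quantifiers *)

Section Quantifiers.
Context {d : measure_display} {T : measurableType d}.

Lemma measurable_forall (A : nat -> set T) :
  (forall n, measurable (A n)) -> measurable [set w | forall n, A n w].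
Proof.
move=> mA; rewrite (_ : [set w | _] = \bigcap_n A n); first exact: bigcapT_measurable.
by apply/seteqP; split=> w /= h n; [move=> _; exact: h|exact: h].
Qed.

Lemma measurable_exists (A : nat -> set T) :
  (forall n, measurable (A n)) -> measurable [set w | exists n, A n w].
Proof.
move=> mA; rewrite (_ : [set w | _] = \bigcup_n A n); first exact: bigcupT_measurable.
by apply/seteqP; split=> w /= [n]; [exists n|move=> _; exists n].
Qed.

End Quantifiers.

Lemma bounded_stationary (u : nat -> nat) (L : nat) :
  (forall n, (u n <= L)%N) -> exists n0, forall n, (u n <= u n0)%N.
Proof.
elim: L => [|L IH] uL; first by exists 0%N => n; apply: leq_trans (uL n) _.
have [[n hn]|h] := pselect (exists n, u n = L.+1).
  by exists n => m; rewrite hn.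
apply: IH => n; have := uL n; rewrite leq_eqVlt => /orP[/eqP e|//].
by exfalso; apply: h; exists n.
Qed.

Lemma sum_single (R : realType) (g : nat -> R) (c n : nat) (v : R) :
  (0 < c < n)%N ->
  \sum_(1 <= x < n) g x * (if x == c then v else 0) = g c * v.
Proof.
move=> hc; rewrite (bigD1_seq c) ?iota_uniq ?mem_index_iota//= eqxx.
by rewrite big1 ?addr0// => x /negbTE ->; rewrite mulr0.
Qed.

(** * The urn process *)

Section Urn.
Context {d : measure_display} {T : measurableType d} {R : realType}.
Variables (P : probability T R) (F : R -> R) (p : nat -> R).
Variables (B : nat -> T -> bool) (S : nat -> T -> nat).
Hypothesis urnP : is_triggered_urn P F p B S.
Let f := fun j : nat => F j%:R.
Hypothesis f_gt0 : forall j, (0 < j)%N -> 0 < f j.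
Hypothesis f_le : forall i j, (0 < i)%N -> (i <= j)%N -> f i <= f j.
Hypothesis p01 : forall n, (0 < n)%N -> 0 < p n < 1.

Local Notation law := (law R f p).
Local Notation clock := (clock R f p).
Local Notation E := (expect R f p).
Let f1_gt0 : 0 < f 1 := f_gt0 1 isT.
Let law_pos h : valid h -> 0 <= law h := law_ge0 R f p f_gt0 p01 h.

Definition hist (n : nat) (w : T) : history := past (B^~ w) (S^~ w) n.

(** Histories are countably many, so any predicate on them gives a countable union of cylinders. *)
Lemma measurable_hist (Q : history -> Prop) n : measurable [set w | Q (hist n w)].
Proof.
have mh h : measurable [set w | hist n w = h].
  elim: n h => [|n IH] [|y h].
  - rewrite (_ : [set w | _] = setT); first exact: measurableT.
    by apply/seteqP; split.
  - rewrite (_ : [set w | _] = set0); first exact: measurable0.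
    by apply/seteqP; split.
  - rewrite (_ : [set w | _] = set0); first exact: measurable0.
    by apply/seteqP; split.
  have [mB [mS _]] := urnP.
  rewrite (_ : [set w | _] = [set w | B n w = y.1] `&`
     ([set w | S n.+1 w = y.2] `&` [set w | hist n w = h])).
    by apply: measurableI => //; apply: measurableI.
  apply/seteqP; split=> w /=; first by rewrite /hist/= => -[<- <-].
  by rewrite /hist/= => -[-> [-> ->]]; rewrite -surjective_pairing.
rewrite (_ : [set w | _] =
    \bigcup_h (if pselect (Q h) then [set w | hist n w = h] else set0)).
  apply: countable_bigcupT_measurable; first exact: countableP.
  by move=> h; case: (pselect (Q h)) => q /=; [exact: mh|exact: measurable0].
apply/seteqP; split=> w /=; last by move=> [h _]; case: pselect => //= Qh ->.
by move=> Qw; exists (hist n w) => //; case: pselect.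
Qed.

Definition Pr (A : set T) : R := fine (P A).

Lemma PrE A : measurable A -> P A = (Pr A)%:E.
Proof. by move=> mA; rewrite fineK// fin_num_measure. Qed.

Lemma Pr_ge0 A : 0 <= Pr A.
Proof. exact/fine_ge0/measure_ge0. Qed.

Lemma PrT : Pr setT = 1.
Proof. by rewrite /Pr probability_setT. Qed.

Lemma Pr0 : Pr set0 = 0.
Proof. by rewrite /Pr measure0. Qed.

Lemma le_Pr A A' : measurable A -> measurable A' -> A `<=` A' -> Pr A <= Pr A'.
Proof.
by move=> mA mA' AA'; rewrite -lee_fin -!PrE// le_measure// inE.
Qed.

Lemma PrD A A' : measurable A -> measurable A' -> A `&` A' = set0 ->
  Pr (A `|` A') = Pr A + Pr A'.
Proof.
move=> mA mA' AA'; apply: EFin_inj; rewrite EFinD -!PrE//.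
  exact: measureU.
exact: measurableU.
Qed.

Lemma PrU_le A A' : measurable A -> measurable A' -> Pr (A `|` A') <= Pr A + Pr A'.
Proof.
move=> mA mA'; rewrite -lee_fin EFinD -!PrE//; last exact: measurableU.
exact: measureU2.
Qed.

Lemma Pr_bigcup_cvg (A : nat -> set T) : (forall n, measurable (A n)) ->
  (forall n m, (n <= m)%N -> A n `<=` A m) ->
  (fun n => Pr (A n)) @ \oo --> Pr (\bigcup_n A n).
Proof.
move=> mA homoA; have mU := bigcupT_measurable _ mA.
apply: (@fine_cvg _ _ _ _ (P \o A)); rewrite -PrE//.
by apply: nondecreasing_cvg_mu => // n m nm; apply/subsetPset; exact: homoA.
Qed.

Lemma Pr_bigcap_cvg (A : nat -> set T) : (forall n, measurable (A n)) ->
  (forall n m, (n <= m)%N -> A m `<=` A n) ->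
  (fun n => Pr (A n)) @ \oo --> Pr (\bigcap_n A n).
Proof.
move=> mA homoA; have mI := bigcapT_measurable mA.
apply: (@fine_cvg _ _ _ _ (P \o A)); rewrite -PrE//.
apply: nonincreasing_cvg_mu => //; first by rewrite ltey_eq fin_num_measure.
by move=> n m nm; apply/subsetPset; exact: homoA.
Qed.

Lemma Pr_bigcup_le (A : nat -> set T) v : (forall n, measurable (A n)) ->
  (forall n m, (n <= m)%N -> A n `<=` A m) ->
  (forall n, Pr (A n) <= v) -> Pr (\bigcup_n A n) <= v.
Proof.
move=> mA homoA hv; have cA := Pr_bigcup_cvg _ mA homoA.
rewrite -(cvg_lim _ cA)//; apply: limr_le; first by apply/cvg_ex; eexists; exact: cA.
exact: nearW.
Qed.

Definition cyl (h : history) : set T := [set w | hist (size h) w = h].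

Lemma measurable_cyl h : measurable (cyl h).
Proof. exact: (measurable_hist (fun g => g = h)). Qed.

Lemma Pr_cyl h : Pr (cyl h) = law h.
Proof.
have [_ [_ hl]] := urnP.
have [b [s e]] := past_surj h.
rewrite -{2}e -urn_law_past; apply: EFin_inj; rewrite -hl -PrE; last first.
  exact: measurable_cyl.
have -> : cyl h = [set w | hist (size h) w = past b s (size h)] by rewrite e.
by congr (P _); apply/seteqP; split=> w /past_eq.
Qed.

Lemma Pr_cyl_seq h (ys : seq (bool * nat)) A : measurable A -> uniq ys ->
  Pr ([set w | hist (size h).+1 w \in [seq y :: h | y <- ys]] `&` A) =
  \sum_(y <- ys) Pr (cyl (y :: h) `&` A).
Proof.
move=> mA; elim: ys => [_|y ys IH /= /andP[yys /IH {}IH]].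
  rewrite big_nil (_ : _ `&` _ = set0) ?Pr0//.
  by apply/seteqP; split=> w //= -[].
rewrite big_cons -IH -PrD.
- congr Pr; apply/seteqP; split=> w /=; rewrite /cyl/= in_cons.
    by move=> [/orP[/eqP|]]; [left|right].
  by move=> [[-> Aw]|[-> Aw]]; rewrite ?eqxx ?orbT.
- by apply: measurableI => //; exact: measurable_cyl.
- apply: measurableI => //.
  exact: (measurable_hist (fun g => g \in [seq y :: h | y <- ys])).
apply/seteqP; split=> w //=; rewrite /cyl/= => -[[-> _] [/mapP[z zys [zy]] _]].
by rewrite zy zys in yys.
Qed.

Lemma uniq_succs h : uniq (succs h).
Proof.
rewrite /succs /= map_inj_uniq ?iota_uniq ?andbT; last by move=> i j [].
by apply/mapP => -[].
Qed.

(** The kernel sums to 1 over [succs h], so the successors carry the whole mass of the cylinder and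
    the rest of it is null. *)
Lemma Pr_cyl_succs h A : measurable A -> valid h ->
  Pr (cyl h `&` A) = \sum_(y <- succs h) Pr (cyl (y :: h) `&` A).
Proof.
move=> mA vh; rewrite -(Pr_cyl_seq _ _ _ mA (uniq_succs h)).
set U := [set w | hist (size h).+1 w \in [seq y :: h | y <- succs h]].
have mU : measurable U.
  exact: (measurable_hist (fun g => g \in [seq y :: h | y <- succs h])).
have mC := measurable_cyl h.
have UC : U `<=` cyl h.
  by move=> w /mapP[y _]; rewrite /cyl /hist/= => -[].
have decomp A' : measurable A' ->
    Pr (cyl h `&` A') = Pr (U `&` A') + Pr ((cyl h `\` U) `&` A').
  move=> mA'; rewrite -PrD.
  - rewrite -setIUl; congr (Pr (_ `&` _)).
    by rewrite setDUK.
  - exact: measurableI.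
  - by apply: measurableI => //; exact: measurableD.
  by apply/seteqP; split=> w //= -[[Uw _] [[_]]].
have rest0 : Pr (cyl h `\` U) = 0.
  have := decomp setT measurableT; rewrite !setIT Pr_cyl.
  rewrite -[U]setIT (Pr_cyl_seq _ _ _ measurableT (uniq_succs h)) setIT.
  under eq_bigr do rewrite setIT Pr_cyl.
  have := expect_cst R f p f_gt0 1 h vh.
  rewrite /expect /=; under eq_bigr do rewrite mulr1.
  rewrite -mulr_sumr => ->; rewrite mulr1 => e.
  by apply: (addrI (law h)); rewrite addr0 -e.
rewrite decomp//; apply/eqP; rewrite -subr_eq0 [X in X - _]addrC addrK.
rewrite eq_le Pr_ge0 andbT -rest0 le_Pr//.
  by apply: measurableI => //; exact: measurableD.
exact: measurableD.
Qed.

Lemma cyl_domination (I : history -> Prop) (A : set T) (X : history -> R) (m : nat) :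
  measurable A ->
  (forall h, I h -> valid h) ->
  (forall h y, I h -> y \in succs h -> I (y :: h)) ->
  (forall h, I h -> size h = m -> Pr (cyl h `&` A) <= X h * law h) ->
  (forall h, I h -> (size h < m)%N ->
     Pr (cyl h `&` A) <= X h * law h \/ E X h <= X h) ->
  forall h, I h -> (size h <= m)%N -> Pr (cyl h `&` A) <= X h * law h.
Proof.
move=> mA Iv IS Am AX.
apply: (backward_domination R f p f_gt0 p01 I (fun h => Pr (cyl h `&` A)) X m) => //.
  by move=> h y Ih _; exact: IS.
by move=> h Ih _; exact: Pr_cyl_succs (Iv _ Ih).
Qed.

(** Integrates a bound on conditional probabilities given the history at time [n]; the constant [v]
    serves as supermartingale. *)
Lemma Pr_cyl_cond n (Q : history -> Prop) A v : measurable A -> 0 <= v ->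
  (forall h, valid h -> size h = n -> Q h -> Pr (cyl h `&` A) <= v * law h) ->
  Pr ([set w | Q (hist n w)] `&` A) <= v.
Proof.
move=> mA v0 hQ; have mQ := measurable_hist Q n.
rewrite (_ : _ `&` A = cyl [::] `&` ([set w | Q (hist n w)] `&` A)); last first.
  by apply/seteqP; split=> w //= -[].
rewrite -[v]mulr1 -[X in v * X]/(law [::]).
apply: (cyl_domination valid _ (fun=> v) n) => //.
- exact: measurableI.
- by move=> h y vh ys /=; rewrite ys.
- move=> h vh hn; case: (pselect (Q h)) => Qh.
    apply: le_trans (hQ _ vh hn Qh); apply: le_Pr.
    + by apply: measurableI; [exact: measurable_cyl|exact: measurableI].
    + by apply: measurableI => //; exact: measurable_cyl.
    + by move=> w [? []].
  rewrite (_ : cyl h `&` _ = set0) ?Pr0 ?mulr_ge0 ?law_ge0//.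
  by apply/seteqP; split=> w //=; rewrite /cyl/= hn => -[-> []].
- by move=> h vh _; right; rewrite expect_cst.
Qed.

Lemma Pr_invalid n : Pr [set w | ~~ valid (hist n w)] = 0.
Proof.
have m' : measurable [set w | ~~ valid (hist n w)].
  exact: (measurable_hist (fun h => ~~ valid h)).
apply/eqP; rewrite eq_le Pr_ge0 andbT.
suff : Pr (cyl [::] `&` [set w | ~~ valid (hist n w)]) <= 0 * law [::].
  rewrite mul0r => /(le_trans _); apply; rewrite le_eqVlt; apply/orP; left.
  by apply/eqP; congr Pr; apply/seteqP; split=> w //= -[].
apply: (cyl_domination valid _ (fun=> 0) n) => //.
- by move=> h y vh ys /=; rewrite ys.
- move=> h vh hn; rewrite mul0r (_ : cyl h `&` _ = set0) ?Pr0//.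
  by apply/seteqP; split=> w //=; rewrite /cyl/= hn => -[->]; rewrite vh.
- by move=> h vh _; right; rewrite expect_cst.
Qed.

Let mhist (Q : history -> Prop) n : measurable [set w | Q (hist n w)] :=
  measurable_hist Q n.

Variable C : R.
Hypothesis C_ge0 : 0 <= C.
Hypothesis pC : forall n, (0 < n)%N -> p n <= C * (1 - p n).

(** Optional stopping with Markov's inequality. The drift condition is asked only at histories from
    which [Q] is still possible, and not where [X >= 1], as if the process were stopped there. *)
Lemma terminal_domination (I Q : history -> Prop) (X : history -> R) (m : nat) :
  (forall h, I h -> valid h) ->
  (forall h y, I h -> y \in succs h -> I (y :: h)) ->
  (forall h, I h -> 0 <= X h) ->
  (forall h, I h -> size h = m -> Q h -> 1 <= X h) ->
  (forall h, I h -> (size h < m)%N ->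
     (exists b s, past b s (size h) = h /\ Q (past b s m)) ->
     1 <= X h \/ E X h <= X h) ->
  forall h, I h -> (size h <= m)%N ->
    Pr (cyl h `&` [set w | Q (hist m w)]) <= X h * law h.
Proof.
move=> Iv IS X0 X1 XE.
have sub1 h : I h -> 1 <= X h ->
    Pr (cyl h `&` [set w | Q (hist m w)]) <= X h * law h.
  move=> Ih hX; apply: (le_trans (y := law h)); last first.
    by rewrite ler_peMl// law_pos// Iv.
  rewrite -Pr_cyl; apply: le_Pr => //.
  - by apply: measurableI => //; exact: (mhist (fun g => g = h)).
  - exact: (mhist (fun g => g = h)).
have sub0 h : I h -> (forall b s, past b s (size h) = h -> ~ Q (past b s m)) ->
    Pr (cyl h `&` [set w | Q (hist m w)]) <= X h * law h.
  move=> Ih hQ; rewrite (_ : _ `&` _ = set0).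
    by rewrite Pr0 mulr_ge0 ?X0// law_pos// Iv.
  by apply/seteqP; split=> w //= -[/hQ].
apply: (cyl_domination I) => //.
- move=> h Ih hm; case: (pselect (Q h)) => [Qh|nQ].
    by apply: sub1 => //; exact: X1.
  by apply: sub0 => // b s; rewrite hm => ->.
move=> h Ih hm; case: (pselect (exists b s, past b s (size h) = h /\ Q (past b s m))) => [ex|nex].
  by have [?|?] := XE _ Ih hm ex; [left; exact: sub1|right].
by left; apply: sub0 => // b s e Qm; apply: nex; exists b, s.
Qed.

Lemma low_prefix k h m b s : (size h <= m)%N -> past b s (size h) = h ->
  low k (past b s m) -> low k h.
Proof. by move=> hm e /(low_past _ _ _ _ _ hm); rewrite e. Qed.

(** * Some color reaches level [k] early *)

Section Reach.
Variable k : nat.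
Hypothesis k_gt0 : (0 < k)%N.
Hypothesis damp_ge : forall j, 1 / 2 <= damp R f C k j.

Let D := growth f (2 * rt k) k.

Let D_ge1 : 1 <= D.
Proof. by apply: growth_ge1 => //; rewrite mulr_ge0// rt_ge0. Qed.

(** If all colors are low at time [n2], then [pop >= n2 / (2 * k)]; a clock at most [a] then makes
    the supermartingale [pop / clock] large. *)
Lemma low_slow_clock n2 (a : R) h1 : 0 <= a -> valid h1 -> (0 < size h1 <= n2)%N ->
  Pr (cyl h1 `&` [set w | low k (hist n2 w) /\ clock (rt k) (hist n2 w) <= a]) <=
  2 * k%:R * a / n2%:R * (pop R f C k (rt k) h1 / clock (rt k) h1) * law h1.
Proof.
move=> a0 v1 /andP[s1 sn].
have v0 : 0 <= 2 * k%:R * a / n2%:R by rewrite divr_ge0// !mulr_ge0.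
pose X h := 2 * k%:R * a / n2%:R * (pop R f C k (rt k) h / clock (rt k) h).
have n20 : (0 < n2)%N by lia.
have n20' : 0 < n2%:R :> R by rewrite ltr0n.
have k0' : 0 < k%:R :> R by rewrite ltr0n.
have c0 h : valid h -> 0 < clock (rt k) h.
  by move=> vh; apply: clock_gt0 => //; exact: rt_ge0.
apply: (terminal_domination (fun h => valid h /\ (0 < size h)%N)
  (fun h => low k h /\ clock (rt k) h <= a) X) => //.
- by move=> h [].
- by move=> h y [vh _] ys /=; rewrite ys.
- move=> h [vh _]; rewrite mulr_ge0// divr_ge0 ?(ltW (c0 _ _))//.
  by apply: pop_ge0 => //; exact: lexx.
- move=> h [vh _] hm [lh ca].
  have pg := pop_low_ge R f f_gt0 C k (rt k) k_gt0 damp_ge (lexx _) h vh lh.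
  rewrite /X mulrA ler_pdivlMr ?c0// mul1r (le_trans ca)//.
  apply: (le_trans (y := 2 * k%:R * a / n2%:R * ((size h)%:R / (2 * k%:R)))).
    rewrite hm le_eqVlt; apply/orP; left; apply/eqP; field.
    by rewrite !gt_eqF.
  by rewrite ler_wpM2l.
- move=> h [vh h0] hm [b [s [e [lh _]]]]; right.
  apply: pop_clock_super => //.
  exact: (low_prefix _ _ n2 b s (ltnW hm) e).
Qed.

(** With [N] colors at the start, [survivors] is at least [N / D]. When the clock has grown by the
    factor [2 * D] and all levels are still below [k], it is at most [N / (2 * D)]; the exponential
    supermartingale makes this gap unlikely. *)
Lemma low_fast_clock n2 h1 : valid h1 -> (0 < size h1 <= n2)%N ->
  Pr (cyl h1 `&` [set w | low k (hist n2 w) /\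
      2 * D * clock (rt k) h1 <= clock (rt k) (hist n2 w)]) <=
  expR (- ((colors h1)%:R / (2 * D))) * law h1.
Proof.
move=> v1 /andP[s1 sn].
have r0 := rt_ge0 R k; have r2 : 0 <= 2 * rt k :> R by rewrite mulr_ge0.
have D0 : 0 < D by rewrite (lt_le_trans ltr01).
have a0 := clock_gt0 R f p f_gt0 p01 _ _ r0 v1.
pose N := colors h1; pose a := clock (rt k) h1.
pose v := N%:R / (2 * D).
pose X h := expR (v - survivors R f p k (rt k) N a h).
have X1 : X h1 <= expR (- v).
  rewrite ler_expR lerBlDl -lerBlDr opprK.
  apply: (le_trans (y := \sum_(1 <= c < N.+1) D^-1)).
    rewrite sumr_const_nat subn1 -mulr_natl /v /=.
    by rewrite le_eqVlt; apply/orP; left; apply/eqP; field; rewrite gt_eqF.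
  rewrite /survivors; apply: ler_sum => c _; rewrite divff ?gt_eqF// mulr1 -/D.
  by rewrite ler_peMl ?invr_ge0 ?(ltW D0)// growth_ge1.
apply: (le_trans (y := X h1 * law h1)); last by rewrite ler_wpM2r// law_pos.
apply: (terminal_domination (fun h => [/\ valid h, (0 < size h)%N,
   (N <= colors h)%N & a <= clock (rt k) h])
  (fun h => low k h /\ 2 * D * clock (rt k) h1 <= clock (rt k) h) X) => //.
- by move=> h [].
- move=> h y [vh _ Nh ah] ys; split=> //=; first by rewrite ys.
    by rewrite colors_cons (leq_trans Nh)// leq_addl.
  by apply: (le_trans ah); have := clock_cons_le R f p f_gt0 p01 (rt k) y h r0 vh.
- by move=> h _; exact: expR_ge0.
- move=> h [vh _ _ _] hm [lh ca]; rewrite -expR0 ler_expR subr_ge0.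
  have c0 := clock_gt0 R f p f_gt0 p01 _ _ r0 vh.
  rewrite /survivors /v.
  apply: (le_trans (y := \sum_(1 <= c < N.+1) (2 * D)^-1)); last first.
    by rewrite sumr_const_nat subn1 -[leLHS]mulr_natl.
  apply: ler_sum => c _; rewrite -[leRHS]mul1r -/D; apply: ler_pM.
  - by rewrite divr_ge0 ?ltW// growth_gt0.
  - by rewrite divr_ge0 ?ltW.
  - by rewrite ler_pdivrMr// mul1r growth_le// ltnW.
  rewrite ler_pdivrMr// -ler_pdivrMl ?invr_gt0 ?mulr_gt0//.
  by rewrite invrK.
- move=> h [vh h0 Nh ah] hm [b [s [e [lh _]]]]; right.
  apply: (survivors_super _ _ _ f_gt0 _ C) => //.
  exact: (low_prefix _ _ n2 b s (ltnW hm) e).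
Qed.

(** Given a low history at time [n1], the clock may since have grown by a factor at most [2 * D],
    which is unlikely if [n2] is large against [n1], or by more, which is unlikely because at least
    [n1 / k] colors had a chance to reach level [k]. *)
Lemma low_bound n1 n2 : (0 < n1 <= n2)%N ->
  Pr [set w | low k (hist n2 w)] <=
  4 * k%:R * D ^+ 2 * n1%:R / n2%:R + 2 * k%:R * D / n1%:R.
Proof.
move=> /andP[n10 n12].
have D0 : 0 < D by rewrite (lt_le_trans ltr01).
have r0 := rt_ge0 R k; have r2 : rt k <= 2 * rt k :> R by rewrite ler_peMl// ler1n.
have n10' : 0 < n1%:R :> R by rewrite ltr0n.
have n20' : 0 < n2%:R :> R by rewrite ltr0n; lia.
have k0' : 0 < k%:R :> R by rewrite ltr0n.
rewrite (_ : [set w | _] = [set w | low k (hist n1 w)] `&` [set w | low k (hist n2 w)]); last first.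
  apply/seteqP; split=> w /=; last by case.
  by move=> lw; split=> //; exact: low_past lw.
apply: (Pr_cyl_cond n1) => //.
  by rewrite addr_ge0 ?divr_ge0 ?mulr_ge0 ?exprn_ge0// ltW.
move=> h vh hn lh.
have c0 := clock_gt0 R f p f_gt0 p01 _ _ r0 vh.
pose a := 2 * D * clock (rt k) h.
have a0 : 0 <= a by rewrite !mulr_ge0// ltW.
have hs : (0 < size h <= n2)%N by rewrite hn n10.
have := low_slow_clock n2 a h a0 vh hs.
have := low_fast_clock n2 h vh hs; rewrite -/a.
set A1 := [set w | _]; set A2 := [set w | _] => hA1 hA2.
have mA1 : measurable A1 by exact: (mhist (fun g => low k g /\ a <= clock (rt k) g)).
have mA2 : measurable A2 by exact: (mhist (fun g => low k g /\ clock (rt k) g <= a)).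
have mC : measurable (cyl h) by exact: (mhist (fun g => g = h)).
apply: (le_trans (y := Pr (cyl h `&` A2 `|` cyl h `&` A1))).
  apply: le_Pr.
  - by apply: measurableI => //; exact: mhist.
  - by apply: measurableU; exact: measurableI.
  move=> w [hw lw]; have [ca|/ltW ca] := leP (clock (rt k) (hist n2 w)) a; [left|right]; split => //.
apply: (le_trans (PrU_le _ _ _ _)); [exact: measurableI|exact: measurableI|].
rewrite mulrDl lerD//.
  apply: (le_trans hA2); rewrite ler_wpM2r ?law_pos//.
  have -> : 2 * k%:R * a / n2%:R * (pop R f C k (rt k) h / clock (rt k) h) =
    4 * k%:R * D / n2%:R * pop R f C k (rt k) h.
    by rewrite /a; field; rewrite !gt_eqF.
  apply: (le_trans (y := 4 * k%:R * D / n2%:R * (n1%:R * D))); last first.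
    by rewrite le_eqVlt; apply/orP; left; apply/eqP; field; rewrite gt_eqF.
  apply: ler_wpM2l; first by rewrite divr_ge0 ?mulr_ge0 ?ltW.
  apply: (le_trans (pop_le R f f_gt0 C C_ge0 k (rt k) (lexx _) h)).
  by rewrite hn ler_wpM2l// growth_le_param.
apply: (le_trans hA1); rewrite ler_wpM2r ?law_pos//.
have N0 : 0 < (colors h)%:R :> R by rewrite ltr0n colors_gt0// hn.
have x0 : 0 < (colors h)%:R / (2 * D) by rewrite divr_gt0 ?mulr_gt0.
apply: (le_trans (y := ((colors h)%:R / (2 * D))^-1)).
  rewrite expRN lef_pV2 ?posrE ?expR_gt0//.
  by apply: le_trans (expR_ge1Dx _); rewrite lerDr.
rewrite invf_div ler_pdivrMr//.
have -> : 2 * k%:R * D / n1%:R * (colors h)%:R =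
  2 * D * ((colors h)%:R * k%:R / n1%:R) by field; rewrite gt_eqF.
rewrite ler_peMr ?mulr_ge0 ?(ltW D0)// ler_pdivlMr// mul1r.
by have := low_size _ _ vh lh; rewrite hn -natrM ler_nat.
Qed.

End Reach.

Lemma mult_hist_le c n m w : (n <= m)%N -> (mult c (hist n w) <= mult c (hist m w))%N.
Proof.
elim: m => [|m IH]; first by rewrite leqn0 => /eqP->.
rewrite leq_eqVlt => /orP[/eqP->//|]; rewrite ltnS => /IH /leq_trans; apply.
exact: mult_le.
Qed.

(** With [n1] of order [k ^ 2 * D] and [n2] of order [k ^ 2 * D ^ 2 * n1], the two terms of
    [low_bound] are at most [4 / k] and [2 / k]. *)
Lemma low_rare k : (0 < k)%N -> (forall j, 1 / 2 <= damp R f C k j) ->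
  exists n, [/\ (k <= n)%N, n%:R <= 4 * k%:R ^+ 4 * growth f (2 * rt k) k ^+ 3 &
    Pr [set w | low k (hist n w)] <= 6 / k%:R].
Proof.
move=> k0 hd; set D := growth _ _ _.
have D1 : 1 <= D by apply: growth_ge1 => //; rewrite mulr_ge0// rt_ge0.
have k1 : 1 <= k%:R :> R by rewrite ler1n.
have D0 : 0 < D by lra.
have k0' : 0 < k%:R :> R by lra.
pose x := k%:R ^+ 2 * D.
have x1 : 1 <= x by rewrite mulr_ege1// exprn_ege1.
pose n1 := (Num.truncn x).+1.
have /andP[lx xn] : (Num.truncn x)%:R <= x < n1%:R by apply: truncn_itv; lra.
have n1_le : n1%:R <= 2 * x by rewrite /n1 -natr1; lra.
have n11 : 1 <= n1%:R :> R by rewrite ler1n.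
pose y := k%:R ^+ 2 * D ^+ 2 * n1%:R.
have kD1 : 1 <= k%:R ^+ 2 * D ^+ 2 by rewrite mulr_ege1// exprn_ege1.
have y1 : n1%:R <= y by rewrite ler_peMl// ler0n.
pose n2 := (Num.truncn y).+1.
have /andP[ly yn] : (Num.truncn y)%:R <= y < n2%:R by apply: truncn_itv; lra.
have n2_le : n2%:R <= 2 * y by rewrite /n2 -natr1; lra.
have n12 : (n1 <= n2)%N by rewrite -(ler_nat R); lra.
have y0 : 0 < y by lra.
have x0 : 0 < x by lra.
exists n2; split=> //.
    rewrite -(ler_nat R); apply: (le_trans _ (ltW yn)); apply: le_trans y1.
    apply: (le_trans _ (ltW xn)); rewrite /x expr2 -mulrA ler_peMr//.
    by rewrite mulr_ege1.
  apply: (le_trans n2_le); apply: (le_trans (y := 2 * (k%:R ^+ 2 * D ^+ 2 * (2 * x)))).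
    by rewrite ler_pM2l// ler_wpM2l// mulr_ge0 ?exprn_ge0// ltW.
  by rewrite le_eqVlt; apply/orP; left; apply/eqP; rewrite /x; ring.
apply: (le_trans (low_bound k k0 hd n1 n2 _)).
  by rewrite n12.
rewrite -/D [leRHS](_ : _ = 4 / k%:R + 2 / k%:R); last by field; rewrite gt_eqF.
have n10 : 0 < n1%:R :> R by lra.
apply: lerD.
  apply: (le_trans (y := 4 * k%:R * D ^+ 2 * n1%:R / y)).
    apply: ler_wpM2l; first by rewrite !mulr_ge0 ?exprn_ge0 ?(ltW D0) ?(ltW k0').
    by rewrite lef_pV2 ?posrE; lra.
  by rewrite le_eqVlt; apply/orP; left; apply/eqP; rewrite /y; field; rewrite !gt_eqF.
apply: (le_trans (y := 2 * k%:R * D / x)).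
  apply: ler_wpM2l; first by rewrite !mulr_ge0 ?(ltW D0) ?(ltW k0').
  by rewrite lef_pV2 ?posrE; lra.
by rewrite le_eqVlt; apply/orP; left; apply/eqP; rewrite /x; field; rewrite !gt_eqF.
Qed.

Lemma Pr_eq0 A : (forall e : R, 0 < e -> Pr A <= e) -> Pr A = 0.
Proof.
move=> h; apply/eqP; rewrite eq_le Pr_ge0 andbT; apply/ler_addgt0Pl => e e0.
by rewrite addr0 h.
Qed.

Definition stuck (k : nat) : set T := [set w | forall n, low k (hist n w)].

(** To be stuck below [k] is to be low at every larger level [l] and all times, which has
    probability at most [6 / l] for large [l]. *)
Lemma Pr_stuck : Pr (\bigcup_k stuck k) = 0.
Proof.
have mS k : measurable (stuck k).
  by apply: measurable_forall => n; exact: (mhist (low k)).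
apply/eqP; rewrite eq_le Pr_ge0 andbT; apply: Pr_bigcup_le => //.
  move=> n m nm w h i c; exact: leq_trans (h i c) nm.
move=> k; suff -> : Pr (stuck k) = 0 by [].
apply: Pr_eq0 => e e0.
have [k1 h1] := eps_nat R 6 e e0.
have [k2 [_ h2]] := damp_large R f f_gt0 f_le C C_ge0.
pose l := maxn k.+1 (maxn k1 k2).
have [n [_ _ hn]] := low_rare l (ltac:(lia)) (h2 l ltac:(lia)).
apply: le_trans (le_trans hn (h1 l ltac:(lia))).
apply: le_Pr; [exact: mS|exact: (mhist (low l))|].
by move=> w h c; apply: leq_trans (h n c) _; lia.
Qed.

Definition all_finite : set T :=
  [set w | forall c, exists L, forall n, (mult c (hist n w) <= L)%N].

Lemma measurable_all_finite : measurable all_finite.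
Proof.
apply: measurable_forall => c; apply: measurable_exists => L.
apply: measurable_forall => n; exact: (mhist (fun h => mult c h <= L)%N).
Qed.

Lemma was_overtaken_mono N k n m w : (n <= m)%N ->
  was_overtaken k N (hist n w) -> was_overtaken k N (hist m w).
Proof.
elim: m => [|m IH]; first by rewrite leqn0 => /eqP->.
rewrite leq_eqVlt => /orP[/eqP->//|]; rewrite ltnS => nm h.
by right; exact: IH.
Qed.

Lemma leader_hist_mono N n m w : (n <= m)%N ->
  (leader N (hist n w) <= leader N (hist m w))%N.
Proof.
elim: m => [|m IH]; first by rewrite leqn0 => /eqP->.
rewrite leq_eqVlt => /orP[/eqP->//|]; rewrite ltnS => /IH /leq_trans; apply.
exact: leader_mono.
Qed.

(** The first [N] colors have a common bound [L]. Not being stuck, some color exceeds [L], and its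
    label is then larger than [N]. *)
Lemma all_finite_overtaken N k n w : all_finite w -> ~ (\bigcup_k stuck k) w ->
  (forall m, valid (hist m w)) -> (0 < k)%N -> (k <= leader N (hist n w))%N ->
  exists m, was_overtaken k N (hist m w).
Proof.
move=> fin nst vw k0 kl.
have [L hL] : exists L, forall c, (0 < c <= N)%N -> forall m, (mult c (hist m w) <= L)%N.
  elim: {k k0 n kl} N => [|N [L IH]]; first by exists 0%N => c; lia.
  have [L' hL'] := fin N.+1; exists (maxn L L') => c /andP[c0].
  rewrite leq_eqVlt => /orP[/eqP-> m|cN m]; rewrite leq_max.
    by rewrite hL' orbT.
  by rewrite IH// c0.
have [m hm] : exists m, ~ low L.+1 (hist m w).
  apply: contrapT => h; apply: nst; exists L.+1 => // m.
  by apply: contrapT => h'; apply: h; exists m.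
have [c hc] : exists c, (L < mult c (hist m w))%N.
  apply: contrapT => h; apply: hm => c; rewrite ltnS leqNgt; apply/negP => hc.
  by apply: h; exists c.
pose l := maxn n m.
have hcl : (L < mult c (hist l w))%N.
  by apply: leq_trans hc _; apply: mult_hist_le; exact: leq_maxr.
have cN : (N < c)%N.
  rewrite ltnNge; apply/negP => cN.
  have c0 : (0 < c)%N.
    have : (0 < mult c (hist l w))%N by lia.
    by rewrite valid_mult_gt0// => /andP[].
  by have := hL c; rewrite c0 cN => /(_ isT l); lia.
exists l; suff ov : overtaken k N (hist l w) by case: (hist l w) ov => [|y h] ov; left.
split; first by apply: leq_trans kl _; apply: leader_hist_mono; exact: leq_maxl.
exists c => //; apply: leader_le => c' hc'; have := hL c' hc' l; lia.
Qed.

(** * Late colors rarely overtake the leader *)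

Section OvertakeBound.
Variables (k : nat) (th zeta : nat -> R).
Hypothesis k_gt0 : (0 < k)%N.
Hypothesis damp_ge : forall j, 1 / 2 <= damp R f C k j.
Hypothesis th_ge : forall m, (k <= m)%N -> rt m <= th m.
Hypothesis th_le : forall m, (k <= m)%N -> th m <= th m.+1.
Hypothesis th_sum : forall m, \sum_(k <= i < m) (th i / f i) ^+ 2 <= 1 / 2.
Hypothesis zeta_ge0 : forall m, 0 <= zeta m.
Hypothesis zeta_le : forall m, (k <= m)%N -> zeta m <= zeta k.
Hypothesis zeta_step : forall m, (k <= m)%N ->
  catch R f C k th 1 m <= zeta m - zeta m.+1.

(** At [h1] no color beyond [N] exists, so [challenge] reduces to its term in [zeta]. The factor 4
    comes from [catch_top]: an overtaking makes [challenge] at least 1 / 4. *)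
Lemma overtaken_bound h1 m : valid h1 -> (0 < size h1 <= m)%N -> ~ low k h1 ->
  Pr (cyl h1 `&` [set w | was_overtaken k (colors h1) (hist m w)]) <=
  4 * ((size h1)%:R * C * zeta k) * law h1.
Proof.
move=> v1 /andP[s1 sm] nl; set N := colors h1.
have kM1 : (k <= leader N h1)%N.
  have [c hc] : exists c, (k <= mult c h1)%N.
    apply: contrapT => h; apply: nl => c; rewrite ltnNge; apply/negP => hc.
    by apply: h; exists c.
  apply: (leq_trans hc (mult_le_leader _ _ _ _)).
  by rewrite -valid_mult_gt0//; lia.
pose Phi := challenge R f C k th zeta N.
(* [X] is frozen at 1 from the first overtaking on, because [challenge_super] holds only before
   it. *)
pose X h := if pselect (was_overtaken k N h) then 1 else 4 * Phi h.
have nov1 : ~ was_overtaken k N h1.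
  move=> /(was_overtaken_present k N k_gt0)[c Nc].
  rewrite valid_mult_gt0// => /andP[_]; rewrite leqNgt; move=> /negP; apply; exact: Nc.
have X1 : X h1 <= 4 * ((size h1)%:R * C * zeta k).
  rewrite /X; case: pselect => //= nwo; rewrite ler_pM2l//.
  rewrite /Phi /challenge big_geq// add0r.
  apply: ler_pM; rewrite ?mulr_ge0 ?zeta_le//.
  by rewrite ler_wpM2r// ler_nat colors_le_size.
apply: (le_trans (y := X h1 * law h1)); last by rewrite ler_wpM2r// law_pos.
(* At the first overtaking [4 * Phi] is at least 1, so the switch to the value 1 does not raise
   [X]. *)
have Xle h : valid h -> overtaken k N h \/ ~ was_overtaken k N h -> X h <= 4 * Phi h.
  rewrite /X; case: pselect => //= wo vh [ov|//].
  have := challenge_overtaken R f f_gt0 C C_ge0 k th zeta k_gt0 damp_ge th_ge th_sum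
    zeta_ge0 N h vh ov.
  by rewrite -/Phi; lra.
apply: (terminal_domination
  (fun h => [/\ valid h, (0 < size h)%N, (N <= colors h)%N & (k <= leader N h)%N])
  (was_overtaken k N) X) => //.
- by move=> h [].
- move=> h y [vh _ Nh kh] ys; split=> //=; first by rewrite ys.
    by rewrite colors_cons (leq_trans Nh)// leq_addl.
  exact: leq_trans kh (leader_mono _ _ _).
- move=> h [vh _ _ kh]; rewrite /X; case: pselect => //= nwo; rewrite mulr_ge0//.
  exact: (challenge_ge0 R f f_gt0 C C_ge0 k th zeta damp_ge th_ge th_sum zeta_ge0).
- by move=> h _ _ wo; rewrite /X; case: pselect.
move=> h [vh h0 Nh kh] _ _.
case: (pselect (was_overtaken k N h)) => [wo|nwo].
  by left; rewrite /X; case: pselect.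
right; rewrite [leRHS](_ : _ = 4 * Phi h); last by rewrite /X; case: pselect.
have nov : ~ overtaken k N h by move=> ov; apply: nwo; case: (h) ov => [|y g] ov; left.
apply: (le_trans (y := E (fun h => 4 * Phi h) h)).
  apply: le_expect => // y ys; apply: Xle; first by rewrite /= ys.
  case: (pselect (overtaken k N (y :: h))) => ov; [by left|right].
  by move=> /= [].
rewrite expectZ ler_pM2l//.
exact: (challenge_super R f p f_gt0 f_le p01 C C_ge0 pC k th zeta).
Qed.

Lemma all_finite_bound n : (0 < n)%N ->
  Pr ([set w | ~ low k (hist n w)] `&`
      (all_finite `&` (~` (\bigcup_k stuck k) `&`
       [set w | forall m, valid (hist m w)]))) <= 4 * (n%:R * C * zeta k).
Proof.
move=> n0.
have mst : measurable (\bigcup_k stuck k).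
  apply: bigcupT_measurable => i.
  by apply: measurable_forall => m; exact: (mhist (low i)).
have mA : measurable (all_finite `&` (~` (\bigcup_k stuck k) `&`
       [set w | forall m, valid (hist m w)])).
  apply: measurableI; first exact: measurable_all_finite.
  apply: measurableI; first exact: measurableC.
  by apply: measurable_forall => m; exact: (mhist (fun h => valid h)).
apply: (Pr_cyl_cond n (fun h => ~ low k h)) => //.
  by rewrite !mulr_ge0.
move=> h vh hn nl.
set N := colors h.
pose O m := cyl h `&` [set w | was_overtaken k N (hist m w)].
have mO m : measurable (O m).
  apply: measurableI; first exact: (mhist (fun g => g = h)).
  exact: (mhist (was_overtaken k N)).
apply: (le_trans (y := Pr (\bigcup_m O m))).
  apply: le_Pr.
  - by apply: measurableI => //; exact: (mhist (fun g => g = h)).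
  - exact: bigcupT_measurable.
  move=> w [hw [fw [sw vw]]].
  have [|m hm] := all_finite_overtaken N k n w fw sw vw k_gt0; last by exists m.
  have [c hc] : exists c, (k <= mult c h)%N.
    apply: contrapT => g; apply: nl => c; rewrite ltnNge; apply/negP => hc.
    by apply: g; exists c.
  have -> : hist n w = h by rewrite -hn; exact: hw.
  apply: (leq_trans hc (mult_le_leader _ _ _ _)).
  by rewrite -valid_mult_gt0//; lia.
apply: Pr_bigcup_le => //.
  by move=> i j ij w [hw wo]; split=> //; exact: was_overtaken_mono wo.
move=> m; apply: (le_trans (y := Pr (O (maxn m n)))).
  apply: le_Pr => // w [hw wo]; split=> //.
  by apply: was_overtaken_mono wo; exact: leq_maxl.
rewrite -hn; apply: overtaken_bound => //.
by rewrite hn n0 leq_maxr.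
Qed.

End OvertakeBound.

(** At the time [n] of [low_rare], either all colors are low, with probability at most [6 / k], or
    [all_finite_bound] applies. In the latter bound, [n <= 4 * k ^ 4 * D ^ 3] meets [births_left k],
    of order [1 / (D ^ 3 * k ^ 7)], and the product vanishes as [k] grows. *)
Lemma all_finite_null_fast :
  (exists k0, forall j, (k0 <= j)%N -> rt j ^+ 24 <= f j) -> Pr all_finite = 0.
Proof.
move=> [k0 hk0]; apply: Pr_eq0 => e e0.
have [k1 [_ h1]] := damp_large R f f_gt0 f_le C C_ge0.
have e3 : 0 < e / 2 by lra.
have [k2 h2] := eps_nat R 6 _ e3.
pose A := 128 * C * f 256 ^+ 256.
have [k3 h3] := eps_nat R A _ e3.
have [k4 h4] := rt_large R (fast_const R f ^+ 2 * 128 * 2).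
pose k := maxn (maxn k0 k1) (maxn (maxn k2 k3) (maxn k4 257)).
have kl : (256 < k)%N by lia.
have kp : (0 < k)%N by lia.
have hd := h1 k ltac:(lia).
have h2k := h2 k ltac:(lia).
have h3k := h3 k ltac:(lia).
have h4k := h4 k ltac:(lia).
have k0k : (k0 <= k)%N by lia.
have r1 := rt_ge1 R k kp.
have ts m : \sum_(k <= i < m) (fast R f i / f i) ^+ 2 <= 1 / 2.
  apply: (le_trans (fast_sum R f f_gt0 k kp _ m)).
    by move=> j kj; apply: hk0; exact: leq_trans kj.
  rewrite ler_pdivrMr ?exprn_gt0 ?(lt_le_trans ltr01)//.
  apply: (le_trans (y := 1 / 2 * rt k)).
    by lra.
  by rewrite ler_pM2l// ler_eXnr.
have [n [kn nle hn]] := low_rare k kp hd.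
have n0 : (0 < n)%N := leq_trans kp kn.
have bound := all_finite_bound k (fast R f) (births_left R f k) kp hd
  (fun m km => fast_ge R f f_gt0 m (leq_trans kp km)) (fun m _ => fast_le R f f_gt0 m)
  ts (births_left_ge0 R f f_gt0 k)
  (births_left_le R f f_gt0 k kl)
  (births_left_step R f f_gt0 f_le k kl C C_ge0) n n0.
have mst : measurable (\bigcup_k stuck k).
  apply: bigcupT_measurable => i.
  by apply: measurable_forall => m; exact: (mhist (low i)).
have mA := measurable_all_finite.
have mV : measurable [set w | forall m, valid (hist m w)].
  by apply: measurable_forall => m; exact: (mhist (fun h => valid h)).
have mI : measurable (\bigcup_m [set w | ~~ valid (hist m w)]).
  by apply: bigcupT_measurable => m; exact: (mhist (fun h => ~~ valid h)).
have Inv : Pr (\bigcup_m [set w | ~~ valid (hist m w)]) = 0.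
  apply/eqP; rewrite eq_le Pr_ge0 andbT; apply: Pr_bigcup_le.
  - by move=> m; exact: (mhist (fun h => ~~ valid h)).
  - move=> i j; elim: j => [|j IH]; first by rewrite leqn0 => /eqP->.
    rewrite leq_eqVlt => /orP[/eqP->//|]; rewrite ltnS => /IH h w /h /=.
    by apply: contra => /andP[].
  - by move=> m; rewrite (Pr_invalid).
set Z := _ `&` _ in bound.
have mZ : measurable Z.
  apply: measurableI; first exact: (mhist (fun h => ~ low k h)).
  apply: measurableI => //; apply: measurableI => //; exact: measurableC.
have mL := mhist (low k) n.
apply: (le_trans (y := Pr (([set w | low k (hist n w)] `|` Z) `|`
   ((\bigcup_k stuck k) `|` (\bigcup_m [set w | ~~ valid (hist m w)]))))).
  apply: le_Pr => //; first by do !apply: measurableU.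
  move=> w fw; case: (pselect (low k (hist n w))) => [lw|nlw]; first by left; left.
  case: (pselect ((\bigcup_k stuck k) w)) => [sw|nsw]; first by right; left.
  case: (pselect ((\bigcup_m [set w | ~~ valid (hist m w)]) w)) => [iw|niw].
    by right; right.
  left; right; split=> //; split=> //; split=> // m.
  by apply: contrapT => /negP h; apply: niw; exists m.
apply: (le_trans (PrU_le _ _ _ _)); [exact: measurableU|exact: measurableU|].
have PrSI := PrU_le _ _ mst mI.
have PrLZ := PrU_le _ _ mL mZ.
rewrite Pr_stuck Inv addr0 in PrSI.
suff : 4 * (n%:R * C * births_left R f k k) <= e / 2.
  by lra.
apply: (le_trans _ h3k).
have k0' : 0 < k%:R :> R by rewrite ltr0n.
have k1' : 1 <= k%:R :> R by rewrite ler1n.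
set D := growth f (2 * rt k) k in nle.
have D0 : 0 < D by apply: growth_gt0 => //; rewrite mulr_ge0// rt_ge0.
have f256 : 0 < f 256 by exact: f_gt0.
apply: (le_trans (y := 4 * (4 * k%:R ^+ 4 * D ^+ 3 * C * births_left R f k k))).
  rewrite ler_pM2l//; apply: ler_wpM2r; first exact: births_left_ge0.
  exact: ler_wpM2r.
rewrite /births_left /births_scale -/D.
have -> : 4 * (4 * k%:R ^+ 4 * D ^+ 3 * C *
   (2 * f 256 ^+ 256 / (D ^+ 3 * k%:R ^+ 6) / k%:R)) =
   (32 * C * f 256 ^+ 256 / k%:R) * (k%:R ^+ 2)^-1.
  move: (f 256 ^+ 256) => z; by field; rewrite !gt_eqF.
have ff : 0 <= f 256 ^+ 256 by rewrite exprn_ge0// ltW.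
apply: (le_trans (y := 32 * C * f 256 ^+ 256 / k%:R)).
  apply: ler_piMr; first by rewrite divr_ge0// mulr_ge0// mulr_ge0.
  by rewrite invf_le1 ?exprn_gt0// exprn_ege1.
rewrite /A; apply: ler_wpM2r; first by rewrite invr_ge0 ltW.
by apply: ler_wpM2r => //; apply: ler_wpM2r => //; rewrite ler_nat.
Qed.

(** * The case [f k < k ^ (3 / 4)] for infinitely many [k] *)

Lemma clock_past_le t b s n m : 0 <= t -> (n <= m)%N -> valid (past b s m) ->
  clock t (past b s n) <= clock t (past b s m).
Proof.
move=> t0; elim: m => [|m IH]; first by rewrite leqn0 => /eqP->.
rewrite leq_eqVlt => /orP[/eqP->//|]; rewrite ltnS => nm /= /andP[_ vm].
apply: (le_trans (IH nm vm)); exact: clock_cons_le R f p f_gt0 p01 t (b m, s m.+1) _ t0 vm.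
Qed.

(** The supermartingale [pop / clock] is 1 at time 1, while a color at level [k] under a clock at
    most [a] makes it at least [growth f t k / (2 * a)]. *)
Lemma early_reach k t a n : (0 < k)%N -> (forall j, 1 / 2 <= damp R f C k j) ->
  rt k <= t -> 0 <= a -> (0 < n)%N ->
  Pr [set w | [/\ valid (hist n w), ~ low k (hist n w) & clock t (hist n w) <= a]]
    <= 2 * a / growth f t k.
Proof.
move=> k0 hd tk a0 n0.
have t0 : 0 <= t := le_trans (rt_ge0 _ _) tk.
have g0 := growth_gt0 R f f_gt0 t k t0.
pose Q h := [/\ valid h, ~ low k h & clock t h <= a].
have v0 : 0 <= 2 * a / growth f t k by rewrite divr_ge0 ?mulr_ge0// ltW.
pose X h := 2 * a / growth f t k * (pop R f C k t h / clock t h).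
have X0 h : valid h -> 0 <= X h.
  move=> vh; rewrite mulr_ge0// divr_ge0//; last by rewrite ltW// clock_gt0.
  exact: pop_ge0.
have X1 h : Q h -> 1 <= X h.
  move=> [vh nl ca]; have c0 := clock_gt0 R f p f_gt0 p01 t h t0 vh.
  have [c hc] : exists c, (k <= mult c h)%N.
    apply: contrapT => g; apply: nl => c; rewrite ltnNge; apply/negP => hc.
    by apply: g; exists c.
  have hcc : (0 < c <= colors h)%N by rewrite -valid_mult_gt0// (leq_trans k0).
  rewrite /X mulrA ler_pdivlMr// mul1r (le_trans ca)//.
  rewrite mulrAC ler_pdivlMr// (mulrC 2) -mulrA ler_wpM2l//.
  rewrite mulrC -ler_pdivrMr//.
  rewrite /pop (bigD1_seq c) ?iota_uniq ?mem_index_iota//=.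
  apply: (le_trans (y := wgt R f C k t (mult c h))).
    by have := wgt_ge R f f_gt0 C k t hd tk (mult c h); rewrite (minn_idPr hc).
  rewrite lerDl sumr_ge0// => i _.
  by apply: le_trans (wgt_ge_half R f f_gt0 C k t hd tk _); lra.
rewrite -[X in Pr X]setTI (_ : setT = [set w | True]); last by [].
apply: (Pr_cyl_cond 1 (fun=> True)) => //.
  exact: (mhist Q).
move=> h vh h1 _.
have eh : h = [:: (true, 1%N)].
  case: h vh h1 => [//|[b x] [|//]] /=; rewrite andbT mem_succs (_ : colors [::] = 0%N)//=.
  by case: b => /= [/eqP->//|]; lia.
have Xh : X h = 2 * a / growth f t k.
  have ec : clock t h = 1 by rewrite eh /= speed0 mulr0 addr0 mulr1.
  rewrite /X ec divr1 eh /pop colors_cons (_ : colors [::] = 0%N)// big_nat1.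
  by rewrite (_ : mult 1 _ = 1%N)// wgt1// mulr1.
rewrite -Xh.
apply: (terminal_domination
  (fun h => valid h /\ (0 < size h)%N) Q X) => //.
- by move=> g [].
- by move=> g y [vg _] ys; rewrite /= ys.
- by move=> g [vg _]; exact: X0.
- by move=> g _ _; exact: X1.
- move=> g [vg g0'] gn [b [s [e [vb nl ca]]]].
  (* If [g] is not low, its clock is at most the final one, hence at most [a], and [X >= 1]
     there. *)
  case: (pselect (low k g)) => [lg|nlg]; [right|left].
    exact: pop_clock_super.
  apply: X1; split=> //; apply: le_trans ca; rewrite -{1}e.
  by apply: clock_past_le => //; exact: ltnW.
- by rewrite h1.
by rewrite h1.
Qed.

(** At each step [clock (f 1)] gains the factor [1 + f 1 * speed], while [c] is drawn with
    probability at least [f 1 * speed]; so the clock killed at the first draw of [c] is a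
    supermartingale. Its initial value is controlled by [clock_f1]. *)
Lemma undrawn_bound c n m (h : history) (g : R) : valid h -> size h = n -> (0 < n <= m)%N ->
  (0 < mult c h)%N -> 0 < g ->
  Pr (cyl h `&` [set w | (mult c (hist m w) <= mult c h)%N /\
     g <= clock (f 1) (hist m w)]) <= 2 ^+ n / g * law h.
Proof.
move=> vh hn /andP[n0 nm] mc g0.
set K := mult c h in mc *.
pose Q h := (mult c h <= K)%N /\ g <= clock (f 1) h.
pose X h := if (mult c h <= K)%N then clock (f 1) h / g else 0.
apply: (le_trans (y := X h * law h)).
  apply: (terminal_domination
    (fun h => [/\ valid h, (0 < size h)%N & (K <= mult c h)%N]) Q X) => //.
  - by move=> i [].
  - move=> i y [vi i0 Ki] ys; split=> //=; first by rewrite ys.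
    exact: leq_trans Ki (mult_le _ _ _).
  - move=> i [vi _ _]; rewrite /X; case: ifP => // _.
    by rewrite divr_ge0 ?ltW// clock_gt0// ltW.
  - move=> i _ _ [Ki gi]; rewrite /X Ki ler_pdivlMr// mul1r//.
  - move=> i [vi i0 Ki] _ _; right.
    have c0 := clock_gt0 R f p f_gt0 p01 _ _ (ltW f1_gt0) vi.
    have e0 := speed_ge0 R f p f_gt0 p01 i vi.
    set e := speed R f p i in e0.
    pose v := clock (f 1) i * (1 + f 1 * e) / g.
    have v0 : 0 <= v.
      by rewrite /v divr_ge0 ?(ltW g0)// mulr_ge0 ?(ltW c0)// addr_ge0// mulr_ge0// ltW.
    have Xv y : X (y :: i) <= v.
      by rewrite /X; case: ifP => // _.
    have hc : (0 < c <= colors i)%N by rewrite -valid_mult_gt0//; lia.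
    case: (leqP (mult c i) K) => [iK|Ki']; last first.
      rewrite [leRHS]/X leqNgt Ki' /=.
      rewrite -[leRHS](expect_cst R f p f_gt0 0 i vi); apply: le_expect => // y _.
      by rewrite /X leqNgt (leq_trans Ki' (mult_le _ _ _)).
    pose dd (x : nat) := if x == c then - v else 0.
    apply: (le_trans (expect_le R f p f_gt0 p01 X i C v 0 dd pC vi i0 (lexx _) _ _)).
    + by rewrite addr0.
    + move=> x hx; rewrite /dd; case: eqP => [->|_]; last by rewrite addr0.
      rewrite subrr /X mult_cons /= eqxx ifF//.
      by apply/negbTE; rewrite -ltnNge add1n ltnS.
    rewrite -/e (bigD1_seq c) ?iota_uniq ?mem_index_iota//= big1 ?addr0; last first.
      by move=> x /negbTE xc; rewrite /dd xc mulr0 addr0 mulr0.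
    rewrite /dd eqxx mulr0 addr0 /X iK.
    have f1K : f 1 <= f (mult c i) by apply: f_le => //; rewrite valid_mult_gt0.
    apply: (le_trans (y := v * (1 - f 1 * e))).
      rewrite (_ : v * (1 - f 1 * e) = v - e * (f 1 * v)); last by ring.
      by rewrite lerD2l !mulrN lerN2; apply: ler_wpM2l => //; exact: ler_wpM2r.
    have -> : v * (1 - f 1 * e) = clock (f 1) i / g * (1 - (f 1 * e) ^+ 2).
      by rewrite /v; ring.
    by rewrite ler_piMr ?divr_ge0 ?(ltW c0) ?(ltW g0)// gerBl sqr_ge0.
  - by rewrite hn.
  - by rewrite hn.
rewrite /X leqnn; apply: ler_wpM2r; first exact: law_pos.
apply: ler_wpM2r; first by rewrite invr_ge0 ltW.
by rewrite -hn; exact: clock_f1.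
Qed.

(** An observed color has a bounded count exactly when some [n] puts it here; these events are
    countably many. *)
Definition last_draw (c n : nat) : set T :=
  [set w | (0 < mult c (hist n w))%N /\
     forall m, (mult c (hist m w) <= mult c (hist n w))%N].

Lemma measurable_last_draw c n : measurable (last_draw c n).
Proof.
have mm m : measurable [set w | (mult c (hist m w) <= mult c (hist n w))%N].
  rewrite (_ : [set w | _] = \bigcup_K ([set w | (mult c (hist m w) <= K)%N] `&`
     [set w | mult c (hist n w) = K])).
    apply: bigcupT_measurable => K; apply: measurableI.
      exact: (mhist (fun h => mult c h <= K)%N).
    exact: (mhist (fun h => mult c h = K)).
  apply/seteqP; split=> w /=; first by move=> h; exists (mult c (hist n w)).
  by move=> [K _ [h1 ->]].
apply: measurableI; first exact: (mhist (fun h => 0 < mult c h)%N).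
exact: measurable_forall mm.
Qed.

Lemma Pr_valid_bound A B' n v : measurable A -> measurable B' ->
  (forall w, A w -> valid (hist n w) -> B' w) -> Pr B' <= v -> Pr A <= v.
Proof.
move=> mA mB AB Bv.
have mI : measurable [set w | ~~ valid (hist n w)] by exact: (mhist (fun h => ~~ valid h)).
apply: (le_trans (y := Pr (B' `|` [set w | ~~ valid (hist n w)]))).
  apply: le_Pr => //; first exact: measurableU.
  move=> w Aw; case: (boolP (valid (hist n w))) => vw; last by right.
  by left; exact: AB.
apply: (le_trans (PrU_le _ _ mB mI)).
by rewrite (Pr_invalid) addr0.
Qed.

(** Take [f k < rt k ^ 24] and [t = k * f 1]. Then [growth f t k] is at least [(2 * g) ^ (k - 1)],
    and by [early_reach] level [k] is unlikely to be reached before [clock t] exceeds [g ^ k]. By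
    [clock_pow], [clock (f 1)] then exceeds [g], which is too long for [c] to remain undrawn. *)
Lemma last_draw_null_slow c n0 :
  (forall k0, exists2 k, (k0 <= k)%N & f k < rt k ^+ 24) ->
  Pr (last_draw c n0) = 0.
Proof.
move=> slow; apply: Pr_eq0 => e e0.
have e3 : 0 < e / 3 by lra.
have [g0' hg0] := eps_nat R (2 ^+ n0) (e / 3) e3.
pose g : R := (maxn g0' 1)%:R.
have g1 : 1 <= g by rewrite ler1n leq_max orbT.
have g0 : 0 < g by lra.
have hg : 2 ^+ n0 / g <= e / 3 by apply: hg0; exact: leq_maxl.
have [k1 [_ h1]] := damp_large R f f_gt0 f_le C C_ge0.
have [k2 h2] := eps_nat R 6 _ e3.
(* The two summands give [2 * g <= rt k ^ 8 * f 1] and [rt k <= k * f 1]. *)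
have [k3 h3] := rt_large R (2 * g / f 1 + (f 1)^-1).
have [k4 h4] := eps_nat R (2 * g) _ e3.
have [k kmax fk] := slow (maxn (maxn k1 k2) (maxn (maxn k3 k4) (n0 + 2))).
have kp : (0 < k)%N by lia.
have k1p : (0 < k.-1)%N by lia.
have k1k : (k.-1 < k)%N by lia.
have n0k : (n0 <= k)%N by lia.
have hd := h1 k ltac:(lia).
have h2k := h2 k ltac:(lia).
have h4k := h4 k ltac:(lia).
have rk := h3 k ltac:(lia).
have r1 := rt_ge1 R k kp.
have r0 : 0 < rt k :> R by lra.
have f1i : 0 < (f 1)^-1 by rewrite invr_gt0.
have gf : 0 < 2 * g / f 1 by rewrite divr_gt0// mulr_gt0.
have [n [kn _ hn]] := low_rare k kp hd.
pose t := k%:R * f 1.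
have tk : rt k <= t.
  rewrite /t -(rtX R k) -[32%N]/(30.+2) exprS -mulrA ler_peMr ?(ltW r0)//.
  rewrite exprSr -mulrA mulr_ege1 ?exprn_ege1//.
  by rewrite -ler_pdivrMr// mul1r; lra.
have t0 : 0 <= t by lra.
have D_ge : (2 * g) ^+ k.-1 <= growth f t k.
  have fk1 := f_gt0 _ k1p.
  apply: le_trans (growth_lower R f f_gt0 f_le t k.-1 k t0 k1p k1k).
  have g2 : 0 <= 2 * g by rewrite mulr_ge0// ltW.
  have tf : 0 <= t / f k.-1 by rewrite divr_ge0// ltW.
  apply: lerXn2r => //.
  rewrite ler_pdivlMr// (le_trans (y := 2 * g * rt k ^+ 24))//.
    apply: ler_wpM2l; first by rewrite mulr_ge0// ltW.
    by apply: le_trans (ltW fk); apply: f_le => //; exact: ltnW.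
  rewrite /t -(rtX R k) -[32%N]/(8 + 24)%N exprD [leRHS]mulrAC; apply: ler_wpM2r.
    by rewrite exprn_ge0// ltW.
  rewrite -ler_pdivrMr//; apply: (le_trans (y := rt k)); first by lra.
  by rewrite ler_eXnr.
have n0' : (0 < n)%N := leq_trans kp kn.
have n0n := leq_trans n0k kn.
have bound1 := early_reach k t (g ^+ k) n kp hd tk (exprn_ge0 _ (ltW g0)) n0'.
have bound1' : 2 * g ^+ k / growth f t k <= e / 3.
  apply: le_trans h4k.
  apply: (le_trans (y := 2 * g ^+ k / (2 * g) ^+ k.-1)).
    apply: ler_wpM2l; first by rewrite mulr_ge0// exprn_ge0// ltW.
    by rewrite lef_pV2 ?posrE ?growth_gt0// exprn_gt0// mulr_gt0.
  rewrite -{1}[k](prednK kp) exprS exprMn.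
  have -> : 2 * (g * g ^+ k.-1) / (2 ^+ k.-1 * g ^+ k.-1) = 2 * g / 2 ^+ k.-1.
    by field; rewrite !gt_eqF// exprn_gt0.
  apply: ler_wpM2l; first by rewrite mulr_ge0// ltW.
  rewrite lef_pV2 ?posrE ?exprn_gt0 ?ltr0n// -natrX ler_nat.
  by rewrite -{1}[k](prednK kp); exact: ltn_expl.
pose A1 := [set w | low k (hist n w)].
pose A2 := [set w | [/\ valid (hist n w), ~ low k (hist n w) & clock t (hist n w) <= g ^+ k]].
pose A3 := [set w | (0 < mult c (hist n0 w))%N] `&` ([set w | g <= clock (f 1) (hist n w)]
   `&` last_draw c n0).
have mA1 : measurable A1 by exact: (mhist (low k)).
have mA2 : measurable A2.
  exact: (mhist (fun h => [/\ valid h, ~ low k h & clock t h <= g ^+ k])).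
have mG : measurable [set w | g <= clock (f 1) (hist n w)].
  exact: (mhist (fun h => g <= clock (f 1) h)).
have mL := measurable_last_draw c n0.
have mG' : measurable ([set w | g <= clock (f 1) (hist n w)] `&` last_draw c n0).
  exact: measurableI.
have mA3 : measurable A3.
  by apply: measurableI => //; exact: (mhist (fun h => 0 < mult c h)%N).
have PA3 : Pr A3 <= 2 ^+ n0 / g.
  apply: (Pr_cyl_cond n0 (fun h => 0 < mult c h)%N) => //.
    by rewrite divr_ge0 ?exprn_ge0// ltW.
  move=> h vh hn0 mc.
  have n00 : (0 < n0)%N by rewrite -hn0; case: (h) mc.
  have nn : (0 < n0 <= n)%N by rewrite n00.
  apply: le_trans (undrawn_bound c n0 n h g vh hn0 nn mc g0).
  apply: le_Pr.
  - by apply: measurableI => //; exact: (mhist (fun g => g = h)).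
  - apply: measurableI; first exact: (mhist (fun g => g = h)).
    exact: (mhist (fun i => (mult c i <= mult c h)%N /\ g <= clock (f 1) i)).
  move=> w [hw [gw [_ lw]]]; split=> //; split=> //.
  have e' : hist n0 w = h by rewrite -hn0; exact: hw.
  by have := lw n; rewrite e'.
apply: (Pr_valid_bound _ (A1 `|` (A2 `|` A3)) n) => //.
- by apply: measurableU => //; exact: measurableU.
- move=> w Lw vw; case: (pselect (low k (hist n w))) => lw; first by left.
  right; have [ca|ac] := leP (clock t (hist n w)) (g ^+ k); [left|right] => //.
  split; [by case: Lw|split=> //] => /=.
  have := lt_le_trans ac (clock_pow R f p f_gt0 p01 (f 1) k (hist n w) (ltW f1_gt0) vw).
  have cf := clock_gt0 R f p f_gt0 p01 (f 1) (hist n w) (ltW f1_gt0) vw.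
  by rewrite ltr_pXn2r ?nnegrE ?(ltW g0) ?(ltW cf)// => /ltW.
have m23 : measurable (A2 `|` A3) by exact: measurableU.
have := PrU_le _ _ mA1 m23; have := PrU_le _ _ mA2 mA3.
rewrite -/A1 in hn; rewrite -/A2 in bound1.
lra.
Qed.

Lemma Pr_bigcup0 (A : nat -> set T) : (forall n, measurable (A n)) ->
  (forall n, Pr (A n) = 0) -> Pr (\bigcup_n A n) = 0.
Proof.
move=> mA A0; have mU := bigcupT_measurable _ mA.
apply: EFin_inj; rewrite -PrE//.
apply/(negligibleP _ mU)/negligible_bigcup => n.
have e : P (A n) = 0%E by rewrite PrE// A0.
by apply/(negligibleP _ (mA n)); exact: e.
Qed.

(** In the slow case color 1 suffices: it is present from time 1 on, and a bounded count would give
    it a last draw. *)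
Lemma all_finite_null : Pr (all_finite) = 0.
Proof.
have [fast|slow] := pselect (exists k0, forall j, (k0 <= j)%N -> rt j ^+ 24 <= f j).
  exact: (all_finite_null_fast).
have {}slow k0 : exists2 k, (k0 <= k)%N & f k < rt k ^+ 24.
  apply: contrapT => h; apply: slow; exists k0 => j kj.
  by rewrite leNgt; apply/negP => fj; apply: h; exists j.
have mU : measurable (\bigcup_n last_draw 1 n).
  by apply: bigcupT_measurable => n; exact: measurable_last_draw.
apply/eqP; rewrite eq_le Pr_ge0 andbT.
apply: (Pr_valid_bound _ (\bigcup_n last_draw 1 n) 1) => //.
- exact: (measurable_all_finite).
- move=> w fw v1; have [L hL] := fw 1%N.
  have [n0 hn0] := bounded_stationary (fun n => mult 1 (hist n w)) L hL.
  exists n0 => //; split=> //; apply: leq_trans (hn0 1%N).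
  by rewrite valid_mult_gt0// /= colors_gt0.
rewrite Pr_bigcup0// => n; first exact: measurable_last_draw.
exact: last_draw_null_slow.
Qed.

Definition infinite (c : nat) : set T :=
  [set w | forall M, exists m, (M <= mult c (hist m w))%N].

Lemma measurable_infinite c : measurable (infinite c).
Proof.
apply: measurable_forall => M; apply: measurable_exists => m.
exact: (mhist (fun h => M <= mult c h)%N).
Qed.

(** * Two colors: abandonment and ties *)

Section Pair.
Variables c c' : nat.
Hypothesis cc' : c != c'.

(** Draws of [c] let [growth f (f 1) (mult c)] increase at rate [f 1], and a draw of [c'], which
    occurs at rate at least [f 1], kills it; the killed process is a supermartingale. *)
Lemma abandoned_bound n m L (h : history) : valid h -> size h = n -> (n <= m)%N ->
  (0 < mult c' h)%N ->
  Pr (cyl h `&` [set w | (mult c' (hist m w) <= mult c' h)%N /\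
     (L <= mult c (hist m w))%N]) <= growth f (f 1) n / growth f (f 1) L * law h.
Proof.
move=> vh hn nm mc'.
have f10 := ltW f1_gt0.
have g0 j := growth_gt0 R f f_gt0 (f 1) j f10.
set K := mult c' h in mc' *.
pose Q h := (mult c' h <= K)%N /\ (L <= mult c h)%N.
pose X h := if (mult c' h <= K)%N then growth f (f 1) (mult c h) / growth f (f 1) L else 0.
have X0 i : 0 <= X i by rewrite /X; case: ifP => // _; rewrite divr_ge0 ?(ltW (g0 _)).
apply: (le_trans (y := X h * law h)).
  apply: (terminal_domination
    (fun h => valid h /\ (K <= mult c' h)%N) Q X) => //; last by rewrite hn.
  - by move=> i [].
  - by move=> i y [vi Ki] ys; split; [rewrite /= ys|exact: leq_trans Ki (mult_le _ _ _)].
  - move=> i _ _ [Ki Li]; rewrite /X Ki ler_pdivlMr// mul1r.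
    exact: growth_le.
  move=> i [vi Ki] _ _; right.
  have hc' : (0 < c' <= colors i)%N by rewrite -valid_mult_gt0//; lia.
  have i0 : (0 < size i)%N by apply: leq_trans (colors_le_size i); lia.
  have e0 := speed_ge0 R f p f_gt0 p01 i vi.
  case: (leqP (mult c' i) K) => [iK|Ki']; last first.
    rewrite [leRHS]/X leqNgt Ki' /=.
    rewrite -[leRHS](expect_cst R f p f_gt0 0 i vi); apply: le_expect => // y _.
    by rewrite /X leqNgt (leq_trans Ki' (mult_le _ _ _)).
  have -> : X i = growth f (f 1) (mult c i) / growth f (f 1) L by rewrite /X iK.
  set v := growth f (f 1) (mult c i) / _.
  have v0 : 0 <= v by rewrite divr_ge0 ?(ltW (g0 _)).
  have Xle y : X (y :: i) <= growth f (f 1) (mult c (y :: i)) / growth f (f 1) L.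
    by rewrite /X; case: ifP => // _; rewrite divr_ge0 ?(ltW (g0 _)).
  pose dc := v * (f 1 / f (mult c i)).
  pose dd x := (if x == c then dc else 0) + (if x == c' then - v else 0).
  apply: (le_trans (expect_le R f p f_gt0 p01 X i C v 0 dd pC vi i0 (lexx _) _ _)).
  - rewrite addr0; apply: (le_trans (Xle _)); rewrite mult_cons/=.
    case: eqP => [e|_]; last by rewrite add0n.
    (* The birth of [c] itself changes nothing, since [growth] is 1 at level 0 as at level 1. *)
    have m0 : mult c i = 0%N by rewrite -e (valid_mult0 _ _ vi)//= ltnn.
    by rewrite /v m0 [X in _ <= X / _](_ : _ = growth f (f 1) 1)// growth1 /growth big_geq.
  - move=> x hx; rewrite /dd; case: (eqVneq x c) => [xc|xc].
      rewrite ifF ?addr0; last by rewrite xc; exact/negbTE.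
      apply: (le_trans (Xle _)); rewrite mult_cons/= xc eqxx add1n.
      have m0 : (0 < mult c i)%N by rewrite -xc valid_mult_gt0.
      by rewrite growthS// le_eqVlt; apply/orP; left; apply/eqP; rewrite /dc /v; ring.
    rewrite add0r; case: (eqVneq x c') => [xc'|xc'].
      rewrite subrr /X mult_cons /= xc' eqxx ifF//.
      by apply/negbTE; rewrite -ltnNge add1n ltnS.
    rewrite addr0; apply: (le_trans (Xle _)).
    by rewrite mult_cons/= (negbTE xc) add0n.
  rewrite gerDl; apply: mulr_ge0_le0 => //.
  under eq_bigr do rewrite mulr0 addr0 /dd mulrDr.
  rewrite big_split/= (sum_single _ _ c'); last by lia.
  have fK : f 1 <= f (mult c' i) by apply: f_le => //; rewrite valid_mult_gt0.
  apply: (le_trans (y := f 1 * v + f (mult c' i) * - v)); last first.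
    by rewrite mulrN subr_le0; exact: ler_wpM2r.
  rewrite lerD2r.
  case: (boolP (0 < c <= colors i)%N) => hc.
    rewrite sum_single//.
    have m0 : (0 < mult c i)%N by rewrite valid_mult_gt0.
    have fm := f_gt0 _ m0.
    by rewrite /dc le_eqVlt; apply/orP; left; apply/eqP; field; rewrite gt_eqF.
  apply: (le_trans (y := 0)); last exact: mulr_ge0.
  rewrite big_nat_cond big1// => x; rewrite andbT => hx.
  by rewrite ifF ?mulr0//; apply/negbTE/eqP => xc; move: hc; rewrite -xc; lia.
rewrite /X leqnn; apply: ler_wpM2r; first exact: law_pos.
apply: ler_wpM2r; first by rewrite invr_ge0 ltW.
apply: growth_le => //; rewrite -hn; exact: count_size.
Qed.

(** By [growth_ge_sum], divergence makes [growth f (f 1) L] unbounded in [L], so the bound of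
    [abandoned_bound] vanishes. *)
Lemma abandoned_null n :
  (forall A, exists L, A <= \sum_(1 <= i < L) (f i)^-1) ->
  Pr (last_draw c' n `&` infinite c) = 0.
Proof.
move=> div; apply: Pr_eq0 => e e0.
have f10 := ltW f1_gt0.
have mL := measurable_last_draw c' n.
have mI := measurable_infinite c.
have [L hL] := div (growth f (f 1) n / e / f 1).
have gL : growth f (f 1) n / growth f (f 1) L <= e.
  rewrite ler_pdivrMr ?growth_gt0// mulrC -ler_pdivrMr//.
  apply: le_trans (growth_ge_sum R f f_gt0 _ L f10).
  apply: (le_trans (y := f 1 * \sum_(1 <= i < L) (f i)^-1)); last by rewrite lerDr.
  by rewrite [leRHS]mulrC -ler_pdivrMr.
rewrite (_ : _ `&` _ = [set w | (0 < mult c' (hist n w))%N] `&`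
   (last_draw c' n `&` infinite c)); last first.
  by apply/seteqP; split=> w /=; [move=> [[? ?] ?]; split|case].
apply: (Pr_cyl_cond n (fun h => 0 < mult c' h)%N).
- exact: measurableI.
- exact: ltW.
move=> h vh hn mc'.
pose O m := cyl h `&` (last_draw c' n `&` [set w | (L <= mult c (hist m w))%N]).
have mO m : measurable (O m).
  apply: measurableI; first exact: (mhist (fun g => g = h)).
  by apply: measurableI => //; exact: (mhist (fun h => L <= mult c h)%N).
apply: (le_trans (y := Pr (\bigcup_m O m))).
  apply: le_Pr.
  - apply: measurableI; first exact: (mhist (fun g => g = h)).
    exact: measurableI.
  - exact: bigcupT_measurable.
  by move=> w [hw [lw iw]]; have [m hm] := iw L; exists m.
apply: Pr_bigcup_le => //.
  move=> i j ij w [hw [lw Lw]]; split=> //; split=> //.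
  by apply: leq_trans Lw _; exact: mult_hist_le.
move=> m; apply: (le_trans (y := growth f (f 1) n / growth f (f 1) L * law h)); last first.
  by apply: ler_wpM2r => //; exact: law_pos.
apply: le_trans (abandoned_bound n (maxn m n) L h vh hn (leq_maxr _ _) mc').
apply: le_Pr => //.
  apply: measurableI; first exact: (mhist (fun g => g = h)).
  exact: (mhist (fun g => (mult c' g <= mult c' h)%N /\ (L <= mult c g)%N)).
move=> w [hw [[_ lw] Lw]]; split=> //; split.
  have e' : hist n w = h by rewrite -hn; exact: hw.
  by have := lw (maxn m n); rewrite e'.
by apply: leq_trans Lw _; apply: mult_hist_le; exact: leq_maxl.
Qed.

Definition both (k m : nat) : set T :=
  [set w | (k <= mult c (hist m w))%N /\ (k <= mult c' (hist m w))%N].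

Lemma measurable_both k m : measurable (both k m).
Proof. exact: (mhist (fun h => (k <= mult c h)%N /\ (k <= mult c' h)%N)). Qed.

(** * Excluding ties by the rotation martingale *)

Section Rotating.
Variables (t tau : R) (L k : nat).
Hypothesis t_ge0 : 0 <= t.
Hypothesis tau01 : 0 < tau <= 1.
Hypothesis k_gt0 : (0 < k <= L)%N.
Hypothesis close : forall j, (L <= j)%N -> growth f t j <= (1 + 1 / 8) * growth f t L.
Local Notation inner := (rot_dot R f t).
Hypothesis small : inner k k <= tau ^+ 2 * inner L L.

Let Z (h : history) := inner (mult c h) (mult c' h).

(** The AM-GM bounds with parameter [tau]: the squared length at level [i <= k] is at most [tau ^ 2]
    times that at [L], and at any level at most twice that at [L]. *)
Lemma inner_small i j : (0 < i <= k)%N -> (0 < j)%N ->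
  - (2 * tau * inner L L) <= inner i j <= 2 * tau * inner L L.
Proof.
move=> /andP[i0 ik] j0; have /andP[tau0 tau1] := tau01.
have L0 : (0 < L)%N by lia.
have N0 := inner_norm_ge1 R f t L.
have hj := inner_norm_max R f f_gt0 t t_ge0 L L0 close j.
have hi : inner i i / tau <= tau * inner L L.
  rewrite ler_pdivrMr//; apply: (le_trans (inner_norm_le R f t i k i0 ik)).
  by apply: (le_trans small); rewrite expr2 mulrAC.
have hj' := ler_wpM2l (ltW tau0) hj.
have tN : 0 <= tau * inner L L by rewrite mulr_ge0 ?(ltW tau0)//; lra.
have := inner_ge R f t i j tau tau0; have := inner_le R f t i j tau tau0.
by move=> h1 h2; apply/andP; split; lra.
Qed.

Lemma inner_sym i j : inner i j = inner j i.
Proof. by rewrite /rot_dot [(rot R f t i).1 * _]mulrC [(rot R f t i).2 * _]mulrC. Qed.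

(** Births and draws of other colors leave [Z] unchanged, and the contributions of [c] and [c']
    cancel by [inner_drift]. *)
Lemma inner_super h : valid h -> (0 < mult c h)%N -> (0 < mult c' h)%N ->
  E Z h <= Z h.
Proof.
move=> vh mc mc'.
have hc : (0 < c <= colors h)%N by rewrite -valid_mult_gt0.
have hc' : (0 < c' <= colors h)%N by rewrite -valid_mult_gt0.
have h0 : (0 < size h)%N by apply: leq_trans (colors_le_size h); lia.
pose d1 := inner (mult c h).+1 (mult c' h) - inner (mult c h) (mult c' h).
pose d2 := inner (mult c h) (mult c' h).+1 - inner (mult c h) (mult c' h).
pose dd x := (if x == c then d1 else 0) + (if x == c' then d2 else 0).
apply: (le_trans (expect_le R f p f_gt0 p01 Z h C (Z h) 0 dd pC vh h0 (lexx _) _ _)).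
- have e1 : ((colors h).+1 == c) = false.
    by apply/negbTE/eqP => e; move: hc; rewrite -e ltnn andbF.
  have e2 : ((colors h).+1 == c') = false.
    by apply/negbTE/eqP => e; move: hc'; rewrite -e ltnn andbF.
  by rewrite addr0 /Z !mult_cons/= e1 e2.
- move=> x hx; rewrite /dd /Z !mult_cons/=; case: (eqVneq x c) => [xc|xc].
    rewrite xc (negbTE cc') addr0 add1n add0n /d1.
    by rewrite addrC subrK.
  rewrite !add0n add0r; case: (eqVneq x c') => [xc'|xc'].
    by rewrite add1n /d2 addrC subrK.
  by rewrite addr0 add0n.
under eq_bigr do rewrite mulr0 addr0 /dd mulrDr.
rewrite big_split/= (sum_single _ _ c)// (sum_single _ _ c')//.
by rewrite /d1 /d2 (inner_drift R f f_gt0 t) ?mulr0 ?addr0.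
Qed.

(** In units of [inner L L], the martingale starts at most at [2 * tau]. At time [m] it is at least
    [5 / 2 - 2 = 1 / 2] if both levels are at least [L], at least [- 2] if both are only known to be
    at least [k], and at least [- 2 * tau] otherwise. *)
Lemma tie_bound (h : history) m : valid h -> (size h <= m)%N ->
  (0 < mult c h <= k)%N -> (0 < mult c' h)%N ->
  5 / 2 * Pr (cyl h `&` both L m) <=
  2 * Pr (cyl h `&` both k m) + 4 * tau * law h.
Proof.
move=> vh hm /andP[mc mck] mc'; have /andP[tau0 tau1] := tau01.
have /andP[k0 kL] := k_gt0.
have L0 : (0 < L)%N by lia.
set N := inner L L; have N1 : 1 <= N := inner_norm_ge1 R f t L.
have N0 : 0 < N by lra.
pose G h := N * (5 / 2 * Pr (cyl h `&` both L m) - 2 * Pr (cyl h `&` both k m)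
  - 2 * tau * law h).
suff : G h <= Z h * law h.
  have hck : (0 < mult c h <= k)%N by rewrite mc.
  have /andP[_ hZ] := inner_small (mult c h) (mult c' h) hck mc'.
  have := ler_wpM2r (law_pos h vh) hZ.
  rewrite -/N -/(Z h) => h1 h2; have := le_trans h2 h1.
  rewrite (_ : 2 * tau * N * law h = N * (2 * tau * law h)); last by ring.
  by rewrite /G ler_pM2l//; lra.
apply: (backward_domination R f p f_gt0 p01
  (fun h => [/\ valid h, (0 < mult c h)%N & (0 < mult c' h)%N]) G Z m) => //.
- by move=> i [].
- move=> i y [vi ic ic'] _ ys; split; first by rewrite /= ys.
    exact: leq_trans ic (mult_le _ _ _).
  exact: leq_trans ic' (mult_le _ _ _).
- move=> i [vi _ _] _; rewrite /G -mulr_sumr; congr (N * _).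
  have sc := Pr_cyl_succs i.
  rewrite (sc _ (measurable_both L m) vi) (sc _ (measurable_both k m) vi).
  have : law i = \sum_(y <- succs i) law (y :: i).
    rewrite -Pr_cyl -[cyl i]setIT (sc _ measurableT vi).
    by apply: eq_bigr => y _; rewrite setIT Pr_cyl.
  move=> ->; rewrite !mulr_sumr -!sumrB.
  by [].
- move=> i [vi ic ic'] im.
  have E1 l : (l <= mult c i)%N -> (l <= mult c' i)%N -> Pr (cyl i `&` both l m) = law i.
    move=> h1 h2; rewrite -Pr_cyl; congr Pr; apply/seteqP; split=> w; first by case.
    by move=> iw; split=> //; rewrite /both/= -im iw.
  have E0 l : ~~ ((l <= mult c i) && (l <= mult c' i))%N -> Pr (cyl i `&` both l m) = 0.
    move=> h1; rewrite (_ : _ `&` _ = set0) ?Pr0//.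
    apply/seteqP; split=> w //=; rewrite /both/= -im => -[-> [h2 h3]].
    by move: h1; rewrite h2 h3.
  have li := law_pos i vi.
  case: (boolP ((L <= mult c i) && (L <= mult c' i))%N) => [/andP[L1 L2]|nL].
    rewrite /G (E1 L L1 L2) (E1 k (leq_trans kL L1) (leq_trans kL L2)).
    have := inner_late R f f_gt0 t t_ge0 L L0 close _ _ L1 L2.
    rewrite -/N -/(Z i) => hZ; have := ler_wpM2r li hZ; apply: le_trans.
    rewrite (_ : N / 2 * law i = N * (1 / 2 * law i)); last by ring.
    rewrite ler_pM2l//.
    have : 0 <= tau * law i by rewrite mulr_ge0// ltW.
    by lra.
  case: (boolP ((k <= mult c i) && (k <= mult c' i))%N) => [/andP[k1 k2]|nk].
    rewrite /G (E0 L)// (E1 k)//.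
    have := inner_ge R f t (mult c i) (mult c' i) 1 ltr01; rewrite -/(Z i) => hZ.
    have h1 := inner_norm_max R f f_gt0 t t_ge0 L L0 close (mult c i).
    have h2 := inner_norm_max R f f_gt0 t t_ge0 L L0 close (mult c' i).
    have hZ' : N * - 2 <= Z i by move: hZ h1 h2; rewrite -/N divr1; lra.
    have := ler_wpM2r li hZ'; apply: le_trans.
    rewrite [leRHS](_ : _ = N * (- 2 * law i)); last by ring.
    rewrite ler_pM2l//.
    have : 0 <= tau * law i by rewrite mulr_ge0// ltW.
    by lra.
  rewrite /G (E0 L)// (E0 k)//.
  have hZ : - (2 * tau * N) <= Z i.
    have [h1|h1] := leqP (mult c i) k.
      have h2 : (0 < mult c i <= k)%N by rewrite ic.
      by have /andP[] := inner_small (mult c i) (mult c' i) h2 ic'.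
    have h2 : (0 < mult c' i <= k)%N.
      rewrite ic' leqNgt; apply: contra nk => kc.
      by rewrite (ltnW h1) (ltnW kc).
    by have /andP[] := inner_small (mult c' i) (mult c i) h2 ic; rewrite inner_sym.
  have := ler_wpM2r li hZ; apply: le_trans.
  rewrite !mulr0 subr0 sub0r mulrN mulNr lerN2 le_eqVlt; apply/orP; left; apply/eqP; ring.
by move=> i [vi ic ic'] _; right; exact: inner_super.
Qed.

End Rotating.

(** Inside the cylinder of a history with both colors, the events [W k] that both reach level [k]
    decrease to an event of probability [e] that contains the tie. For large [k < L], [tie_bound]
    then says nearly [5 / 2 * e <= 2 * e]. *)
Lemma tie_null : (exists A, forall j, \sum_(1 <= i < j) (f i)^-1 <= A) ->
  Pr (infinite c `&` infinite c') = 0.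
Proof.
move=> [A hA].
have mI := measurable_infinite c; have mI' := measurable_infinite c'.
have mII : measurable (infinite c `&` infinite c') by exact: measurableI.
pose present n := [set w | (0 < mult c (hist n w))%N /\ (0 < mult c' (hist n w))%N].
have mp n : measurable (present n).
  exact: (mhist (fun h => (0 < mult c h)%N /\ (0 < mult c' h)%N)).
have -> : infinite c `&` infinite c' = \bigcup_n (present n `&` (infinite c `&` infinite c')).
  apply/seteqP; split=> w; last by case=> n _ [].
  move=> [iw iw']; have [m hm] := iw 1%N; have [m' hm'] := iw' 1%N.
  exists (maxn m m') => //; split=> //; split.
    by apply: leq_trans hm _; apply: mult_hist_le; exact: leq_maxl.
  by apply: leq_trans hm' _; apply: mult_hist_le; exact: leq_maxr.
apply: (Pr_bigcup0) => n; first exact: measurableI.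
apply/eqP; rewrite eq_le Pr_ge0 andbT.
apply: (Pr_cyl_cond n
  (fun h => (0 < mult c h)%N /\ (0 < mult c' h)%N)) => //.
move=> h vh hn [mc mc']; rewrite mul0r.
have mC : measurable (cyl h) by exact: (mhist (fun g => g = h)).
pose V k m := cyl h `&` both k m.
have mV k m : measurable (V k m) by apply: measurableI => //; exact: measurable_both.
pose W k := \bigcup_m V k m.
have mW k : measurable (W k) by exact: bigcupT_measurable.
have Vmono k i j : (i <= j)%N -> V k i `<=` V k j.
  move=> ij w [hw [h1 h2]]; split=> //; split.
    by apply: leq_trans h1 _; exact: mult_hist_le.
  by apply: leq_trans h2 _; exact: mult_hist_le.
have Wanti i j : (i <= j)%N -> W j `<=` W i.
  move=> ij w [m _ [hw [h1 h2]]]; exists m => //; split=> //; split.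
    exact: leq_trans ij h1.
  exact: leq_trans ij h2.
have cW := Pr_bigcap_cvg W mW Wanti.
have mIW : measurable (\bigcap_k W k) by exact: bigcapT_measurable.
apply: (le_trans (y := Pr (\bigcap_k W k))).
  apply: le_Pr => //; first exact: measurableI.
  move=> w [hw [iw iw']] k _; have [m hm] := iw k; have [m' hm'] := iw' k.
  exists (maxn m m') => //; split=> //; split.
    by apply: leq_trans hm _; apply: mult_hist_le; exact: leq_maxl.
  by apply: leq_trans hm' _; apply: mult_hist_le; exact: leq_maxr.
set e := Pr (\bigcap_k W k) in cW *.
rewrite leNgt; apply/negP => e0.
(* With an error [tau] in each approximation, [tie_bound] yields [e / 2 <= 17 / 2 * tau],
   contradicting [tau <= e / 32]. *)
pose tau := Num.min 1 (e / 32).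
have tau0 : 0 < tau by rewrite /tau lt_min ltr01/= divr_gt0.
have tau1 : tau <= 1 by rewrite /tau ge_min lexx.
have taue : tau <= e / 32 by rewrite /tau ge_min lexx orbT.
have [k1 _ hk1] := (cvgrPdist_le _ _).1 cW tau tau0.
pose k := maxn k1 (mult c h).+1.
have k0 : (0 < k)%N by lia.
have fk := f_gt0 k k0.
(* With this rate, the single factor at level [k] multiplies the squared length by
   [1 + 1 / tau ^ 2], whence [small]. *)
pose t := f k / tau.
have t0 : 0 <= t by rewrite divr_ge0 ?ltW.
have e8 : 0 < 1 / 8 :> R by lra.
have [L0 hL0] := growth_stabilizes R f f_gt0 t A (1 / 8) t0 e8 hA.
pose L := maxn L0 k.+1.
have small : rot_dot R f t k k <= tau ^+ 2 * rot_dot R f t L L.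
  apply: (le_trans (y := tau ^+ 2 * rot_dot R f t k.+1 k.+1)).
    rewrite inner_normS// /t.
    have -> : f k / tau / f k = tau^-1 by field; rewrite !gt_eqF.
    have -> : tau ^+ 2 * (rot_dot R f t k k * (1 + tau^-1 ^+ 2)) =
      rot_dot R f t k k * (tau ^+ 2 + 1) by field; rewrite gt_eqF.
    rewrite ler_peMr ?lerDr ?sqr_ge0//.
    by apply: le_trans (inner_norm_ge1 R f t k).
  apply: ler_wpM2l; first exact: sqr_ge0.
  by apply: inner_norm_le => //; exact: leq_maxr.
have cV := Pr_bigcup_cvg (V L) (mV L) (Vmono L).
have [m1 _ hm1] := (cvgrPdist_le _ _).1 cV tau tau0.
pose m := maxn m1 n.
have kL : (0 < k <= L)%N by rewrite k0 (leq_trans (leqnSn k))// leq_maxr.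
have tau01 : 0 < tau <= 1 by rewrite tau0.
have mck : (0 < mult c h <= k)%N by rewrite mc (leq_trans (leqnSn _))// leq_maxr.
have hm : (size h <= m)%N by rewrite hn leq_maxr.
have := tie_bound t tau L k t0 tau01 kL (fun j _ => hL0 L j (leq_maxl _ _)) small
  h m vh hm mck mc'.
have law1 : law h <= 1.
  by rewrite -Pr_cyl -(PrT); apply: le_Pr => //; exact: measurableT.
have VW : Pr (V k m) <= Pr (W k) by apply: le_Pr => // w hw; exists m.
have We : e <= Pr (W L) by apply: le_Pr => // w hw; exact: hw.
have := hk1 k (leq_maxl _ _); rewrite /= ler_distlC => /andP[_ hWk].
have := hm1 m (leq_maxl _ _); rewrite /= ler_distlC => /andP[hVL _].
rewrite -/(V L m) -/(V k m) -/(W L) in hVL *.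
have law0 := law_pos h vh.
have : tau * law h <= tau by rewrite ler_piMr// ltW.
by move: hWk hVL; lra.
Qed.

End Pair.

End Urn.

(** * Extended-real series and their partial sums *)

Section Series.
Variables (R : realType) (u : nat -> R).
Hypothesis u_ge0 : forall n, (0 < n)%N -> 0 <= u n.

Lemma nneseries_fin_bounded : (\sum_(1 <= n <oo) (u n)%:E < +oo)%E ->
  exists A, forall j, \sum_(1 <= i < j) u i <= A.
Proof.
have u0 n : (1 <= n)%N -> xpredT n -> (0 <= (u n)%:E)%E by move=> n1 _; rewrite lee_fin u_ge0.
move=> fin; exists (fine (\sum_(1 <= n <oo) (u n)%:E)%E) => j.
rewrite -lee_fin fineK; first by rewrite -sumEFin; exact: nneseries_lim_ge.
by rewrite ge0_fin_numE// nneseries_ge0.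
Qed.

Lemma nneseries_pinfty_unbounded : (\sum_(1 <= n <oo) (u n)%:E = +oo)%E ->
  forall A, exists j, A <= \sum_(1 <= i < j) u i.
Proof.
have u0 n : (1 <= n)%N -> xpredT n -> (0 <= (u n)%:E)%E by move=> n1 _; rewrite lee_fin u_ge0.
move=> inf A; apply: contrapT => nA.
suff : (\sum_(1 <= n <oo) (u n)%:E <= A%:E)%E by rewrite inf leye_eq.
apply: lime_le; first exact: is_cvg_nneseries.
apply: nearW => j; rewrite sumEFin lee_fin leNgt; apply/negP => /ltW Aj.
by apply: nA; exists j.
Qed.

End Series.

(** * Null sets and the final assembly *)

Lemma ae_of_null (R : realType) (d : measure_display) (T : measurableType d)
    (P : probability T R) (N : set T) (Q : T -> Prop) :
  measurable N -> Pr P N = 0 -> (forall w, ~ N w -> Q w) -> {ae P, forall w, Q w}.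
Proof.
move=> mN N0 NQ; exists N; split=> //; first by rewrite PrE// N0.
by move=> w nQ; apply: contrapT => nN; apply: nQ; exact: NQ.
Qed.

Lemma Pr_setU0 (R : realType) (d : measure_display) (T : measurableType d)
    (P : probability T R) (A A' : set T) :
  measurable A -> measurable A' -> Pr P A = 0 -> Pr P A' = 0 -> Pr P (A `|` A') = 0.
Proof.
move=> mA mA' A0 A'0; apply/eqP; rewrite eq_le Pr_ge0 andbT.
by apply: (le_trans (PrU_le P _ _ mA mA')); rewrite A0 A'0 addr0.
Qed.

Theorem theorem3p2 (R : realType) (d : measure_display) (T : measurableType d)
  (P : probability T R) (F : R -> R) (p : nat -> R)
  (B : nat -> T -> bool) (S : nat -> T -> nat) :
  (* update function F : [1, oo) -> [0, oo), strictly increasing, F(1) > 0 *)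
  (forall x, 1 <= x -> 0 <= F x) ->
  (forall x y, 1 <= x -> x < y -> F x < F y) ->
  0 < F 1 ->
  (* p_n in (0, 1) for n >= 1, and p_n <= p < 1 *)
  (forall n, (1 <= n)%N -> 0 < p n < 1) ->
  (exists q : R, q < 1 /\ forall n, (1 <= n)%N -> p n <= q) ->
  is_triggered_urn P F p B S ->
  ((\sum_(1 <= n <oo) ((F n%:R)^-1)%:E < +oo)%E ->
     {ae P, forall w, exists c : nat,
        (forall M : nat, exists n, (M <= kcount (S^~ w) n c)%N) /\
        (forall c' : nat, c' <> c ->
           exists M : nat, forall n, (kcount (S^~ w) n c' <= M)%N)})
  /\
  ((\sum_(1 <= n <oo) ((F n%:R)^-1)%:E = +oo)%E ->
     {ae P, forall w, forall c : nat,
        (1 <= c)%N -> (exists n, (c <= ncol (B^~ w) n)%N) ->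
        forall M : nat, exists n, (M <= kcount (S^~ w) n c)%N}).
Proof.
move=> _ F_lt F1 p01 [q [q1 pq]] urnP.
pose f := fun j : nat => F j%:R.
have f_le i j : (0 < i)%N -> (i <= j)%N -> f i <= f j.
  move=> i0; rewrite leq_eqVlt => /orP[/eqP->//|ij].
  by apply/ltW/F_lt; rewrite ?ler1n ?ltr_nat.
have f_gt0 j : (0 < j)%N -> 0 < f j by move=> j0; exact: lt_le_trans F1 (f_le 1%N j isT j0).
have u_ge0 n : (0 < n)%N -> 0 <= (f n)^-1 by move=> n0; rewrite invr_ge0 ltW// f_gt0.
(* Since [p n <= q], the odds [p n / (1 - p n)] of a birth are at most [q / (1 - q)]. *)
pose C := q / (1 - q).
have q0 : 0 <= q by case/andP: (p01 1%N isT) => h _; apply: ltW (lt_le_trans h (pq _ _)).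
have C_ge0 : 0 <= C by rewrite divr_ge0// subr_ge0 ltW.
have pC n : (0 < n)%N -> p n <= C * (1 - p n).
  move=> n0; have := pq n n0; rewrite /C mulrAC ler_pdivlMr ?subr_gt0//.
  by move: (p n) => x xq; nra.
have fin0 := all_finite_null P F p B S urnP f_gt0 f_le p01 C C_ge0 pC.
have mfin := measurable_all_finite P F p B S urnP.
have minf := measurable_infinite P F p B S urnP.
have ex_inf w : ~ all_finite B S w -> exists c, infinite B S c w.
  move=> nfin; apply: contrapT => ninf; apply: nfin => c.
  apply: contrapT => nL; apply: ninf; exists c => M.
  apply: contrapT => nM; apply: nL; exists M => n; rewrite leqNgt; apply/negP => Mn.
  by apply: nM; exists n; exact: ltnW.
have not_inf w c : ~ infinite B S c w -> exists M, forall n, (mult c (hist B S n w) <= M)%N.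
  move=> ninf; apply: contrapT => nM; apply: ninf => M.
  apply: contrapT => h; apply: nM; exists M => n; rewrite leqNgt; apply/negP => Mn.
  by apply: h; exists n; exact: ltnW.
split=> [conv|div].
  have [A hA] := nneseries_fin_bounded R _ u_ge0 conv.
  (* Outside [all_finite] some color is infinite, and outside all ties there is no second one. *)
  pose Tie c c' := if c == c' then set0 else infinite B S c `&` infinite B S c'.
  have mTie c c' : measurable (Tie c c').
    by rewrite /Tie; case: ifP => // _; exact: measurableI.
  have mU c : measurable (\bigcup_c' Tie c c') by exact: bigcupT_measurable.
  apply: (ae_of_null R d T P (all_finite B S `|` \bigcup_c \bigcup_c' Tie c c')).
  - by apply: measurableU => //; exact: bigcupT_measurable.
  - apply: Pr_setU0 => //; first exact: bigcupT_measurable.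
    apply: Pr_bigcup0 => // c; apply: Pr_bigcup0 => // c'.
    rewrite /Tie; case: ifPn => [_|cc']; first exact: Pr0.
    by apply: (tie_null P F p B S urnP f_gt0 p01 C C_ge0 pC c c' cc'); exists A.
  move=> w nN; have [c ic] := ex_inf w (fun h => nN (or_introl h)).
  exists c; split=> [M|c' c'c].
    by have [n hn] := ic M; exists n; rewrite -(mult_past (B^~ w)).
  have [|M hM] := not_inf w c'.
    move=> ic'; apply: nN; right; exists c => //; exists c' => //.
    by rewrite /Tie ifF//; apply/negbTE/eqP => e; apply: c'c.
  by exists M => n; rewrite -(mult_past (B^~ w)); exact: hM.
have hdiv := nneseries_pinfty_unbounded R _ u_ge0 div.
(* If [c] is infinite and an observed [c'] is not, then [c'] has a last draw, which is one of these
   null events. *)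
pose Left c c' n := if c == c' then set0 else last_draw B S c' n `&` infinite B S c.
have mLeft c c' n : measurable (Left c c' n).
  rewrite /Left; case: ifP => // _; apply: measurableI => //.
  exact: (measurable_last_draw P F p B S urnP).
have mU2 c c' : measurable (\bigcup_n Left c c' n) by exact: bigcupT_measurable.
have mU1 c : measurable (\bigcup_c' \bigcup_n Left c c' n) by exact: bigcupT_measurable.
have mI n : measurable [set w | ~~ valid (hist B S n w)].
  exact: (measurable_hist P F p B S urnP (fun h => ~~ valid h)).
apply: (ae_of_null R d T P ((all_finite B S `|` \bigcup_n [set w | ~~ valid (hist B S n w)]) `|`
   \bigcup_c \bigcup_c' \bigcup_n Left c c' n)).
- by apply: measurableU; [apply: measurableU => //|]; exact: bigcupT_measurable.
- apply: Pr_setU0.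
  + by apply: measurableU => //; exact: bigcupT_measurable.
  + exact: bigcupT_measurable.
  + apply: Pr_setU0 => //; first exact: bigcupT_measurable.
    by apply: Pr_bigcup0 => // n; exact: (Pr_invalid P F p B S urnP f_gt0 p01).
  apply: Pr_bigcup0 => // c; apply: Pr_bigcup0 => // c'; apply: Pr_bigcup0 => // n.
  rewrite /Left; case: ifPn => [_|cc']; first exact: Pr0.
  exact: (abandoned_null P F p B S urnP f_gt0 f_le p01 C C_ge0 pC c c' cc' n hdiv).
move=> w nN c' c'1 [n hn].
have [c ic] := ex_inf w (fun h => nN (or_introl (or_introl h))).
have vn : valid (hist B S n w).
  by apply: contrapT => /negP h; apply: nN; left; right; exists n.
(* Validity turns a label among the first [ncol] ones into a positive count. *)
have mc' : (0 < mult c' (hist B S n w))%N.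
  by rewrite valid_mult_gt0// c'1 /hist colors_past.
suff ic' : infinite B S c' w.
  by move=> M; have [m hm] := ic' M; exists m; rewrite -(mult_past (B^~ w)).
apply: contrapT => nic'.
have [M hM] := not_inf w c' nic'.
have [n0 hn0] := bounded_stationary (fun n => mult c' (hist B S n w)) M hM.
apply: nN; right; exists c => //; exists c' => //; exists n0 => //.
rewrite /Left ifF; last by apply/negbTE/eqP => e; apply: nic'; rewrite -e.
by split=> //; split=> //; exact: leq_trans mc' (hn0 n).
Qed.
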